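(* There is a polynomial-time randomized approximation algorithm for MAX $k$-CSP$_d$ and absolute constants $c>0$, $p>0$ such that, given any instance $\mathcal{I}$, with probability at least $p$ it finds an assignment that satisfies at least $c\cdot \min(kd, e^{k/8})\, OPT(\mathcal{I})/d^k$ clauses, i.e. at least $\Omega\left(\min(kd, e^{k/8})\, OPT(\mathcal{I})/d^k\right)$ clauses with constant probability.
   Context: An instance $\mathcal{I}$ of MAX CSP$_d$ consists of a finite set of indices $X$, one variable $x_u$ for each $u \in X$ taking values in $[d]=\{1,\dots,d\}$, and a finite set $\mathcal{C}$ of clauses. Each clause $C$ is a set of pairs $(u,i)$ with $u\in X$, $i\in[d]$, and no clause contains two pairs $(u,i),(u,j)$ with $i\ne j$. An assignment $x^*$ satisfies $C$ if $x^*_u = i$ for every $(u,i)\in C$. The value of an assignment is the number of clauses it satisfies, and $OPT(\mathcal{I})$ denotes the maximum value over all assignments. In MAX $k$-CSP$_d$, all clauses additionally have length $|C|\le k$. (A general instance whose constraints are arbitrary predicates of arity at most $k$ over $[d]$ reduces to this form by replacing each predicate with the clauses corresponding to its satisfying tuples.)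
   Formalization: The formal theorem assumes d ≥ 2; for d = 1 the claim fails with an absolute constant c (one empty clause has OPT = 1, while c·min(k, e^{k/8}) exceeds 1 for large k), and for d = 0 the bound is undefined. *)

(* Defs.v *)
From mathcomp Require Import all_boot all_order all_algebra.
From mathcomp Require Import boolp reals.

Set Implicit Arguments.
Unset Strict Implicit.
Unset Printing Implicit Defensive.

Import Order.TTheory GRing.Theory Num.Theory.

Local Open Scope nat_scope.

(** * MAX CSP_d

    The index set X is 'I_n and the domain [d] = {1, ..., d} is 'I_d, so that
    the value i is represented by i - 1. *)

Definition clause (n d : nat) := {set 'I_n * 'I_d}.

Record csp (n d : nat) := Csp {
  clauses : {set clause n d};
  clauses_consistent : forall C, C \in clauses ->
    forall (u : 'I_n) (i j : 'I_d), (u, i) \in C -> (u, j) \in C -> i = j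
}.

Definition is_kcsp (k n d : nat) (P : csp n d) : Prop :=
  forall C, C \in clauses P -> #|C| <= k.

Definition assignment (n d : nat) := {ffun 'I_n -> 'I_d}.

Definition satisfies (n d : nat) (x : assignment n d) (C : clause n d) : bool :=
  [forall q in C, x q.1 == q.2].

Definition value (n d : nat) (P : csp n d) (x : assignment n d) : nat :=
  #|[set C in clauses P | satisfies x C]|.

Definition opt (n d : nat) (P : csp n d) : nat :=
  \max_(x : assignment n d) value P x.

(** * Randomized random-access machines with logarithmic cost

    A machine has registers and a memory, both indexed by [nat] and holding
    natural numbers, and is controlled by a structured program.  Every operation
    is charged the bit length of the numbers (addresses included) it handles, so
    polynomial time here is polynomial time for Turing machines. *)

Definition bitlen (a : nat) : nat := (trunc_log 2 a).+1.

Inductive binop := Add | Sub | Mul | Div.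

Definition binop_eval (o : binop) (a b : nat) : nat :=
  match o with
  | Add => a + b
  | Sub => a - b (* truncated, hence also a comparison *)
  | Mul => a * b
  | Div => a %/ b
  end.

Inductive expr :=
| Cst of nat
| Reg of nat
| Read of expr
| Op of binop & expr & expr.

Inductive prog :=
| Skip
| Assign of nat & expr
| Write of expr & expr
| Toss of nat
| Seq of prog & prog
| Ite of expr & prog & prog
| While of expr & prog.

Record store := Store { regs : nat -> nat; mem : nat -> nat }.

Definition upd (f : nat -> nat) (a v : nat) : nat -> nat :=
  fun b => if b == a then v else f b.

Definition set_reg (s : store) (x v : nat) : store :=
  Store (upd (regs s) x v) (mem s).

Definition set_mem (s : store) (a v : nat) : store :=
  Store (regs s) (upd (mem s) a v).

Fixpoint eval (s : store) (e : expr) : nat :=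
  match e with
  | Cst a => a
  | Reg x => regs s x
  | Read e1 => mem s (eval s e1)
  | Op o e1 e2 => binop_eval o (eval s e1) (eval s e2)
  end.

Fixpoint cost (s : store) (e : expr) : nat :=
  match e with
  | Cst a => bitlen a
  | Reg x => bitlen x + bitlen (regs s x)
  | Read e1 => cost s e1 + bitlen (eval s e1) + bitlen (mem s (eval s e1))
  | Op _ e1 e2 => cost s e1 + cost s e2 + bitlen (eval s e1) + bitlen (eval s e2)
  end.

(** [exec A s r s' r' t]: program [A], started in store [s] with the sequence
    [r] of random bits ahead, halts in store [s'] with the bits [r'] left
    unread, in time [t].  A test succeeds when it evaluates to a nonzero
    number. *)
Inductive exec : prog -> store -> seq bool -> store -> seq bool -> nat -> Prop :=
| ExecSkip s r : exec Skip s r s r 1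
| ExecAssign x e s r :
    exec (Assign x e) s r (set_reg s x (eval s e)) r
      (cost s e + bitlen x + bitlen (eval s e))
| ExecWrite e1 e2 s r :
    exec (Write e1 e2) s r (set_mem s (eval s e1) (eval s e2)) r
      (cost s e1 + cost s e2 + bitlen (eval s e1) + bitlen (eval s e2))
| ExecToss x s b r :
    exec (Toss x) s (b :: r) (set_reg s x b) r (bitlen x)
| ExecSeq A1 A2 s r s1 r1 t1 s2 r2 t2 :
    exec A1 s r s1 r1 t1 -> exec A2 s1 r1 s2 r2 t2 ->
    exec (Seq A1 A2) s r s2 r2 (t1 + t2)
| ExecIteT e A1 A2 s r s1 r1 t :
    eval s e != 0 -> exec A1 s r s1 r1 t ->
    exec (Ite e A1 A2) s r s1 r1 (cost s e + t)
| ExecIteF e A1 A2 s r s1 r1 t :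
    eval s e = 0 -> exec A2 s r s1 r1 t ->
    exec (Ite e A1 A2) s r s1 r1 (cost s e + t)
| ExecWhileT e A s r s1 r1 t1 s2 r2 t2 :
    eval s e != 0 -> exec A s r s1 r1 t1 -> exec (While e A) s1 r1 s2 r2 t2 ->
    exec (While e A) s r s2 r2 (cost s e + t1 + t2)
| ExecWhileF e A s r :
    eval s e = 0 -> exec (While e A) s r s r (cost s e).

(** The input word is stored in memory from address 0 on; all else is 0. *)
Definition init_store (w : seq nat) : store :=
  Store (fun=> 0) (fun a => nth 0 w a).

Definition halts_within (A : prog) (w : seq nat) (N : nat) : Prop :=
  forall r : N.-tuple bool, exists s r' t,
    exec A (init_store w) r s r' t /\ t <= N.

(** Probability that [A] halts on [w] in a store satisfying [Q], over [N]
    independent fair bits.  A program that halts within time [N] reads at most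
    [N] of them, since each costs at least 1. *)
Definition success_prob (R : realType) (A : prog) (w : seq nat) (N : nat)
    (Q : store -> Prop) : R :=
  (#|[set r : N.-tuple bool |
      `[< exists s r' t, exec A (init_store w) r s r' t /\ Q s >]]|%:R
    / 2 ^+ N)%R.

(** * Instances as inputs, assignments as outputs *)

Definition encode_clause (n d : nat) (C : clause n d) : seq nat :=
  #|C| :: flatten [seq [:: nat_of_ord q.1; nat_of_ord q.2] | q <- enum C].

Definition encode (k n d : nat) (P : csp n d) : seq nat :=
  [:: k, d, n, #|clauses P|
    & flatten [seq encode_clause C | C <- enum (clauses P)]].

(** Bit length of the input, plus one per index since X is part of the instance
    as a set and not merely through its cardinal; k and d count in binary. *)
Definition input_size (k n d : nat) (P : csp n d) : nat :=
  n + \sum_(a <- encode k P) bitlen a.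

(** The value given to variable u is left at memory address u. *)
Definition outputs (n d : nat) (s : store) (x : assignment n d) : Prop :=
  forall u : 'I_n, mem s u = x u.

(** [A] runs in polynomial time on all instances of MAX k-CSP_d, for all k and
    all d >= 2 at once, with time bound the polynomial [T]. *)
Definition runs_in_time (A : prog) (T : {poly nat}) : Prop :=
  forall (k d n : nat) (P : csp n d), 2 <= d -> is_kcsp k P ->
    halts_within A (encode k P) T.[input_size k P]%R.

(* Main.v *)
(** Encode a clause by the linear form on R^(n * d) that has coefficient d - 1 on
    the pairs of the clause and -1 on the other pairs of its variables.  Rounds of
    multiplicative weights, each approximating a top eigenvector by repeated
    matrix powering, produce integer vectors together with nonnegative dual
    weights [lam] on the pairs; choosing the signs of these vectors one at a time
    so as not to decrease a quartic potential yields a bounded vector y on which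
    the sum of the squared forms is within a constant factor of the primal value.
    If this value is large, one of the two product distributions whose marginals
    are uniform plus or minus a multiple of y gains a factor of order k * d over
    the uniform one.  If it is small, the dual weights show that an optimal
    assignment satisfies most of its clauses through pairs of large [lam], and the
    product distribution that boosts these heavy pairs gains exp (k / 8).  The
    best of the three is made deterministic by conditional expectations, in
    integer arithmetic; when there are at most d clauses, satisfying a single one
    already suffices.  The procedure is written in a small language of bounded
    loops over integer arrays, whose compilation to the machine model runs in
    polynomial time. *)

Require Import Defs.
From mathcomp Require Import all_boot all_order all_algebra zify ring lra.
From mathcomp Require Import boolp reals sequences exp.

Import Order.TTheory GRing.Theory Num.Theory.

Set Implicit Arguments.
Unset Strict Implicit.
Unset Printing Implicit Defensive.

Local Open Scope nat_scope.

(** The numbers [k] and [d] come in binary, so loops over the [n * d] pairs are affordable only when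
    [d] is below the number of clauses; this is what isolates the case of few clauses. Likewise [k]
    is replaced by [minn k n], which cannot lower the target. A signed sum of the vectors has no
    useful bound on its entries, and perturbing the uniform distribution by it could give negative
    probabilities, so it is truncated. The dual weights make this cheap: the quartic potential is
    weighted by [lam], and the same [lam] bounds the quadratic form of every vector, hence of the
    part cut off. They serve again on the indicator of the pairs of small [lam] chosen by an optimal
    assignment. Eigenvalues never occur: traces of powers of a Gram matrix form a log-convex
    sequence, and Cauchy-Schwarz is all the spectral theory needed. In the source language trip
    counts are limited by [nu] and stored values by [cap], so every program runs in polynomial time;
    the price is to show that this one never exceeds either limit. No coin is tossed, and the
    success probability is 1. *)

(** * Polynomial bounds and bit lengths *)

Definition polybounded (f : nat -> nat) :=
  exists c, forall L, f L <= (L + 2) ^ c.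

Lemma leq_exp2r_weak a b c : a <= b -> a ^ c <= b ^ c.
Proof. by case: c => // c; rewrite leq_exp2r. Qed.

Lemma polybounded_const k : polybounded (fun=> k).
Proof.
exists k => L; apply: leq_trans (ltnW (ltn_expl k (ltnSn 1))) _.
by apply: leq_exp2r_weak; rewrite leq_addl.
Qed.

Lemma polybounded_id : polybounded id.
Proof. by exists 1 => L; rewrite expn1 leq_addr. Qed.

Lemma polybounded_mul f g :
  polybounded f -> polybounded g -> polybounded (fun L => f L * g L).
Proof.
by move=> [a Ha] [b Hb]; exists (a + b) => L; rewrite expnD leq_mul.
Qed.

(** The base [L + 2] is at least 2 even at [L = 0], and positive powers satisfy
    [x + y <= 2 * x * y], so one more exponent absorbs the sum. *)
Lemma polybounded_add f g :
  polybounded f -> polybounded g -> polybounded (fun L => f L + g L).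
Proof.
move=> [a Ha] [b Hb]; exists (a + b).+1 => L.
have P0 c : 0 < (L + 2) ^ c by rewrite expn_gt0 addn_gt0 orbT.
apply: leq_trans (leq_add (Ha L) (Hb L)) _.
rewrite expnS expnD; have := P0 a; have := P0 b.
move: ((L + 2) ^ a) ((L + 2) ^ b) => x y; nia.
Qed.

Lemma polybounded_exp f c : polybounded f -> polybounded (fun L => f L ^ c).
Proof.
move=> [a Ha]; exists (a * c) => L.
by rewrite expnM leq_exp2r_weak.
Qed.

Lemma polybounded_comp f g :
  polybounded f -> polybounded g -> polybounded (fun L => f (g L)).
Proof.
move=> [a Ha] Hg.
have [c Hc] := polybounded_exp a (polybounded_add Hg (polybounded_const 2)).
by exists c => L; apply: leq_trans (Ha _) (Hc L).
Qed.

Ltac polyb := repeat first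
  [ assumption | exact: polybounded_const | exact: polybounded_id
  | apply: polybounded_add | apply: polybounded_mul | apply: polybounded_exp ].

Lemma bitlen_lt v B : 0 < B -> v < 2 ^ B -> bitlen v <= B.
Proof.
move=> B0 vB; rewrite /bitlen; case: (posnP v) => [->|v0].
  by rewrite trunc_log0.
rewrite -(ltn_exp2l _ _ (ltnSn 1)).
exact: leq_ltn_trans (trunc_logP (ltnSn 1) v0) vB.
Qed.

Lemma bitlen_leS v : bitlen v <= v.+1.
Proof. by apply: bitlen_lt => //; apply: ltn_trans (ltnSn v) (ltn_expl _ _). Qed.

(** * Cost of expressions and of counting loops *)

Fixpoint esize (e : expr) : nat :=
  match e with
  | Cst a => a.+2
  | Reg x => x.+2
  | Read e1 => (esize e1).+1
  | Op _ e1 e2 => (esize e1 + esize e2).+1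
  end.

Fixpoint efine (B : nat) (s : store) (e : expr) : Prop :=
  match e with
  | Cst a => True
  | Reg x => regs s x < 2 ^ B
  | Read e1 => efine B s e1 /\ Defs.mem s (eval s e1) < 2 ^ B
  | Op _ e1 e2 => efine B s e1 /\ efine B s e2
  end.

Lemma scale_square B s : 0 < B -> 0 < s ->
  [/\ 0 < B * s, s <= B * s, B <= B * s & B * s <= B * (s * s)].
Proof. by move=> B0 s0; split; nia. Qed.

Lemma esize_gt0 e : 0 < esize e.
Proof. by case: e. Qed.

(** Literals and register numbers enter [esize] in unary, and a compound is larger than the sum of
    its parts; so every operation, products included, yields at most [B * esize e] bits, and the
    cost, a sum over subterms, is at most quadratic in [esize e]. *)
Lemma efine_bounds B s e : 0 < B -> efine B s e ->
  eval s e < 2 ^ (B * esize e) /\ cost s e <= 4 * B * (esize e * esize e).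
Proof.
move=> B0; elim: e => [a|x|e IH|o e1 IH1 e2 IH2] /=.
- move=> _; have [h1 h2 h3 h4] := @scale_square B a.+2 B0 isT; split.
    apply: leq_trans (ltn_expl a (ltnSn 1)) _; rewrite leq_exp2l //; lia.
  apply: leq_trans (bitlen_leS a) _; lia.
- move=> H; have [h1 h2 h3 h4] := @scale_square B x.+2 B0 isT; split.
    by apply: leq_trans H _; rewrite leq_exp2l //.
  have := bitlen_leS x; have := bitlen_lt B0 H; lia.
- case=> /IH[H1 H2] H3.
  have [h1 h2 h3 h4] := scale_square B0 (esize_gt0 e); split.
    by apply: leq_trans H3 _; rewrite leq_exp2l // leq_pmulr.
  have := bitlen_lt h1 H1; have := bitlen_lt B0 H3; lia.
- case=> /IH1[H1 H2] /IH2[H3 H4].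
  have [h1 h2 h3 h4] := scale_square B0 (esize_gt0 e1).
  have [k1 k2 k3 k4] := scale_square B0 (esize_gt0 e2).
  split.
    apply: (@leq_trans (2 ^ (B * esize e1 + B * esize e2 + 1))); last first.
      rewrite leq_exp2l //; lia.
    rewrite expnD expnD; move: H1 H3.
    have P1 := expn_gt0 2 (B * esize e1).
    have P2 := expn_gt0 2 (B * esize e2).
    move: (2 ^ (B * esize e1)) (2 ^ (B * esize e2)) P1 P2 => p q.
    case: o => /=; [nia|nia|nia|] => P1 P2 Q1 Q2.
    by have := leq_div (eval s e1) (eval s e2); nia.
  have := bitlen_lt h1 H1; have := bitlen_lt k1 H3.
  have : 0 <= B * (esize e1 * esize e2) by [].
  lia.
Qed.

(** The bits [r] come back unread: compiled code never tosses, so it runs alike on every random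
    string. *)
Definition run (A : prog) (s s' : store) (b : nat) :=
  exists2 t, (forall r, exec A s r s' r t) & t <= b.

Lemma run_le A s s' b b' : b <= b' -> run A s s' b -> run A s s' b'.
Proof. by move=> le [t H1 H2]; exists t => //; apply: leq_trans le. Qed.

Lemma run_seq A1 A2 s s1 s2 b1 b2 :
  run A1 s s1 b1 -> run A2 s1 s2 b2 -> run (Seq A1 A2) s s2 (b1 + b2).
Proof.
move=> [t1 H1 L1] [t2 H2 L2]; exists (t1 + t2); last exact: leq_add.
by move=> r; apply: ExecSeq.
Qed.

Definition acost x e := 5 * (esize e * esize e) + x + 1.

Lemma run_assign B s x e : 0 < B -> efine B s e ->
  run (Assign x e) s (set_reg s x (eval s e)) (B * acost x e).
Proof.
move=> B0 /(efine_bounds B0)[H1 H2]; eexists; first by move=> r; exact: ExecAssign.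
have [h1 h2 h3 h4] := scale_square B0 (esize_gt0 e).
have : x.+1 <= B * x.+1 by rewrite leq_pmull.
have := bitlen_lt h1 H1; have := bitlen_leS x; rewrite /acost; lia.
Qed.

Lemma run_write B s e1 e2 : 0 < B -> efine B s e1 -> efine B s e2 ->
  run (Write e1 e2) s (set_mem s (eval s e1) (eval s e2))
    (B * (acost 0 e1 + acost 0 e2)).
Proof.
move=> B0 /(efine_bounds B0)[H1 H2] /(efine_bounds B0)[H3 H4].
eexists; first by move=> r; exact: ExecWrite.
have [h1 h2 h3 h4] := scale_square B0 (esize_gt0 e1).
have [k1 k2 k3 k4] := scale_square B0 (esize_gt0 e2).
have := bitlen_lt h1 H1; have := bitlen_lt k1 H3; rewrite /acost; lia.
Qed.

(** The test is a truncated subtraction, nonzero exactly while the counter is below the bound.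
    Incrementing the counter is left to the body, through [Inv]. *)
Lemma run_count (Inv : nat -> store -> Prop) n b x body tb :
    (forall i s, i < n -> Inv i s -> exists2 s', run body s s' tb & Inv i.+1 s') ->
    (forall i s, Inv i s -> regs s b = n /\ regs s x = i) ->
  forall s, Inv 0 s -> exists2 s',
    run (While (Op Defs.Sub (Reg b) (Reg x)) body) s s'
        (n.+1 * (tb + (b + x + 4 * n + 6))) & Inv n s'.
Proof.
move=> Hb Hr.
suff H j i s : i + j = n -> Inv i s -> exists2 s',
    run (While (Op Defs.Sub (Reg b) (Reg x)) body) s s'
        (j.+1 * (tb + (b + x + 4 * n + 6))) & Inv n s'.
  by move=> s; apply: H.
elim: j i s => [|j IH] i s.
  rewrite addn0 => -> I0; exists s => //.
  have [e1 e2] := Hr _ _ I0.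
  eexists; first by move=> r; apply: ExecWhileF; rewrite /= e1 e2 subnn.
  rewrite /= e1 e2.
  by have := bitlen_leS b; have := bitlen_leS x; have := bitlen_leS n; lia.
move=> ijn Ii; have [e1 e2] := Hr _ _ Ii.
have [|s1 [t1 H1 L1] I1] := Hb i s _ Ii; first lia.
have [|s2 [t2 H2 L2] I2] := IH i.+1 s1 _ I1; first lia.
exists s2 => //; eexists.
  move=> r; apply: ExecWhileT (H1 r) (H2 r); rewrite /= e1 e2; lia.
rewrite /= e1 e2.
have := bitlen_leS b; have := bitlen_leS x; have := bitlen_leS n.
have := bitlen_leS i; lia.
Qed.

(** * Register layout and signed arithmetic *)

Definition rP g := 3 * g.
Definition rQ g := 3 * g + 1.
Definition rV x := 3 * x + 2.

(** Scratch registers of depth at least [g]; those congruent to 2 modulo 3 hold the configuration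
    and the source variables. Code compiled at depth [g] changes only these, so values pending at
    smaller depths survive. *)
Definition temp g := [pred x | (x %% 3 < 2) && (3 * g <= x)].

Definition keeps (D : pred nat) (s s' : store) :=
  Defs.mem s' = Defs.mem s /\ forall x, ~~ D x -> regs s' x = regs s x.

Lemma keeps_trans D s1 s2 s3 : keeps D s1 s2 -> keeps D s2 s3 -> keeps D s1 s3.
Proof.
move=> [m1 r1] [m2 r2]; split=> [|x Dx]; first by rewrite m2.
by rewrite r2 // r1.
Qed.

Lemma keeps_sub (D E : pred nat) s s' :
  (forall x, D x -> E x) -> keeps D s s' -> keeps E s s'.
Proof.
by move=> DE [m r]; split=> // x Ex; apply: r; apply: contra Ex; apply: DE.
Qed.

Lemma keeps_temp g h s s' : h <= g -> keeps (temp g) s s' -> keeps (temp h) s s'.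
Proof. by move=> hg; apply: keeps_sub => x /=; lia. Qed.

Lemma keeps_set (D : pred nat) s x v : D x -> keeps D s (set_reg s x v).
Proof.
move=> Dx; split=> // y Dy /=; rewrite /upd.
by case: eqP => // e; rewrite e Dx in Dy.
Qed.

Lemma set_reg_same s x v : regs (set_reg s x v) x = v.
Proof. by rewrite /= /upd eqxx. Qed.

Lemma set_reg_other s x y v : y <> x -> regs (set_reg s x v) y = regs s y.
Proof. by rewrite /= /upd => /eqP/negbTE ->. Qed.

Inductive ebin := BAdd | BSub | BMul | BDiv | BLt.

(* The comparison evaluates to 0 or 1, division to the quotient of the absolute
   values. *)
Definition zbin (o : ebin) (a b : int) : int :=
  match o with
  | BAdd => (a + b)%R
  | BSub => (a - b)%R
  | BMul => (a * b)%R
  | BDiv => Posz (absz a %/ absz b)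
  | BLt => Posz (a < b)%R
  end.

(* A source register or expression is a difference of two machine numbers. *)
Definition absE g :=
  Op Defs.Add (Op Defs.Sub (Reg (rP g)) (Reg (rQ g)))
              (Op Defs.Sub (Reg (rQ g)) (Reg (rP g))).

(** In the comparison, [1 - (1 - t)] with truncated subtraction is 1 if [t] is positive and 0
    otherwise. *)
Definition combP (o : ebin) g h : expr :=
  let a := Reg (rP g) in let a' := Reg (rQ g) in
  let b := Reg (rP h) in let b' := Reg (rQ h) in
  match o with
  | BAdd => Op Defs.Add a b
  | BSub => Op Defs.Add a b'
  | BMul => Op Defs.Add (Op Defs.Mul a b) (Op Defs.Mul a' b')
  | BDiv => Op Defs.Div (absE g) (absE h)
  | BLt => Op Defs.Sub (Cst 1) (Op Defs.Sub (Cst 1)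
             (Op Defs.Sub (Op Defs.Add b a') (Op Defs.Add a b')))
  end.

Definition combQ (o : ebin) g h : expr :=
  let a := Reg (rP g) in let a' := Reg (rQ g) in
  let b := Reg (rP h) in let b' := Reg (rQ h) in
  match o with
  | BAdd => Op Defs.Add a' b'
  | BSub => Op Defs.Add a' b
  | BMul => Op Defs.Add (Op Defs.Mul a b') (Op Defs.Mul a' b)
  | BDiv => Cst 0
  | BLt => Cst 0
  end.

(** The new positive part is parked in [rP h.+1] because the negative part may still read both old
    parts of [g]. *)
Definition comb o g h : prog :=
  Seq (Assign (rP h.+1) (combP o g h))
    (Seq (Assign (rQ g) (combQ o g h)) (Assign (rP g) (Reg (rP h.+1)))).

Definition rval (s : store) g : int := (Posz (regs s (rP g)) - Posz (regs s (rQ g)))%R.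

Lemma eval_absE s g : eval s (absE g) = absz (rval s g).
Proof. rewrite /rval /=; lia. Qed.

Lemma comb_val o g h s :
  (Posz (eval s (combP o g h)) - Posz (eval s (combQ o g h)))%R
  = zbin o (rval s g) (rval s h).
Proof.
rewrite /rval; case: o => /=; try lia.
have E u v : u - v + (v - u) = absz (Posz u - Posz v)%R by lia.
by rewrite !E subr0.
Qed.

Definition bounded B s g := regs s (rP g) < 2 ^ B /\ regs s (rQ g) < 2 ^ B.

Lemma comb_run o g h : g < h -> exists K, forall B s, 0 < B ->
  bounded B s g -> bounded B s h -> exists s',
  [/\ run (comb o g h) s s' (B * K),
      keeps (fun x => [|| x == rP g, x == rQ g | x == rP h.+1]) s s',
      regs s' (rP g) = eval s (combP o g h),
      regs s' (rQ g) = eval s (combQ o g h) & bounded (B * K) s' g].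
Proof.
move=> gh.
pose e1 := combP o g h; pose e2 := combQ o g h.
pose k := esize e1.
exists (acost (rP h.+1) e1 + k * (acost (rQ g) e2 + acost (rP g) (Reg (rP h.+1)))
        + esize e1 + esize e2) => B s B0 [bg bg'] [bh bh'].
have k0 : 0 < k by apply: esize_gt0.
have F1 : efine B s e1 by rewrite /e1; case: (o).
have F2 : efine B s e2 by rewrite /e2; case: (o).
have [v1 _] := efine_bounds B0 F1; have [v2 _] := efine_bounds B0 F2.
set s1 := set_reg s (rP h.+1) (eval s e1).
have E2 : eval s1 e2 = eval s e2.
  by rewrite /s1 /e2; case: (o) => //=; rewrite /upd /rP /rQ !ifN //; lia.
have Bk : B <= B * k by rewrite leq_pmulr.
have F2' : efine (B * k) s1 e2.
  have le : 2 ^ B <= 2 ^ (B * k) by rewrite leq_exp2l.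
  move: (leq_trans bg le) (leq_trans bg' le) (leq_trans bh le) (leq_trans bh' le).
  rewrite /s1 /e2; case: (o) => //=; rewrite /upd /rP /rQ !ifN //; lia.
set s2 := set_reg s1 (rQ g) (eval s1 e2).
have R2 : regs s2 (rP h.+1) = eval s e1.
  by rewrite /s2 set_reg_other ?set_reg_same // /rP /rQ; lia.
have R2' : eval s2 (Reg (rP h.+1)) = eval s e1 by [].
exists (set_reg s2 (rP g) (eval s2 (Reg (rP h.+1)))); split.
- apply: run_le; last first.
    apply: run_seq (run_assign _ B0 F1) _.
    apply: run_seq.
      by apply: run_assign F2'; rewrite muln_gt0 B0.
    by apply: (run_assign (B := B * k)); rewrite ?muln_gt0 ?B0 // /efine R2.
  by rewrite -/e1 -/e2; nia.
- apply: (keeps_trans (s2 := s1)).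
    by apply: keeps_set; rewrite eqxx !orbT.
  apply: (keeps_trans (s2 := s2)); apply: keeps_set; by rewrite eqxx ?orbT.
- by rewrite set_reg_same R2'.
- rewrite set_reg_other; last by rewrite /rP /rQ; lia.
  by rewrite set_reg_same E2.
- split.
    rewrite set_reg_same R2'; apply: leq_trans v1 _.
    by rewrite leq_exp2l // leq_mul2l; lia.
  rewrite set_reg_other; last by rewrite /rP /rQ; lia.
  rewrite set_reg_same E2; apply: leq_trans v2 _.
  by rewrite leq_exp2l // leq_mul2l; lia.
Qed.

(** * Source expressions and their compilation *)

Inductive ex :=
| EC of nat
| EV of nat
| EI of ex
| EG of nat & ex
| EB of ebin & ex & ex
| EBig of bool & nat & ex & ex.

(** [nu] limits every trip count and [cap] every stored absolute value, whatever the program asks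
    for; this alone makes all programs polynomial. The arrays begin after [base], beyond the input
    word. *)
Record conf := Conf { inp : seq nat; nu : nat; cap : nat; base : nat }.

Definition zbig (o : bool) (n : nat) (F : nat -> int) : int :=
  if o then (\prod_(i < n) F i)%R else (\sum_(i < n) F i)%R.

Fixpoint ev (p : conf) (V : nat -> nat) (A : nat -> nat -> int) (e : ex) : int :=
  match e with
  | EC c => Posz c
  | EV x => Posz (V x)
  | EI e1 => Posz (nth 0 (inp p) (absz (ev p V A e1)))
  | EG t e1 => A t (absz (ev p V A e1))
  | EB o e1 e2 => zbin o (ev p V A e1) (ev p V A e2)
  | EBig o x b e1 =>
      zbig o (minn (absz (ev p V A b)) (nu p)) (fun i => ev p (upd V x i) A e1)
  end.

(* The polynomial pairing (t + j)^2 + t is injective; the cells [base] and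
   [base + 1] are never written and hence stay zero. *)
Definition adr base t j := base + 2 * ((t + j) * (t + j) + t).+1.

Lemma adr_inj b t j t' j' : adr b t j = adr b t' j' -> t = t' /\ j = j'.
Proof.
rewrite /adr => H.
have {}H : (t + j) * (t + j) + t = (t' + j') * (t' + j') + t' by lia.
have E : t + j = t' + j' by nia.
by rewrite E in H; lia.
Qed.

Definition adrE t e :=
  let f := Op Defs.Add (Cst t) e in
  Op Defs.Add (Reg (rV 0))
    (Op Defs.Mul (Cst 2)
       (Op Defs.Add (Op Defs.Add (Op Defs.Mul f f) (Cst t)) (Cst 1))).

Definition pospart (z : int) : nat := if z is Posz n then n else 0.
Definition negpart (z : int) : nat := if z is Negz n then n.+1 else 0.

Record sim (p : conf) (L : nat) (s : store) (V : nat -> nat)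
    (A : nat -> nat -> int) : Prop := Sim {
  sim_base : regs s (rV 0) = base p;
  sim_nu : regs s (rV 1) = nu p;
  sim_cap : regs s (rV 2) = cap p;
  sim_var : forall x, regs s (rV x.+3) = V x;
  sim_inp : forall a, a <= base p -> Defs.mem s a = nth 0 (inp p) a;
  sim_pos : forall t j, Defs.mem s (adr (base p) t j) = pospart (A t j);
  sim_neg : forall t j, Defs.mem s (adr (base p) t j).+1 = negpart (A t j)
}.

(** Trip counts are at most [L] itself, all other numbers only have at most [L] bits. *)
Record small (p : conf) (L : nat) (V : nat -> nat) (A : nat -> nat -> int) : Prop :=
  Small {
  small_pos : 0 < L;
  small_nu : nu p <= L;
  small_base : base p < 2 ^ L;
  small_cap : cap p < 2 ^ L;
  small_var : forall x, V x < 2 ^ L;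
  small_inp : forall a, nth 0 (inp p) a < 2 ^ L;
  small_size : size (inp p) <= base p;
  small_arr : forall t j, absz (A t j) <= cap p
}.

Definition minE e x := Op Defs.Sub e (Op Defs.Sub e (Reg x)).

(** For a big operator the accumulator lives at depth [g]; depth [g.+1] holds the bound and the
    saved old value of the index variable, restored at the end so that nested uses of one variable
    are harmless. *)
Fixpoint cE (e : ex) (g : nat) : prog :=
  match e with
  | EC c => Seq (Assign (rP g) (Cst c)) (Assign (rQ g) (Cst 0))
  | EV x => Seq (Assign (rP g) (Reg (rV x.+3))) (Assign (rQ g) (Cst 0))
  | EI e1 => Seq (cE e1 g) (Seq (Assign (rP g) (Read (minE (absE g) (rV 0))))
                                (Assign (rQ g) (Cst 0)))
  | EG t e1 =>
      Seq (cE e1 g) (Seq (Assign (rQ g) (absE g))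
        (Seq (Assign (rP g) (Read (adrE t (Reg (rQ g)))))
             (Assign (rQ g) (Read (Op Defs.Add (adrE t (Reg (rQ g))) (Cst 1))))))
  | EB o e1 e2 => Seq (cE e1 g) (Seq (cE e2 g.+1) (comb o g g.+1))
  | EBig o x b e1 =>
      Seq (cE b g) (Seq (Assign (rP g.+1) (minE (absE g) (rV 1)))
     (Seq (Assign (rQ g.+1) (Reg (rV x.+3)))
     (Seq (Assign (rP g) (Cst o)) (Seq (Assign (rQ g) (Cst 0))
     (Seq (Assign (rV x.+3) (Cst 0))
     (Seq (While (Op Defs.Sub (Reg (rP g.+1)) (Reg (rV x.+3)))
        (Seq (cE e1 g.+2) (Seq (comb (if o then BMul else BAdd) g g.+2)
          (Assign (rV x.+3) (Op Defs.Add (Reg (rV x.+3)) (Cst 1))))))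
        (Assign (rV x.+3) (Reg (rQ g.+1)))))))))
  end.

Lemma sim_keeps p L s s' V A g : keeps (temp g) s s' -> sim p L s V A -> sim p L s' V A.
Proof.
move=> [m r] [s1 s2 s3 s4 s5 s6 s7].
have rv x : regs s' (rV x) = regs s (rV x).
  by apply: r; rewrite /temp /rV /=; lia.
by split=> *; rewrite ?m ?rv; auto.
Qed.

Lemma eval_adrE s p t e : regs s (rV 0) = base p ->
  eval s (adrE t e) = adr (base p) t (eval s e).
Proof. by move=> /= ->; rewrite /adr addn1. Qed.

Lemma pospart_le z : pospart z <= absz z. Proof. by case: z. Qed.
Lemma negpart_le z : negpart z <= absz z. Proof. by case: z. Qed.
Lemma pos_neg z : (Posz (pospart z) - Posz (negpart z))%R = z.
Proof. by case: z => n /=; lia. Qed.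

Definition expr_spec (p : conf) (f : nat -> nat) (L : nat) V A e g s := exists s',
  [/\ run (cE e g) s s' (f L), keeps (temp g) s s', rval s' g = ev p V A e
    & bounded (f L) s' g].

Lemma bounded_le B B' s g : B <= B' -> bounded B s g -> bounded B' s g.
Proof.
move=> le [h1 h2]; split; first apply: leq_trans h1 _; last apply: leq_trans h2 _.
  by rewrite leq_exp2l.
by rewrite leq_exp2l.
Qed.

Lemma bounded_keeps B s s' g h : h < g -> keeps (temp g) s s' ->
  bounded B s h -> bounded B s' h /\ rval s' h = rval s h.
Proof.
move=> hg [_ r] [b1 b2]; rewrite /bounded /rval !r //.
  by rewrite /temp /rQ /=; lia.
by rewrite /temp /rP /=; lia.
Qed.

Lemma val_set s g a b : rval (set_reg (set_reg s (rP g) a) (rQ g) b) g = (Posz a - Posz b)%R.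
Proof. by rewrite /rval set_reg_same set_reg_other ?set_reg_same // /rP /rQ; lia. Qed.

Lemma temp_rP g : temp g (rP g). Proof. by rewrite /temp /rP /=; lia. Qed.
Lemma temp_rQ g : temp g (rQ g). Proof. by rewrite /temp /rQ /=; lia. Qed.

Lemma lt_exp2_add a b c : a < 2 ^ b -> a < 2 ^ (b + c).
Proof. by move=> h; apply: leq_trans h _; rewrite leq_exp2l ?leq_addr. Qed.

Lemma eval_minE s e x : eval s (minE e x) = minn (eval s e) (regs s x).
Proof. by rewrite /minE /=; lia. Qed.

Lemma bounded_absz B s g : bounded B s g -> absz (rval s g) < 2 ^ B.
Proof. by rewrite /bounded /rval; lia. Qed.

Lemma zbigS o i F : zbig o i.+1 F = zbin (if o then BMul else BAdd) (zbig o i F) (F i).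
Proof. by case: o; rewrite /zbig big_ord_recr. Qed.

Lemma small_upd p L V A x i : small p L V A -> i <= nu p -> small p L (upd V x i) A.
Proof.
move=> [s1 s2 s3 s4 s5 s6 s7 s8] inu; split=> // y.
rewrite /upd; case: eqP => // _.
exact: leq_ltn_trans (leq_trans inu s2) (ltn_expl _ _).
Qed.

Lemma efine_adrE B s t e :
  regs s (rV 0) < 2 ^ B -> efine B s e -> efine B s (adrE t e).
Proof. by []. Qed.

Lemma cE_spec e g : exists2 f, polybounded f & forall p L V A s,
  small p L V A -> sim p L s V A -> expr_spec p f L V A e g s.
Proof.
elim: e g => [c|x|e IH|t e IH|o e1 IH1 e2 IH2|o x b IHb e IH] g.
- pose K := acost (rP g) (Cst c) + acost (rQ g) (Cst 0).
  exists (fun L => (L + c.+1) * K.+1); first by polyb.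
  move=> p L V A s sm si; set B := L + c.+1.
  have B0 : 0 < B by rewrite /B; lia.
  exists (set_reg (set_reg s (rP g) c) (rQ g) 0); split.
  + apply: run_le; last by apply: run_seq; apply: (run_assign (B := B)).
    by rewrite -mulnDr leq_mul.
  + by apply: keeps_trans; apply: keeps_set; [apply: temp_rP|apply: temp_rQ].
  + by rewrite val_set subr0.
  + rewrite /bounded set_reg_same set_reg_other ?set_reg_same; last by rewrite /rP /rQ; lia.
    split; last by rewrite expn_gt0.
    apply: leq_trans (ltn_expl c (ltnSn 1)) _; rewrite leq_exp2l // /B; nia.
- pose K := acost (rP g) (Reg (rV x.+3)) + acost (rQ g) (Cst 0).
  exists (fun L => L * K.+1); first by polyb.
  move=> p L V A s sm si; have L0 := small_pos sm.
  have bx : regs s (rV x.+3) < 2 ^ L by rewrite (sim_var si) (small_var sm).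
  exists (set_reg (set_reg s (rP g) (V x)) (rQ g) 0); split.
  + apply: run_le; last first.
      apply: run_seq; last by apply: (run_assign (B := L)).
      have -> : V x = eval s (Reg (rV x.+3)) by rewrite /= (sim_var si).
      by apply: (run_assign (B := L)).
    by rewrite -mulnDr leq_mul.
  + by apply: keeps_trans; apply: keeps_set; [apply: temp_rP|apply: temp_rQ].
  + by rewrite val_set subr0.
  + rewrite /bounded set_reg_same set_reg_other ?set_reg_same; last by rewrite /rP /rQ; lia.
    split; last by rewrite expn_gt0.
    by rewrite -(sim_var si); apply: leq_trans bx _; rewrite leq_exp2l // leq_pmulr.
- have [f pf Hf] := IH g.
  pose E := Read (minE (absE g) (rV 0)).
  pose K := acost (rP g) E + acost (rQ g) (Cst 0).
  exists (fun L => (f L + L) * K.+1 + f L); first by polyb.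
  move=> p L V A s sm si; have L0 := small_pos sm.
  have [s1 [r1 k1 v1 [b1 b1']]] := Hf _ _ _ _ _ sm si.
  have si1 := sim_keeps k1 si.
  have B0 : 0 < f L + L by lia.
  have Em : eval s1 (minE (absE g) (rV 0)) = minn (absz (ev p V A e)) (base p).
    by rewrite eval_minE eval_absE v1 (sim_base si1).
  have EE : eval s1 E = nth 0 (inp p) (absz (ev p V A e)).
    change (Defs.mem s1 (eval s1 (minE (absE g) (rV 0))) = nth 0 (inp p) (absz (ev p V A e))).
    rewrite Em (sim_inp si1) ?geq_minr //.
    (* Addresses beyond [base] are cut to [base], which lies past the input, so both sides are the
       default 0. *)
    case: leqP => // H; rewrite !nth_default //; have := small_size sm; lia.
  exists (set_reg (set_reg s1 (rP g) (nth 0 (inp p) (absz (ev p V A e)))) (rQ g) 0); split.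
  + apply: run_le; last first.
      apply: (run_seq r1); apply: run_seq; last by apply: (run_assign (B := f L + L)).
      rewrite -EE; apply: (run_assign _ B0).
      split.
        split; first by do 2!split => //; exact: lt_exp2_add.
        split; first by do 2!split => //; exact: lt_exp2_add.
        by rewrite /efine (sim_base si1) addnC; apply/lt_exp2_add/(small_base sm).
      rewrite Em (sim_inp si1) ?geq_minr //.
      by rewrite addnC; apply/lt_exp2_add/(small_inp sm).
    by rewrite -mulnDr -/E; rewrite addnC leq_add2r leq_mul.
  + apply: (keeps_trans k1).
    by apply: keeps_trans; apply: keeps_set; [apply: temp_rP|apply: temp_rQ].
  + by rewrite val_set subr0.
  + rewrite /bounded set_reg_same set_reg_other ?set_reg_same; last by rewrite /rP /rQ; lia.
    split; last by rewrite expn_gt0.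
    apply: leq_trans (small_inp sm _) _; rewrite leq_exp2l //.
    nia.
- have [f pf Hf] := IH g.
  pose E1 := Read (adrE t (Reg (rQ g))).
  pose E2 := Read (Op Defs.Add (adrE t (Reg (rQ g))) (Cst 1)).
  pose K := acost (rQ g) (absE g) + acost (rP g) E1 + acost (rQ g) E2.
  exists (fun L => (f L + L) * K.+1 + f L); first by polyb.
  move=> p L V A s sm si; have L0 := small_pos sm.
  have [s1 [r1 k1 v1 b1]] := Hf _ _ _ _ _ sm si.
  set j := absz (ev p V A e).
  have bj : j < 2 ^ (f L + L) by rewrite /j -v1; apply/lt_exp2_add/bounded_absz.
  have B0 : 0 < f L + L by lia.
  set s2 := set_reg s1 (rQ g) j.
  have k2 : keeps (temp g) s1 s2 by apply/keeps_set/temp_rQ.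
  have si2 := sim_keeps k2 (sim_keeps k1 si).
  have q2 : regs s2 (rQ g) = j by rewrite set_reg_same.
  have bV : regs s2 (rV 0) < 2 ^ (f L + L).
    by rewrite (sim_base si2) addnC; apply/lt_exp2_add/(small_base sm).
  have bp : pospart (A t j) < 2 ^ (f L + L).
    apply: leq_ltn_trans (pospart_le _) _.
    apply: leq_ltn_trans (small_arr sm _ _) _.
    by rewrite addnC; apply/lt_exp2_add/(small_cap sm).
  have bn : negpart (A t j) < 2 ^ (f L + L).
    apply: leq_ltn_trans (negpart_le _) _.
    apply: leq_ltn_trans (small_arr sm _ _) _.
    by rewrite addnC; apply/lt_exp2_add/(small_cap sm).
  have a2 : eval s2 (adrE t (Reg (rQ g))) = adr (base p) t j.
    by rewrite (eval_adrE _ _ (sim_base si2)); congr adr.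
  have m2 : eval s2 E1 = pospart (A t j) by rewrite -(sim_pos si2) -a2.
  set s3 := set_reg s2 (rP g) (pospart (A t j)).
  have k3 : keeps (temp g) s2 s3 by apply/keeps_set/temp_rP.
  have si3 := sim_keeps k3 si2.
  have q3 : regs s3 (rQ g) = j by rewrite set_reg_other // /rP /rQ; lia.
  have a3 : eval s3 (adrE t (Reg (rQ g))) = adr (base p) t j.
    by rewrite (eval_adrE _ _ (sim_base si3)); congr adr.
  have a3' : eval s3 (Op Defs.Add (adrE t (Reg (rQ g))) (Cst 1)) = (adr (base p) t j).+1.
    change (eval s3 (adrE t (Reg (rQ g))) + 1 = (adr (base p) t j).+1).
    by rewrite a3 addn1.
  have m3 : eval s3 E2 = negpart (A t j) by rewrite -(sim_neg si3) -a3'.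
  exists (set_reg s3 (rQ g) (negpart (A t j))); split.
  + apply: run_le; last first.
      apply: (run_seq r1); apply: (run_seq (s1 := s2)).
        rewrite /s2 /j -v1 -eval_absE; apply: (run_assign _ B0).
        by case: b1 => b1 b1'; do 2!split => //; apply/lt_exp2_add.
      apply: (run_seq (s1 := s3)).
        rewrite /s3 -m2; apply: (run_assign _ B0); split; last by rewrite -[X in X < _]/(eval s2 E1) m2.
        by apply: efine_adrE => //; rewrite /efine q2.
      rewrite -m3; apply: (run_assign _ B0); split; last by rewrite -[X in X < _]/(eval s3 E2) m3.
      split=> //; apply: efine_adrE; last by rewrite /efine q3.
      by rewrite (sim_base si3) -(sim_base si2).
    by rewrite -!mulnDr addnA addnC leq_add2r leq_mul.
  + by apply: (keeps_trans k1); apply: (keeps_trans k2); apply: (keeps_trans k3);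
      apply/keeps_set/temp_rQ.
  + rewrite /rval set_reg_same set_reg_other; last by rewrite /rP /rQ; lia.
    by rewrite set_reg_same pos_neg.
  + apply: (bounded_le (B := f L + L)); first by nia.
    rewrite /bounded set_reg_same set_reg_other; last by rewrite /rP /rQ; lia.
    by rewrite set_reg_same.
- have [f1 pf1 H1] := IH1 g; have [f2 pf2 H2] := IH2 g.+1.
  have [K HK] := comb_run o (ltnSn g).
  exists (fun L => f1 L + f2 L + (f1 L + f2 L + 1) * K); first by polyb.
  move=> p L V A s sm si.
  have [s1 [r1 k1 v1 b1]] := H1 _ _ _ _ _ sm si.
  have [s2 [r2 k2 v2 b2]] := H2 _ _ _ _ _ sm (sim_keeps k1 si).
  have [b1' v1'] := bounded_keeps (ltnSn g) k2 b1.
  have [|||s3 [r3 k3 p3 q3 b3]] := HK (f1 L + f2 L + 1) s2.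
  + by rewrite addn1.
  + by apply: bounded_le b1'; lia.
  + by apply: bounded_le b2; lia.
  exists s3; split.
  + by apply: run_le (run_seq r1 (run_seq r2 r3)); lia.
  + apply: (keeps_trans k1); apply: (keeps_trans (keeps_temp (leqnSn g) k2)).
    by apply: keeps_sub k3 => y; rewrite /temp /rP /rQ /=; lia.
  + by rewrite /rval p3 q3 comb_val v1' v1 v2.
  + by apply: bounded_le b3; lia.
- have [fb pb Hb] := IHb g; have [f pf Hf] := IH g.+2.
  pose o' := if o then BMul else BAdd.
  have [K HK] := comb_run o' (leqnSn g.+1).
  pose Einc := Op Defs.Add (Reg (rV x.+3)) (Cst 1).
  pose K0 := acost (rP g.+1) (minE (absE g) (rV 1)) + acost (rQ g.+1) (Reg (rV x.+3))
    + acost (rP g) (Cst o) + acost (rQ g) (Cst 0) + acost (rV x.+3) (Cst 0)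
    + acost (rV x.+3) (Reg (rQ g.+1)).
  pose BB L := (f L + 2) * (L + 2) + L + fb L.
  pose tb L := f L + BB L * K + BB L * acost (rV x.+3) Einc.
  exists (fun L => fb L + BB L * K0 + (L + 1) * (tb L + (rP g.+1 + rV x.+3 + 4 * L + 6)) + BB L).
    by rewrite /tb /BB; polyb.
  move=> p L V A s sm si; have L0 := small_pos sm.
  have [s1 [r1 k1 v1 b1]] := Hb _ _ _ _ _ sm si.
  set F := fun i => ev p (upd V x i) A e.
  set n := minn (absz (ev p V A b)) (nu p).
  have nnu : n <= nu p by apply: geq_minr.
  have nL : n <= L by apply: leq_trans nnu (small_nu sm).
  have B0 : 0 < BB L by rewrite /BB; lia.
  have ltB a : a < 2 ^ L -> a < 2 ^ BB L.
    by move=> h; apply: leq_trans h _; rewrite leq_exp2l // /BB; lia.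
  have ltL a : a <= L -> a < 2 ^ BB L.
    by move=> h; apply: ltB; apply: leq_ltn_trans h (ltn_expl _ _).
  (* Each iteration adds at most [f L + 2] bits to the accumulator, so even a product stays of
     polynomial size after [n <= L] of them. *)
  pose Inv i s' := [/\ Defs.mem s' = Defs.mem s,
     forall y, ~~ temp g y -> y <> rV x.+3 -> regs s' y = regs s y,
     [/\ regs s' (rV x.+3) = i, regs s' (rP g.+1) = n & regs s' (rQ g.+1) = V x],
     rval s' g = zbig o i F &
     regs s' (rP g) + regs s' (rQ g) <= 2 ^ ((f L + 2) * i.+1)].
  have Hstep i s' : i < n -> Inv i s' -> exists2 s'',
      run (Seq (cE e g.+2) (Seq (comb o' g g.+2) (Assign (rV x.+3) Einc))) s' s'' (tb L)
      & Inv i.+1 s''.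
    move=> ltin [m' k' [x' n' o1] v' b'].
    have inu : i <= nu p by apply: leq_trans nnu; apply: ltnW.
    have sm' := small_upd x sm inu.
    have si' : sim p L s' (upd V x i) A.
      case: (si) => t1 t2 t3 t4 t5 t6 t7.
      split=> *; rewrite ?m'; auto.
      - by rewrite k' // /temp /rV /=; lia.
      - by rewrite k' // /temp /rV /=; lia.
      - by rewrite k' // /temp /rV /=; lia.
      - rewrite /upd; case: eqP => [->//|ne].
        by rewrite k' ?t4 // /temp /rV /=; lia.
    have [s2 [r2 k2 v2 b2]] := Hf _ _ _ _ _ sm' si'.
    have bi : (f L + 2) * i.+1 + f L + 2 <= BB L by rewrite /BB; nia.
    have Kr y : ~~ temp g.+2 y -> regs s2 y = regs s' y by case: k2 => _; apply.
    have Pg : regs s2 (rP g) = regs s' (rP g) by rewrite Kr // /temp /rP /=; lia.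
    have Qg : regs s2 (rQ g) = regs s' (rQ g) by rewrite Kr // /temp /rQ /=; lia.
    have le1 : 2 ^ ((f L + 2) * i.+1) < 2 ^ BB L by rewrite ltn_exp2l //; lia.
    have bg : bounded (BB L) s2 g.
      by rewrite /bounded Pg Qg; split; apply: leq_ltn_trans le1; lia.
    have bg2 : bounded (BB L) s2 g.+2 by apply: bounded_le b2; lia.
    have [s3 [r3 k3 p3 q3 _]] := HK _ _ B0 bg bg2.
    have K3 y : y <> rP g -> y <> rQ g -> y <> rP g.+3 -> regs s3 y = regs s2 y.
      by move=> /eqP h1 /eqP h2 /eqP h3; case: k3 => _; apply; rewrite !negb_or h1 h2 h3.
    have x3 : regs s3 (rV x.+3) = i.
      by rewrite K3 ?Kr // /temp /rV /rP /rQ /=; lia.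
    exists (set_reg s3 (rV x.+3) i.+1).
      apply: run_le (run_seq r2 (run_seq r3 _)); last first.
        have -> : i.+1 = eval s3 Einc.
          by rewrite -[RHS]/(regs s3 (rV x.+3) + 1) x3 addn1.
        apply: (run_assign _ B0).
        by split=> //; rewrite /efine x3; apply: ltL; lia.
      by rewrite /tb; lia.
    split.
    - by case: k3 => m3 _; case: k2 => m2 _; rewrite /= m3 m2.
    - move=> y ty yx; rewrite set_reg_other // K3 ?Kr ?k' //.
      + by move: ty; rewrite /temp /=; lia.
      + by move: ty; rewrite /temp /rP /=; lia.
      + by move: ty; rewrite /temp /rQ /=; lia.
      + by move: ty; rewrite /temp /rP /=; lia.
    - rewrite set_reg_same; split=> //.
        by rewrite set_reg_other ?K3 ?Kr // /temp /rV /rP /rQ /=; lia.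
      by rewrite set_reg_other ?K3 ?Kr // /temp /rV /rP /rQ /=; lia.
    - rewrite zbigS -v' -/o' /F -v2.
      rewrite /rval !set_reg_other; try by rewrite /rV /rP /rQ; lia.
      by rewrite p3 q3 comb_val /rval Pg Qg.
    - rewrite !set_reg_other; try by rewrite /rV /rP /rQ; lia.
      rewrite p3 q3.
      have [b21 b22] := b2.
      have le2 : regs s2 (rP g.+2) + regs s2 (rQ g.+2) <= 2 ^ (f L + 1).
        by rewrite expnD; lia.
      rewrite -Pg -Qg in b'.
      apply: (@leq_trans (2 ^ ((f L + 2) * i.+1) * 2 ^ (f L + 1) * 2)); last first.
        by rewrite -mulnA -expnSr -expnD leq_exp2l //; lia.
      have := expn_gt0 2 ((f L + 2) * i.+1); have := expn_gt0 2 (f L + 1).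
      move: b' le2; move: (2 ^ (_ * _)) (2 ^ (f L + 1)) => c1 c2.
      rewrite /o'; case: (o) => /=; nia.
  set s2 := set_reg s1 (rP g.+1) n.
  set s3 := set_reg s2 (rQ g.+1) (V x).
  set s4 := set_reg s3 (rP g) o.
  set s5 := set_reg s4 (rQ g) 0.
  set s6 := set_reg s5 (rV x.+3) 0.
  have P6 : regs s6 (rP g) = o.
    rewrite /s6 set_reg_other; last by rewrite /rV /rP; lia.
    rewrite /s5 set_reg_other; last by rewrite /rP /rQ; lia.
    by rewrite set_reg_same.
  have Q6 : regs s6 (rQ g) = 0.
    rewrite /s6 set_reg_other; last by rewrite /rV /rQ; lia.
    by rewrite set_reg_same.
  have I0 : Inv 0 s6.
    split.
    - by case: k1.
    - move=> y ty yx; rewrite !set_reg_other //; first by case: k1 => _; apply.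
      + by move=> ye; move: ty; rewrite ye /temp /rP /=; lia.
      + by move=> ye; move: ty; rewrite ye /temp /rQ /=; lia.
      + by move=> ye; move: ty; rewrite ye /temp /rP /=; lia.
      + by move=> ye; move: ty; rewrite ye /temp /rQ /=; lia.
    - split; first by rewrite set_reg_same.
        rewrite /s6 set_reg_other; last by rewrite /rV /rP; lia.
        rewrite /s5 set_reg_other; last by rewrite /rP /rQ; lia.
        rewrite /s4 set_reg_other; last by rewrite /rP; lia.
        rewrite /s3 set_reg_other; last by rewrite /rP /rQ; lia.
        by rewrite set_reg_same.
      rewrite /s6 set_reg_other; last by rewrite /rV /rQ; lia.
      rewrite /s5 set_reg_other; last by rewrite /rV /rQ; lia.
      rewrite /s4 set_reg_other; last by rewrite /rP /rQ; lia.
      by rewrite set_reg_same.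
    - by rewrite /rval P6 Q6 subr0 /zbig; case: (o); rewrite big_ord0.
    - by rewrite P6 Q6 addn0; case: (o) => //; rewrite expn_gt0.
  have Hr i s' : Inv i s' -> regs s' (rP g.+1) = n /\ regs s' (rV x.+3) = i.
    by case=> _ _ [].
  have [s7 r7 [m7 k7 [x7 n7 o7] v7 b7]] := run_count Hstep Hr I0.
  have si1 := sim_keeps k1 si.
  exists (set_reg s7 (rV x.+3) (V x)); split.
  + apply: run_le; last first.
      apply: (run_seq r1); apply: (run_seq (s1 := s2)).
        have -> : s2 = set_reg s1 (rP g.+1) (eval s1 (minE (absE g) (rV 1))).
          by rewrite eval_minE eval_absE v1 (sim_nu si1).
        apply: (run_assign _ B0); case: b1 => b1 b1'.
        have h1 : regs s1 (rP g) < 2 ^ BB L.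
          by apply: leq_trans b1 _; rewrite leq_exp2l // /BB; lia.
        have h2 : regs s1 (rQ g) < 2 ^ BB L.
          by apply: leq_trans b1' _; rewrite leq_exp2l // /BB; lia.
        do 2!split=> //; rewrite /efine (sim_nu si1); apply: ltL; exact: small_nu sm.
      apply: (run_seq (s1 := s3)).
        have e2 : regs s2 (rV x.+3) = V x.
          by rewrite set_reg_other ?(sim_var si1) // /rV /rP; lia.
        rewrite /s3 -e2 -[regs _ _]/(eval s2 (Reg (rV x.+3))); apply: (run_assign _ B0).
        by rewrite /efine e2; apply/ltB/(small_var sm).
      apply: (run_seq (s1 := s4)); first exact: (run_assign (B := BB L)).
      apply: (run_seq (s1 := s5)); first exact: (run_assign (B := BB L)).
      apply: (run_seq (s1 := s6)); first exact: (run_assign (B := BB L)).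
      apply: (run_seq r7).
      rewrite -o7 -[regs s7 _]/(eval s7 (Reg (rQ g.+1))); apply: (run_assign _ B0).
      by rewrite /efine o7; apply/ltB/(small_var sm).
    have : n.+1 * (tb L + (rP g.+1 + rV x.+3 + 4 * n + 6)) <=
      (L + 1) * (tb L + (rP g.+1 + rV x.+3 + 4 * L + 6)) by apply: leq_mul; lia.
    rewrite /K0 !mulnDr; lia.
  + split=> // y ty; case: (y =P rV x.+3) => [->|ne].
      by rewrite set_reg_same (sim_var si).
    by rewrite set_reg_other // k7.
  + rewrite /rval !set_reg_other; try by rewrite /rV /rP /rQ; lia.
    exact: v7.
  + have le : 2 ^ ((f L + 2) * n.+1) < 2 ^ BB L by rewrite ltn_exp2l // /BB; nia.
    apply: (bounded_le (B := BB L)); first lia.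
    rewrite /bounded !set_reg_other; try by rewrite /rV /rP /rQ; lia.
    by split; apply: leq_ltn_trans le; lia.
Qed.

(** * Statements and their compilation *)

Inductive st :=
| SSet of nat & ex & ex
| SSeq of st & st
| SFor of nat & ex & st.

(** An oversized value is stored as 0, which keeps the semantics total; magnitude bounds will show
    that the program never stores one. *)
Definition clip (c : nat) (z : int) : int := if absz z <= c then z else 0%R.

Definition upd2 (A : nat -> nat -> int) t j (z : int) : nat -> nat -> int :=
  fun t' j' => if (t' == t) && (j' == j) then z else A t' j'.

Fixpoint sem (p : conf) (V : nat -> nat) (A : nat -> nat -> int) (c : st) :
    nat -> nat -> int :=
  match c with
  | SSet t e1 e2 => upd2 A t (absz (ev p V A e1)) (clip (cap p) (ev p V A e2))
  | SSeq c1 c2 => sem p V (sem p V A c1) c2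
  | SFor x b c1 =>
      iteri (minn (absz (ev p V A b)) (nu p)) (fun i A' => sem p (upd V x i) A' c1) A
  end.

Lemma pospart_sub u v : pospart (Posz u - Posz v)%R = u - v.
Proof.
case: (leqP v u) => h; first by rewrite subzn //=; lia.
have -> : (Posz u - Posz v)%R = Negz (v - u).-1 by lia.
by rewrite /=; lia.
Qed.

Lemma negpart_sub u v : negpart (Posz u - Posz v)%R = v - u.
Proof.
case: (leqP v u) => h; first by rewrite subzn //=; lia.
have -> : (Posz u - Posz v)%R = Negz (v - u).-1 by lia.
by rewrite /=; lia.
Qed.

(** Equal to 1 when the value is within [cap] and to 0 otherwise; multiplying by it implements
    [clip]. *)
Definition flagE g := Op Defs.Sub (Cst 1) (Op Defs.Sub (absE g) (Reg (rV 2))).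

Fixpoint cS (c : st) (g : nat) : prog :=
  match c with
  | SSet t e1 e2 =>
      Seq (cE e1 g) (Seq (cE e2 g.+1)
     (Seq (Assign (rP g) (absE g)) (Seq (Assign (rQ g) (flagE g.+1))
     (Seq (Write (adrE t (Reg (rP g)))
            (Op Defs.Mul (Op Defs.Sub (Reg (rP g.+1)) (Reg (rQ g.+1))) (Reg (rQ g))))
          (Write (Op Defs.Add (adrE t (Reg (rP g))) (Cst 1))
            (Op Defs.Mul (Op Defs.Sub (Reg (rQ g.+1)) (Reg (rP g.+1))) (Reg (rQ g))))))))
  | SSeq c1 c2 => Seq (cS c1 g) (cS c2 g)
  | SFor x b c1 =>
      Seq (cE b g) (Seq (Assign (rP g) (minE (absE g) (rV 1)))
     (Seq (Assign (rQ g) (Reg (rV x.+3))) (Seq (Assign (rV x.+3) (Cst 0))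
     (Seq (While (Op Defs.Sub (Reg (rP g)) (Reg (rV x.+3)))
            (Seq (cS c1 g.+1) (Assign (rV x.+3) (Op Defs.Add (Reg (rV x.+3)) (Cst 1)))))
          (Assign (rV x.+3) (Reg (rQ g)))))))
  end.

Lemma clip_le c z : absz (clip c z) <= c.
Proof. by rewrite /clip; case: ifP. Qed.

Lemma small_upd2 p L V A t j z : absz z <= cap p ->
  small p L V A -> small p L V (upd2 A t j z).
Proof.
move=> zc [s1 s2 s3 s4 s5 s6 s7 s8]; split=> // t' j'.
by rewrite /upd2; case: ifP.
Qed.

Lemma small_var_irr p L V V' A : (forall x, V' x < 2 ^ L) ->
  small p L V A -> small p L V' A.
Proof. by move=> h [*]; split. Qed.

Definition low g := [pred y | (y %% 3 < 2) && (y < 3 * g)].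

Lemma keeps_low g h s s' : keeps (temp h) s s' -> g <= h ->
  forall y, low g y -> regs s' y = regs s y.
Proof. by move=> [_ H] gh y; rewrite /low /= => hy; apply: H; rewrite /temp /=; lia. Qed.

Lemma sim_write p L s V A t j z : sim p L s V A ->
  sim p L (set_mem (set_mem s (adr (base p) t j) (pospart z))
            (adr (base p) t j).+1 (negpart z)) V (upd2 A t j z).
Proof.
move=> [s1 s2 s3 s4 s5 s6 s7]; split=> //=.
- move=> a ab; rewrite /upd !ifN ?s5 //; rewrite /adr; lia.
- move=> t' j'; rewrite /upd /upd2.
  have -> : (adr (base p) t' j' == (adr (base p) t j).+1) = false.
    by rewrite /adr; lia.
  case: eqP => [/adr_inj[-> ->]|ne]; first by rewrite !eqxx.
  by case: (t' =P t) => [e1|] //; case: (j' =P j) => [e2|] //=; subst.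
- move=> t' j'; rewrite /upd /upd2 eqSS.
  have -> : ((adr (base p) t' j').+1 == adr (base p) t j) = false.
    by rewrite /adr; lia.
  case: eqP => [/adr_inj[-> ->]|ne]; first by rewrite !eqxx.
  by case: (t' =P t) => [e1|] //; case: (j' =P j) => [e2|] //=; subst.
Qed.

Lemma sim_setvar p L s V V' A x k : sim p L s V A -> (forall y, V' y = upd V x k y) ->
  sim p L (set_reg s (rV x.+3) k) V' A.
Proof.
move=> [t1 t2 t3 t4 t5 t6 t7] EV; split=> //; try by rewrite set_reg_other // /rV; lia.
move=> y; rewrite EV /upd; case: eqP => [->|ne]; first by rewrite set_reg_same.
by rewrite set_reg_other // /rV; lia.
Qed.

Definition stmt_spec (p : conf) (f : nat -> nat) (L : nat) V A c g s := exists s',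
  [/\ run (cS c g) s s' (f L), sim p L s' V (sem p V A c), small p L V (sem p V A c)
    & forall y, low g y -> regs s' y = regs s y].

(** Stored values never exceed [cap], so [small] holds again with the same [L] after every
    statement. Costs therefore add up along sequences and loops instead of being composed, and
    polynomials suffice. *)
Lemma cS_spec c g : exists2 f, polybounded f & forall p L V A s,
  small p L V A -> sim p L s V A -> stmt_spec p f L V A c g s.
Proof.
elim: c g => [t e1 e2|c1 IH1 c2 IH2|x b c IH] g.
- have [f1 pf1 H1] := cE_spec e1 g; have [f2 pf2 H2] := cE_spec e2 g.+1.
  pose E1 := adrE t (Reg (rP g)).
  pose F1 := Op Defs.Mul (Op Defs.Sub (Reg (rP g.+1)) (Reg (rQ g.+1))) (Reg (rQ g)).
  pose F2 := Op Defs.Mul (Op Defs.Sub (Reg (rQ g.+1)) (Reg (rP g.+1))) (Reg (rQ g)).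
  pose K := acost (rP g) (absE g) + acost (rQ g) (flagE g.+1)
     + (acost 0 E1 + acost 0 F1) + (acost 0 (Op Defs.Add E1 (Cst 1)) + acost 0 F2).
  exists (fun L => f1 L + f2 L + (f1 L + f2 L + L + 1) * K); first by polyb.
  move=> p L V A s sm si.
  have [s1 [r1 k1 v1 b1]] := H1 _ _ _ _ _ sm si.
  have [s2 [r2 k2 v2 b2]] := H2 _ _ _ _ _ sm (sim_keeps k1 si).
  have [b1' v1'] := bounded_keeps (ltnSn g) k2 b1.
  set B := f1 L + f2 L + L + 1.
  have B0 : 0 < B by rewrite /B; lia.
  have [bP bQ] : bounded B s2 g by apply: bounded_le b1'; rewrite /B; lia.
  have [bP' bQ'] : bounded B s2 g.+1 by apply: bounded_le b2; rewrite /B; lia.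
  have si2 := sim_keeps k2 (sim_keeps k1 si).
  set j := absz (ev p V A e1); set z := ev p V A e2.
  have bL a : a < 2 ^ L -> a < 2 ^ B.
    by move=> h; apply: leq_trans h _; rewrite leq_exp2l // /B; lia.
  set s3 := set_reg s2 (rP g) j.
  have k3 : keeps (temp g) s2 s3 by apply/keeps_set/temp_rP.
  have si3 := sim_keeps k3 si2.
  have P3 : regs s3 (rP g) = j by rewrite set_reg_same.
  have P3' : regs s3 (rP g.+1) = regs s2 (rP g.+1) by rewrite set_reg_other // /rP; lia.
  have Q3' : regs s3 (rQ g.+1) = regs s2 (rQ g.+1).
    by rewrite set_reg_other // /rP /rQ; lia.
  set fl := eval s3 (flagE g.+1).
  have Efl : fl = (absz z <= cap p).
    rewrite /fl -[LHS]/(1 - (eval s3 (absE g.+1) - regs s3 (rV 2))).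
    rewrite eval_absE (sim_cap si3) /rval P3' Q3' -/(rval s2 g.+1) v2 -/z.
    by case: leqP; lia.
  set s4 := set_reg s3 (rQ g) fl.
  have k4 : keeps (temp g) s3 s4 by apply/keeps_set/temp_rQ.
  have si4 := sim_keeps k4 si3.
  have Q4 : regs s4 (rQ g) = fl by rewrite set_reg_same.
  have P4 : regs s4 (rP g) = j by rewrite set_reg_other // /rP /rQ; lia.
  have P4' : regs s4 (rP g.+1) = regs s2 (rP g.+1).
    by rewrite set_reg_other // /rP /rQ; lia.
  have Q4' : regs s4 (rQ g.+1) = regs s2 (rQ g.+1) by rewrite set_reg_other // /rQ; lia.
  have a4 : eval s4 E1 = adr (base p) t j.
    by rewrite (eval_adrE _ _ (sim_base si4)); congr adr.
  have zE : z = rval s2 g.+1 by [].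
  set z' := clip (cap p) z.
  have w1 : eval s4 F1 = pospart z'.
    rewrite -[LHS]/((regs s4 (rP g.+1) - regs s4 (rQ g.+1)) * regs s4 (rQ g)).
    rewrite P4' Q4' Q4 Efl /z' /clip zE /rval.
    by case: ifP => _; rewrite ?muln0 // muln1 ?pospart_sub ?negpart_sub.
  set s5 := set_mem s4 (adr (base p) t j) (pospart z').
  have w2 : eval s5 F2 = negpart z'.
    rewrite -[LHS]/((regs s4 (rQ g.+1) - regs s4 (rP g.+1)) * regs s4 (rQ g)).
    rewrite P4' Q4' Q4 Efl /z' /clip zE /rval.
    by case: ifP => _; rewrite ?muln0 // muln1 ?pospart_sub ?negpart_sub.
  have a5 : eval s5 E1 = adr (base p) t j by [].
  have bj : j < 2 ^ B.
    by rewrite /j -v1 -v1'; apply: bounded_absz.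
  have bfl : fl < 2 ^ B.
    by rewrite Efl; apply: (leq_ltn_trans (leq_b1 _)); rewrite -{1}(expn0 2) ltn_exp2l.
  have bb : regs s4 (rV 0) < 2 ^ B by rewrite (sim_base si4); apply/bL/(small_base sm).
  have fa : efine B s4 E1 by apply: efine_adrE => //; rewrite /efine P4.
  exists (set_mem s5 (adr (base p) t j).+1 (negpart z')); split.
  + apply: run_le; last first.
      apply: (run_seq r1); apply: (run_seq r2).
      apply: (run_seq (s1 := s3)).
        rewrite /s3 /j -v1 -v1' -eval_absE; apply: (run_assign _ B0).
        by do 2!split.
      apply: (run_seq (s1 := s4)).
        apply: (run_assign _ B0); split=> //; split.
          by do 2!split; rewrite /efine ?P3' ?Q3'.
        by rewrite /efine (sim_cap si3); apply/bL/(small_cap sm).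
      apply: (run_seq (s1 := s5)).
        rewrite /s5 -w1 -a4; apply: (run_write B0) => //.
        by split; [split|]; rewrite /efine ?P4' ?Q4' ?Q4.
      have -> : (adr (base p) t j).+1 = eval s5 (Op Defs.Add E1 (Cst 1)).
        by rewrite -[RHS]/(eval s5 E1 + 1) a5 addn1.
      rewrite -w2; apply: (run_write B0) => //.
      split; [split|].
      * by rewrite /efine -[regs s5 _]/(regs s4 (rQ g.+1)) Q4'.
      * by rewrite /efine -[regs s5 _]/(regs s4 (rP g.+1)) P4'.
      * by rewrite /efine -[regs s5 _]/(regs s4 (rQ g)) Q4.
    rewrite -/E1 -/F1 -/F2 -/B /K !mulnDr; lia.
  + exact: sim_write.
  + by apply: small_upd2 (clip_le _ _) sm.
  + move=> y ly; rewrite -[LHS]/(regs s4 y).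
    rewrite (keeps_low k4 (leqnn g) ly) (keeps_low k3 (leqnn g) ly).
    by rewrite (keeps_low k2 (leqnSn g) ly) (keeps_low k1 (leqnn g) ly).
- have [f1 pf1 H1] := IH1 g; have [f2 pf2 H2] := IH2 g.
  exists (fun L => f1 L + f2 L); first by polyb.
  move=> p L V A s sm si.
  have [s1 [r1 si1 sm1 l1]] := H1 _ _ _ _ _ sm si.
  have [s2 [r2 si2 sm2 l2]] := H2 _ _ _ _ _ sm1 si1.
  exists s2; split=> //; first exact: run_seq r1 r2.
  by move=> y ly; rewrite l2 // l1.
- have [fb pb Hb] := cE_spec b g; have [f pf Hf] := IH g.+1.
  pose Einc := Op Defs.Add (Reg (rV x.+3)) (Cst 1).
  pose K0 := acost (rP g) (minE (absE g) (rV 1)) + acost (rQ g) (Reg (rV x.+3))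
    + acost (rV x.+3) (Cst 0) + acost (rV x.+3) (Reg (rQ g)).
  pose BB L := L + fb L.
  pose tb L := f L + BB L * acost (rV x.+3) Einc.
  exists (fun L => fb L + BB L * K0 + (L + 1) * (tb L + (rP g + rV x.+3 + 4 * L + 6))).
    by rewrite /tb /BB; polyb.
  move=> p L V A s sm si; have L0 := small_pos sm.
  have [s1 [r1 k1 v1 b1]] := Hb _ _ _ _ _ sm si.
  set n := minn (absz (ev p V A b)) (nu p).
  pose F n := iteri n (fun i A' => sem p (upd V x i) A' c) A.
  have nnu : n <= nu p by apply: geq_minr.
  have nL : n <= L by apply: leq_trans nnu (small_nu sm).
  have B0 : 0 < BB L by rewrite /BB; lia.
  have ltB a : a < 2 ^ L -> a < 2 ^ BB L.
    by move=> h; apply: leq_trans h _; rewrite leq_exp2l // /BB; lia.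
  have ltL a : a <= L -> a < 2 ^ BB L.
    by move=> h; apply: ltB; apply: leq_ltn_trans h (ltn_expl _ _).
  pose Inv i s' := [/\ sim p L s' (upd V x i) (F i), small p L V (F i),
     regs s' (rP g) = n, regs s' (rQ g) = V x &
     forall y, low g y -> regs s' y = regs s y].
  have Hstep i s' : i < n -> Inv i s' -> exists2 s'',
      run (Seq (cS c g.+1) (Assign (rV x.+3) Einc)) s' s'' (tb L) & Inv i.+1 s''.
    move=> ltin [si' sm' n' o' l'].
    have inu : i <= nu p by apply: leq_trans nnu; apply: ltnW.
    have [s2 [r2 si2 sm2 l2]] := Hf _ _ _ _ _ (small_upd x sm' inu) si'.
    have x2 : regs s2 (rV x.+3) = i by rewrite (sim_var si2) /upd eqxx.
    exists (set_reg s2 (rV x.+3) i.+1).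
      apply: run_le (run_seq r2 _); last first.
        have -> : i.+1 = eval s2 Einc.
          by rewrite -[RHS]/(regs s2 (rV x.+3) + 1) x2 addn1.
        apply: (run_assign _ B0).
        by split=> //; rewrite /efine x2; apply: ltL; lia.
      by rewrite /tb; lia.
    split.
    - by apply: sim_setvar si2 _ => y; rewrite /upd; case: eqP.
    - by apply: small_var_irr sm2; apply: small_var sm.
    - by rewrite set_reg_other ?l2 // /low /rV /rP /=; lia.
    - by rewrite set_reg_other ?l2 // /low /rV /rQ /=; lia.
    - move=> y ly; rewrite set_reg_other ?l2 ?l' //; move: ly; rewrite /low /rV /=; lia.
  set s2 := set_reg s1 (rP g) n.
  set s3 := set_reg s2 (rQ g) (V x).
  set s4 := set_reg s3 (rV x.+3) 0.
  have si1 := sim_keeps k1 si.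
  have k2 : keeps (temp g) s1 s2 by apply/keeps_set/temp_rP.
  have k3 : keeps (temp g) s2 s3 by apply/keeps_set/temp_rQ.
  have si3 := sim_keeps k3 (sim_keeps k2 si1).
  have I0 : Inv 0 s4.
    split=> //.
    - exact: sim_setvar si3 _.
    - rewrite /s4 set_reg_other; last by rewrite /rV /rP; lia.
      rewrite /s3 set_reg_other; last by rewrite /rP /rQ; lia.
      by rewrite set_reg_same.
    - rewrite /s4 set_reg_other; last by rewrite /rV /rQ; lia.
      by rewrite set_reg_same.
    - move=> y ly; rewrite /s4 set_reg_other; last by move: ly; rewrite /low /rV /=; lia.
      rewrite (keeps_low k3 (leqnn g) ly) (keeps_low k2 (leqnn g) ly).
      exact: keeps_low k1 (leqnn g) _ ly.
  have Hr i s' : Inv i s' -> regs s' (rP g) = n /\ regs s' (rV x.+3) = i.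
    by case=> si' _ -> _ _; rewrite (sim_var si') /upd eqxx.
  have [s7 r7 [si7 sm7 n7 o7 l7]] := run_count Hstep Hr I0.
  exists (set_reg s7 (rV x.+3) (V x)); split.
  + apply: run_le; last first.
      apply: (run_seq r1); apply: (run_seq (s1 := s2)).
        have -> : s2 = set_reg s1 (rP g) (eval s1 (minE (absE g) (rV 1))).
          by rewrite eval_minE eval_absE v1 (sim_nu si1).
        apply: (run_assign _ B0); case: b1 => b1 b1'.
        have h1 : regs s1 (rP g) < 2 ^ BB L.
          by apply: leq_trans b1 _; rewrite leq_exp2l // /BB; lia.
        have h2 : regs s1 (rQ g) < 2 ^ BB L.
          by apply: leq_trans b1' _; rewrite leq_exp2l // /BB; lia.
        do 2!split=> //; rewrite /efine (sim_nu si1); apply: ltL; exact: small_nu sm.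
      apply: (run_seq (s1 := s3)).
        have e2 : regs s2 (rV x.+3) = V x.
          by rewrite set_reg_other ?(sim_var si1) // /rV /rP; lia.
        have -> : s3 = set_reg s2 (rQ g) (eval s2 (Reg (rV x.+3))).
          by rewrite -[eval _ _]/(regs s2 (rV x.+3)) e2.
        apply: (run_assign _ B0).
        by rewrite /efine e2; apply/ltB/(small_var sm).
      apply: (run_seq (s1 := s4)); first exact: (run_assign (B := BB L)).
      apply: (run_seq r7).
      rewrite -o7 -[regs s7 _]/(eval s7 (Reg (rQ g))); apply: (run_assign _ B0).
      by rewrite /efine o7; apply/ltB/(small_var sm).
    have : n.+1 * (tb L + (rP g + rV x.+3 + 4 * n + 6)) <=
      (L + 1) * (tb L + (rP g + rV x.+3 + 4 * L + 6)) by apply: leq_mul; lia.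
    rewrite /K0 !mulnDr; lia.
  + by apply: sim_setvar si7 _ => y; rewrite /upd; case: eqP => // ->.
  + by [].
  + move=> y ly; rewrite set_reg_other ?l7 //; move: ly; rewrite /low /rV /=; lia.
Qed.

(** * Set-up, output, and the complete compiled program *)

Fixpoint powP q : prog :=
  if q is q'.+1 then
    Seq (powP q') (Assign (rV 1) (Op Defs.Mul (Reg (rV 1)) (Reg (rP 0))))
  else Skip.

(** The header takes 4 cells and a clause at most [1 + 2 n], so this bounds the input length. The
    extra [n] keeps the output cells below the arrays even when there are no clauses. *)
Definition baseE : expr :=
  let n := Read (Cst 2) in let m := Read (Cst 3) in
  Op Defs.Add (Op Defs.Add (Cst 4) n)
    (Op Defs.Mul m (Op Defs.Add (Cst 1) (Op Defs.Add n n))).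

Definition loopcapE : expr :=
  Op Defs.Add (Op Defs.Add (Read (Cst 2)) (Read (Cst 3))) (Cst 2).

Definition prologue q : prog :=
  Seq (Assign (rV 0) baseE) (Seq (Assign (rP 0) loopcapE)
 (Seq (Assign (rV 1) (Cst 1)) (Seq (powP q)
 (Seq (Assign (rV 2) (Op Defs.Add (Read (Cst 1)) (Cst 1)))
 (Seq (Assign (rQ 0) (Cst 0))
      (While (Op Defs.Sub (Reg (rV 1)) (Reg (rQ 0)))
        (Seq (Assign (rV 2) (Op Defs.Add (Reg (rV 2)) (Reg (rV 2))))
             (Assign (rQ 0) (Op Defs.Add (Reg (rQ 0)) (Cst 1)))))))))).

(** The count [n] is copied to a register first, because the output overwrites the input cell that
    holds it. *)
Definition epilogue t : prog :=
  Seq (Assign (rP 1) (Read (Cst 2))) (Seq (Assign (rP 0) (Cst 0))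
    (While (Op Defs.Sub (Reg (rP 1)) (Reg (rP 0)))
      (Seq (Write (Reg (rP 0)) (Read (adrE t (Reg (rP 0)))))
           (Assign (rP 0) (Op Defs.Add (Reg (rP 0)) (Cst 1)))))).

Definition compile q (c : st) t : prog :=
  Seq (prologue q) (Seq (cS c 0) (epilogue t)).

(** The factor [d + 1] in the cap leaves room for the values up to [d] that parsing stores, even
    when [d], given in binary, exceeds [2 ^ nu]. *)
Definition wconf q (w : seq nat) : conf :=
  let n := nth 0 w 2 in let m := nth 0 w 3 in
  Conf w ((n + m + 2) ^ q) ((nth 0 w 1).+1 * 2 ^ ((n + m + 2) ^ q))
       (4 + n + m * (1 + (n + n))).

Lemma set_reg_neq s x y v : y != x -> regs (set_reg s x v) y = regs s y.
Proof. by move/eqP; apply: set_reg_other. Qed.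

Lemma powP_run q : exists K, forall L s, 0 < L -> regs s (rV 1) = 1 ->
  regs s (rP 0) ^ q < 2 ^ L -> 0 < regs s (rP 0) -> regs s (rP 0) < 2 ^ L ->
  exists s', [/\ run (powP q) s s' (L * K), keeps (pred1 (rV 1)) s s'
    & regs s' (rV 1) = regs s (rP 0) ^ q].
Proof.
elim: q => [|q [K IH]].
  exists 1 => L s L0 e1 _ _ _; exists s; split=> //.
  by exists 1; [move=> r; apply: ExecSkip | lia].
pose E := Op Defs.Mul (Reg (rV 1)) (Reg (rP 0)).
exists (K + acost (rV 1) E) => L s L0 e1 bq a0 ba.
have bq' : regs s (rP 0) ^ q < 2 ^ L.
  by apply: leq_ltn_trans bq; rewrite leq_pexp2l.
have [s1 [r1 k1 v1]] := IH L s L0 e1 bq' a0 ba.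
have P1 : regs s1 (rP 0) = regs s (rP 0) by case: k1 => _; apply.
exists (set_reg s1 (rV 1) (eval s1 E)); split.
- rewrite mulnDr; apply: run_seq r1 _; apply: (run_assign _ L0).
  by split; rewrite /efine ?P1 ?v1.
- by apply: (keeps_trans k1); apply: keeps_set; rewrite /= eqxx.
- by rewrite set_reg_same -[LHS]/(regs s1 (rV 1) * regs s1 (rP 0)) v1 P1 expnSr.
Qed.

Lemma prologue_run q : exists2 f, polybounded f & forall w L,
  small (wconf q.+1 w) L (fun=> 0) (fun _ _ => 0%R) -> exists2 s,
  run (prologue q.+1) (init_store w) s (f L) & sim (wconf q.+1 w) L s (fun=> 0) (fun _ _ => 0%R).
Proof.
have [K HK] := powP_run q.+1.
pose Ed := Op Defs.Add (Read (Cst 1)) (Cst 1).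
pose E2 := Op Defs.Add (Reg (rV 2)) (Reg (rV 2)).
pose E3 := Op Defs.Add (Reg (rQ 0)) (Cst 1).
pose K0 := acost (rV 0) baseE + acost (rP 0) loopcapE + acost (rV 1) (Cst 1)
  + K + acost (rV 2) Ed + acost (rQ 0) (Cst 0).
pose tb L := L * acost (rV 2) E2 + L * acost (rQ 0) E3.
exists (fun L => L * K0 + (L + 1) * (tb L + (rV 1 + rQ 0 + 4 * L + 6))).
  by rewrite /tb; polyb.
move=> w L sm; have L0 := small_pos sm; have bi := small_inp sm.
set p := wconf _ w in sm *.
pose n := nth 0 w 2; pose m := nth 0 w 3; pose d := nth 0 w 1.
set s0 := init_store w.
set s1 := set_reg s0 (rV 0) (base p).
set s2 := set_reg s1 (rP 0) (n + m + 2).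
set s3 := set_reg s2 (rV 1) 1.
have nuL : nu p < 2 ^ L by apply: leq_ltn_trans (small_nu sm) (ltn_expl _ _).
have P3 : regs s3 (rP 0) = n + m + 2 by [].
have a_nu : n + m + 2 <= nu p.
  by rewrite /p /= -/n -/m -{1}(expn1 (n + m + 2)) leq_pexp2l //; lia.
have [||||s4 [r4 k4 v4]] := HK L s3 L0; rewrite ?P3 //; try lia.
have [m4 k4'] := k4.
set s5 := set_reg s4 (rV 2) d.+1.
set s6 := set_reg s5 (rQ 0) 0.
pose Inv i s := [/\ Defs.mem s = Defs.mem s0, regs s (rV 0) = base p,
  regs s (rV 1) = nu p /\ regs s (rQ 0) = i, regs s (rV 2) = d.+1 * 2 ^ i
  & forall x, regs s (rV x.+3) = 0].
have Hstep i s : i < nu p -> Inv i s -> exists2 s',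
    run (Seq (Assign (rV 2) E2) (Assign (rQ 0) E3)) s s' (tb L) & Inv i.+1 s'.
  move=> inu [m' b' [n' i'] c' x'].
  have bc : d.+1 * 2 ^ i < 2 ^ L.
    apply: leq_ltn_trans (small_cap sm); rewrite /p /= leq_mul //.
    by rewrite leq_pexp2l // ltnW.
  have bi' : i < 2 ^ L by apply: ltn_trans nuL.
  pose t1 := set_reg s (rV 2) (eval s E2).
  exists (set_reg t1 (rQ 0) (eval t1 E3)).
    apply: run_seq; apply: (run_assign _ L0); split=> //; rewrite /efine ?c' //.
    by rewrite /t1 set_reg_neq // i'.
  split; first by [].
  - by rewrite set_reg_neq // set_reg_neq // b'.
  - rewrite set_reg_same; split; first by rewrite set_reg_neq // set_reg_neq // n'.
    rewrite -[LHS]/(regs t1 (rQ 0) + 1) set_reg_neq // i'; lia.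
  - rewrite set_reg_neq // set_reg_same -[LHS]/(regs s (rV 2) + regs s (rV 2)) c'.
    by rewrite expnS; lia.
  - by move=> x; rewrite !set_reg_other ?x' // /rQ /rV; lia.
have Hr i s : Inv i s -> regs s (rV 1) = nu p /\ regs s (rQ 0) = i by case=> _ _ [].
have I0 : Inv 0 s6.
  have kk y : y <> rV 1 -> regs s4 y = regs s3 y by move/eqP=> h; apply: k4'.
  split.
  - by rewrite -[LHS]/(Defs.mem s4) m4.
  - rewrite /s6 set_reg_neq // /s5 set_reg_neq // kk //.
  - by split=> //; rewrite /s6 set_reg_neq // /s5 set_reg_neq // v4.
  - by rewrite /s6 set_reg_neq // set_reg_same muln1.
  - move=> x; rewrite /s6 set_reg_other; last by rewrite /rV /rQ; lia.
    rewrite /s5 set_reg_other; last by rewrite /rV; lia.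
    rewrite kk; last by rewrite /rV; lia.
    rewrite /s3 set_reg_other; last by rewrite /rV; lia.
    rewrite /s2 set_reg_other; last by rewrite /rV /rP; lia.
    rewrite /s1 set_reg_other; last by rewrite /rV; lia.
    by [].
have [s7 r7 [m7 b7 [n7 i7] c7 x7]] := run_count Hstep Hr I0.
exists s7; last first.
  split=> //.
  - by move=> a _; rewrite m7.
  - move=> t j; rewrite m7 -[Defs.mem _ _]/(nth 0 w _) nth_default //.
    by apply: leq_trans (small_size sm) _; rewrite /adr; first [exact: leq_addr | exact/leqW/leq_addr].
  - move=> t j; rewrite m7 -[Defs.mem _ _]/(nth 0 w _) nth_default //.
    by apply: leq_trans (small_size sm) _; rewrite /adr; first [exact: leq_addr | exact/leqW/leq_addr].
apply: run_le; last first.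
  apply: (run_seq (s1 := s1)).
    by apply: (run_assign (B := L)) => //; do !split=> //; exact: bi.
  apply: (run_seq (s1 := s2)).
    by apply: (run_assign (B := L)) => //; do !split=> //; exact: bi.
  apply: (run_seq (s1 := s3)); first exact: (run_assign (B := L)).
  apply: (run_seq r4).
  apply: (run_seq (s1 := s5)).
    have -> : s5 = set_reg s4 (rV 2) (eval s4 Ed).
      by rewrite -[eval _ _]/(Defs.mem s4 1 + 1) m4 addn1.
    apply: (run_assign _ L0); split=> //; split=> //.
    by rewrite m4 -[X in X < _]/(nth 0 w 1).
  apply: (run_seq (s1 := s6)); first exact: (run_assign (B := L)).
  exact: r7.
have : (nu p).+1 * (tb L + (rV 1 + rQ 0 + 4 * nu p + 6)) <=
      (L + 1) * (tb L + (rV 1 + rQ 0 + 4 * L + 6)).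
  by apply: leq_mul; have := small_nu sm; lia.
rewrite /K0 !mulnDr; lia.
Qed.

Lemma epilogue_run t : exists2 f, polybounded f & forall p L V A s,
  small p L V A -> sim p L s V A -> nth 0 (inp p) 2 <= base p ->
  2 <= base p -> nth 0 (inp p) 2 <= L -> exists2 s', run (epilogue t) s s' (f L) &
  forall u, u < nth 0 (inp p) 2 -> Defs.mem s' u = pospart (A t u).
Proof.
pose E1 := Read (adrE t (Reg (rP 0))).
pose E2 := Op Defs.Add (Reg (rP 0)) (Cst 1).
pose K0 := acost (rP 1) (Read (Cst 2)) + acost (rP 0) (Cst 0).
pose tb L := L * (acost 0 (Reg (rP 0)) + acost 0 E1) + L * acost (rP 0) E2.
exists (fun L => L * K0 + (L + 1) * (tb L + (rP 1 + rP 0 + 4 * L + 6))).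
  by rewrite /tb; polyb.
move=> p L V A s sm si nb b2 nL; have L0 := small_pos sm.
set n := nth 0 (inp p) 2 in nb nL *.
pose Inv i s' := [/\ regs s' (rP 1) = n, regs s' (rP 0) = i, regs s' (rV 0) = base p,
  forall j, Defs.mem s' (adr (base p) t j) = pospart (A t j)
  & forall u, u < i -> Defs.mem s' u = pospart (A t u)].
have Hstep i s1 : i < n -> Inv i s1 -> exists2 s',
    run (Seq (Write (Reg (rP 0)) E1) (Assign (rP 0) E2)) s1 s' (tb L) & Inv i.+1 s'.
  move=> ltin [n1 i1 b1 a1 u1].
  have bi : i < 2 ^ L by apply: leq_ltn_trans (ltn_expl _ (ltnSn 1)); lia.
  have e1 : eval s1 E1 = pospart (A t i).
    rewrite -a1 -[LHS]/(Defs.mem s1 (eval s1 (adrE t (Reg (rP 0))))).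
    by rewrite (eval_adrE _ _ b1) -[eval _ _]/(regs s1 (rP 0)) i1.
  set s2 := set_mem s1 i (pospart (A t i)).
  exists (set_reg s2 (rP 0) i.+1).
    apply: (run_seq (s1 := s2)).
      have -> : s2 = set_mem s1 (eval s1 (Reg (rP 0))) (eval s1 E1).
        by rewrite e1 -[eval s1 (Reg _)]/(regs s1 (rP 0)) i1.
      apply: (run_write L0); first by rewrite /efine i1.
      split; first by apply: efine_adrE; rewrite /efine ?b1 ?i1 //; apply: small_base sm.
      rewrite -[X in X < _]/(eval s1 E1) e1; apply: leq_ltn_trans (pospart_le _) _.
      by apply: leq_ltn_trans (small_arr sm _ _) (small_cap sm).
    have -> : i.+1 = eval s2 E2 by rewrite -[RHS]/(regs s1 (rP 0) + 1) i1 addn1.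
    by apply: (run_assign _ L0); split=> //; rewrite /efine -[regs s2 _]/(regs s1 (rP 0)) i1.
  split=> //.
  - move=> j; rewrite /= /upd ifN ?a1 //; rewrite /adr; lia.
  - move=> u; rewrite ltnS leq_eqVlt /= /upd; case: eqP => [->//|_ /=]; exact: u1.
set s1 := set_reg s (rP 1) n; set s2 := set_reg s1 (rP 0) 0.
have I0 : Inv 0 s2.
  split=> //; last by move=> j; apply: (sim_pos si).
  by rewrite -(sim_base si).
have Hr i s' : Inv i s' -> regs s' (rP 1) = n /\ regs s' (rP 0) = i by case.
have [s7 r7 [n7 i7 b7 a7 u7]] := run_count Hstep Hr I0.
exists s7 => //.
have m2 : Defs.mem s 2 = n by rewrite (sim_inp si).
apply: run_le; last first.
  apply: (run_seq (s1 := s1)).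
    have -> : s1 = set_reg s (rP 1) (eval s (Read (Cst 2))).
      by rewrite -[eval _ _]/(Defs.mem s 2) m2.
    apply: (run_assign _ L0); split=> //.
    by rewrite -[X in X < _]/(Defs.mem s 2) m2; apply: leq_ltn_trans nL (ltn_expl _ _).
  apply: (run_seq (s1 := s2)); first exact: (run_assign (B := L)).
  exact: r7.
have : n.+1 * (tb L + (rP 1 + rP 0 + 4 * n + 6)) <=
      (L + 1) * (tb L + (rP 1 + rP 0 + 4 * L + 6)).
  by apply: leq_mul; lia.
rewrite /K0 !mulnDr; lia.
Qed.

Lemma compile_run q c t : exists2 f, polybounded f & forall w L,
  small (wconf q.+1 w) L (fun=> 0) (fun _ _ => 0%R) -> exists2 s,
  run (compile q.+1 c t) (init_store w) s (f L) &
  forall u, u < nth 0 w 2 -> Defs.mem s u =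
    pospart (sem (wconf q.+1 w) (fun=> 0) (fun _ _ => 0%R) c t u).
Proof.
have [f1 p1 H1] := prologue_run q.
have [f2 p2 H2] := cS_spec c 0.
have [f3 p3 H3] := epilogue_run t.
exists (fun L => f1 L + (f2 L + f3 L)); first by polyb.
move=> w L sm; have [s1 r1 si1] := H1 w L sm.
have [s2 [r2 si2 sm2 _]] := H2 _ _ _ _ _ sm si1.
have [||| s3 r3 o3] := H3 _ _ _ _ _ sm2 si2.
- by rewrite /=; lia.
- by rewrite /=; lia.
- apply: leq_trans (small_nu sm); rewrite /=.
  by apply: (@leq_trans (nth 0 w 2 + nth 0 w 3 + 2)); [lia|rewrite -{1}(expn1 (_ + 2)) leq_pexp2l //; lia].
exists s3 => //; exact: run_seq r1 (run_seq r2 r3).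
Qed.

(** * Size of the encoded instance and total running time *)

Lemma card_clause_le n d (P : csp n d) C : C \in clauses P -> #|C| <= n.
Proof.
move=> CP; rewrite -[n in _ <= n]card_ord.
rewrite -(card_in_imset (f := fst)); first exact: max_card.
move=> [u i] [v j] /= h1 h2 e; rewrite e in h1 *.
by rewrite (clauses_consistent CP h1 h2).
Qed.

Lemma size_encode k n d (P : csp n d) :
  size (encode k P) <= 4 + n + #|clauses P| * (1 + (n + n)).
Proof.
rewrite /encode /= size_flatten /shape sumnE !big_map.
have -> : \sum_(j <- enum (clauses P)) size (encode_clause j)
  = \sum_(C in clauses P) (1 + (#|C| + #|C|)).
  rewrite big_enum /=; apply: eq_bigr => C _.
  rewrite /encode_clause /= size_flatten /shape sumnE !big_map.
  rewrite (eq_bigr (fun=> 2)) // big_const_seq iter_addn_0 count_predT -cardE.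
  by rewrite mul2n -addnn.
have : \sum_(C in clauses P) (1 + (#|C| + #|C|)) <= \sum_(C in clauses P) (1 + (n + n)).
  by apply: leq_sum => C /card_clause_le; lia.
rewrite sum_nat_const => h.
apply: (@leq_trans (4 + \sum_(C in clauses P) (1 + (#|C| + #|C|)))); first by [].
by rewrite -addnA leq_add2l; apply: leq_trans h (leq_addl _ _).
Qed.

Lemma size_encode_ge k n d (P : csp n d) : #|clauses P| <= size (encode k P).
Proof.
rewrite /encode /= size_flatten /shape sumnE !big_map cardE.
elim: (enum _) => [|C s IH]; first by rewrite big_nil.
by rewrite big_cons /=; move: IH; rewrite /encode_clause /=; lia.
Qed.

Lemma bitlen_gt v : v < 2 ^ bitlen v.
Proof. exact: trunc_log_ltn. Qed.

Lemma size_le_input_size k n d (P : csp n d) :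
  [/\ n <= input_size k P, #|clauses P| <= input_size k P
    & forall a, nth 0 (encode k P) a < 2 ^ input_size k P].
Proof.
rewrite /input_size; split; first exact: leq_addr.
  apply: leq_trans (size_encode_ge k P) _.
  apply: leq_trans (leq_addl _ _); rewrite -sum1_size.
  by apply: leq_sum => a _.
move=> a; case: (ltnP a (size (encode k P))) => h; last first.
  by rewrite nth_default // expn_gt0.
apply: leq_trans (bitlen_gt _) _; rewrite leq_exp2l //.
apply: leq_trans (leq_addl _ _).
rewrite (big_nth 0) big_mkord (bigD1 (Ordinal h)) //=; exact: leq_addr.
Qed.

Definition sizebound q z :=
  (2 * z + 2) ^ q + (4 + z + z * (1 + (z + z))) + z + 1.

Lemma sizebound_small q k n d (P : csp n d) :
  small (wconf q (encode k P)) (sizebound q (input_size k P)) (fun=> 0) (fun _ _ => 0%R).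
Proof.
have [zn zm za] := size_le_input_size k P.
set z := input_size k P in zn zm za *; set m := #|clauses P| in zm *.
have hnu : (n + m + 2) ^ q <= (2 * z + 2) ^ q by apply: leq_exp2r_weak; lia.
have hb : 4 + n + m * (1 + (n + n)) <= 4 + z + z * (1 + (z + z)).
  by rewrite leq_add ?leq_mul //; lia.
have le2 a b : a <= b -> a < 2 ^ b.
  by move=> ab; apply: leq_ltn_trans ab (ltn_expl _ _).
split=> //=; rewrite /sizebound -/m.
- by lia.
- by lia.
- by apply: le2; lia.
- have h1 : d < 2 ^ z by apply: (za 1).
  apply: (@leq_ltn_trans (2 ^ z * 2 ^ ((2 * z + 2) ^ q))).
    by apply: leq_mul => //; rewrite leq_pexp2l.
  by rewrite -expnD ltn_exp2l //; lia.
- by move=> x; rewrite expn_gt0.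
- move=> a; apply: leq_trans (za a) _; rewrite leq_exp2l //; lia.
- exact: size_encode.
Qed.

Lemma compile_correct q c t : exists T : {poly nat},
  forall k n d (P : csp n d) (r : (T.[input_size k P]%R).-tuple bool),
  exists s b, [/\ exec (compile q.+1 c t) (init_store (encode k P)) r s r b,
    b <= T.[input_size k P]%R &
    forall u : 'I_n, Defs.mem s u =
      pospart (sem (wconf q.+1 (encode k P)) (fun=> 0) (fun _ _ => 0%R) c t u)].
Proof.
have [f pf H] := compile_run q c t.
have psb : polybounded (sizebound q.+1) by rewrite /sizebound; polyb.
have [e He] := polybounded_comp pf psb.
exists (('X + 2%:P) ^+ e)%R => k n d P r.
have [s [b r1 r2] o] := H _ _ (sizebound_small q.+1 k P).
exists s, b; split=> //.
  apply: leq_trans r2 (leq_trans (He _) _).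
  by rewrite horner_exp hornerD hornerX hornerC natrXE natrDE.
by move=> u; apply: o.
Qed.

Lemma success_prob1 (R : realType) A w N (Q : store -> Prop) :
  (forall r : N.-tuple bool, exists s r' t, exec A (init_store w) r s r' t /\ Q s) ->
  success_prob R A w N Q = 1%R.
Proof.
move=> H; rewrite /success_prob (_ : [set r | _] = setT).
  by rewrite cardsT card_tuple card_bool natrX divff // expf_neq0 // pnatr_eq0.
by apply/setP => r; rewrite !inE; apply/asboolP.
Qed.

Local Open Scope ring_scope.

(** * Log-convex sequences and moments of a Gram matrix *)

(** The ratios [a j.+1 / a j] do not decrease; stated without division, since a vanishing term makes
    the next one vanish. *)
Lemma logconvex_ratio (R : realFieldType) (a : nat -> R) :
  (forall j, 0 <= a j) -> (forall j, a j.+1 ^+ 2 <= a j * a j.+2) ->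
  forall n, a 1%N * a n <= a 0%N * a n.+1.
Proof.
move=> a0 lc; elim=> [|n IH]; first by rewrite mulrC.
have := a0 n; rewrite le0r => /orP[/eqP an|an].
  have : a n.+1 ^+ 2 <= 0 by rewrite (le_trans (lc n)) // an mul0r.
  rewrite le_eqVlt ltNge sqr_ge0 orbF sqrf_eq0 => /eqP ->.
  by rewrite mulr0 mulr_ge0.
rewrite -(ler_pM2r an).
apply: (@le_trans _ _ (a 0%N * a n.+1 ^+ 2)).
  by have := ler_wpM2r (a0 n.+1) IH; nra.
by have := ler_wpM2l (a0 0%N) (lc n); nra.
Qed.

(** In terms of ratios: the first one is at most the geometric mean of the first [n.+1]. *)
Lemma logconvex_first (R : realFieldType) (a : nat -> R) :
  (forall j, 0 <= a j) -> (forall j, a j.+1 ^+ 2 <= a j * a j.+2) ->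
  forall n, a 1%N ^+ n.+1 <= a 0%N ^+ n * a n.+1.
Proof.
move=> a0 lc; elim=> [|n IH]; first by rewrite expr0 mul1r.
rewrite exprS; apply: le_trans (ler_wpM2l (a0 _) IH) _.
rewrite mulrCA exprSr -mulrA; apply: ler_wpM2l; first by rewrite exprn_ge0.
exact: logconvex_ratio.
Qed.

(** In terms of ratios: the last one is at least the geometric mean of the [n] before it. *)
Lemma logconvex_last (R : realFieldType) (a : nat -> R) :
  (forall j, 0 <= a j) -> (forall j, a j.+1 ^+ 2 <= a j * a j.+2) ->
  forall n, a n ^+ n.+1 <= a 0%N * a n.+1 ^+ n.
Proof.
move=> a0 lc; elim=> [|n IH]; first by rewrite expr0 mulr1.
have := a0 n.+1; rewrite le0r => /orP[/eqP ->|an].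
  by rewrite expr0n mulr_ge0 // exprn_ge0.
have an' : 0 < a n.+1 ^+ n by rewrite exprn_gt0.
rewrite -(ler_pM2r an') -exprD.
have -> : (n.+2 + n = 2 * n.+1)%N by lia.
rewrite exprM; apply: (@le_trans _ _ ((a n * a n.+2) ^+ n.+1)).
  by rewrite lerXn2r ?nnegrE ?sqr_ge0 ?mulr_ge0.
rewrite exprMn mulrAC; apply: ler_wpM2r; first by rewrite exprn_ge0.
exact: IH.
Qed.

Lemma cauchy_schwarz (R : realFieldType) (I : finType) (w x y : I -> R) :
  (forall i, 0 <= w i) ->
  (\sum_i w i * (x i * y i)) ^+ 2 <= (\sum_i w i * x i ^+ 2) * (\sum_i w i * y i ^+ 2).
Proof.
move=> w0.
have sumE (a c : R) : \sum_i w i * (a * y i - c * x i) ^+ 2 =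
    a ^+ 2 * (\sum_i w i * y i ^+ 2) - 2 * a * c * (\sum_i w i * (x i * y i))
    + c ^+ 2 * (\sum_i w i * x i ^+ 2).
  rewrite !mulr_sumr -sumrB -big_split /=.
  by apply: eq_bigr => i _; ring.
move: sumE; set C := \sum_i w i * (x i * y i); set A := \sum_i w i * x i ^+ 2.
set B := \sum_i w i * y i ^+ 2 => sumE.
have A0 : 0 <= A by apply: sumr_ge0 => i _; rewrite mulr_ge0 ?sqr_ge0.
have := A0; rewrite le0r => /orP[/eqP Az|Ap].
  have C0 : C = 0.
    apply: big1 => i _; have /eqP := Az; rewrite psumr_eq0; last first.
      by move=> j _; rewrite mulr_ge0 ?sqr_ge0.
    move=> /allP/(_ i); rewrite mem_index_enum => /(_ isT).
    by rewrite /= mulf_eq0 sqrf_eq0 => /orP[]/eqP ->; rewrite ?mul0r ?mulr0.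
  by rewrite Az mul0r C0 expr0n.
have : 0 <= \sum_i w i * (A * y i - C * x i) ^+ 2.
  by apply: sumr_ge0 => i _; rewrite mulr_ge0 ?sqr_ge0.
have -> : \sum_i w i * (A * y i - C * x i) ^+ 2 = A * (A * B - C ^+ 2).
  by rewrite sumE; ring.
by rewrite pmulr_rge0 // subr_ge0.
Qed.

Lemma cauchy_schwarz1 (R : realFieldType) (I : finType) (x y : I -> R) :
  (\sum_i x i * y i) ^+ 2 <= (\sum_i x i ^+ 2) * (\sum_i y i ^+ 2).
Proof.
have E (f : I -> R) : \sum_i 1 * f i = \sum_i f i.
  by apply: eq_bigr => i _; rewrite mul1r.
by have := @cauchy_schwarz R I (fun=> 1) x y (fun=> ler01); rewrite !E.
Qed.

Lemma mxtrace_weighted (R : comRingType) r N (X Y : 'M[R]_(r, N)) (v : 'rV[R]_N) :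
  \tr (X *m diag_mx v *m Y^T) = \sum_(p : 'I_r * 'I_N) v 0 p.2 * (X p.1 p.2 * Y p.1 p.2).
Proof.
rewrite /mxtrace -(pair_bigA _ (fun i j => v 0 j * (X i j * Y i j))) /=.
apply: eq_bigr => i _; rewrite mxE; apply: eq_bigr => j _.
by rewrite mul_mx_diag !mxE; ring.
Qed.

Definition gram (R : comRingType) m N (B : 'M[R]_(m, N)) (v : 'rV[R]_N) :=
  B *m diag_mx v *m B^T.

Definition mxpow (R : comRingType) m (M : 'M[R]_m) j := iter j (mulmx M) 1%:M.

Lemma mxpowD (R : comRingType) m (M : 'M[R]_m) i j :
  mxpow M (i + j) = mxpow M i *m mxpow M j.
Proof. by elim: i => [|i IH]; rewrite ?mul1mx // addSn /= IH mulmxA. Qed.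

Lemma mxpowSr (R : comRingType) m (M : 'M[R]_m) j : mxpow M j.+1 = mxpow M j *m M.
Proof. by rewrite -addn1 mxpowD /= mulmx1. Qed.

Lemma mxpow_sym (R : comRingType) m (M : 'M[R]_m) j :
  M^T = M -> (mxpow M j)^T = mxpow M j.
Proof.
move=> sM; elim: j => [|j IH]; first exact: trmx1.
by rewrite [in LHS]mxpowSr trmx_mul IH sM.
Qed.

Lemma gram_sym (R : comRingType) m N (B : 'M[R]_(m, N)) (v : 'rV[R]_N) : (gram B v)^T = gram B v.
Proof. by rewrite /gram !trmx_mul trmxK tr_diag_mx mulmxA. Qed.

(** For a row [U] this is a moment of the spectral measure of the Gram matrix at [U]; for [U] the
    identity it is the power sum of the eigenvalues. Both cases are needed in one definition. *)
Definition moment (R : comRingType) r m N (U : 'M[R]_(r, m)) (B : 'M[R]_(m, N)) (v : 'rV[R]_N) j :=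
  \tr (U *m mxpow (gram B v) j *m U^T).

Lemma moment_even (R : comRingType) r m N (U : 'M[R]_(r, m)) (B : 'M[R]_(m, N)) (v : 'rV[R]_N) i j :
  moment U B v (i + j) =
  \sum_(p : 'I_r * 'I_m) (U *m mxpow (gram B v) i) p.1 p.2 * (U *m mxpow (gram B v) j) p.1 p.2.
Proof.
rewrite /moment mxpowD; set X := mxpow _ i; set Y := mxpow _ j.
have -> : U *m (X *m Y) *m U^T = (U *m X) *m diag_mx (const_mx 1) *m (U *m Y)^T.
  by rewrite diag_const_mx mulmx1 trmx_mul mxpow_sym ?gram_sym // !mulmxA.
by rewrite mxtrace_weighted; apply: eq_bigr => p _; rewrite mxE mul1r.
Qed.

Lemma moment_odd (R : comRingType) r m N (U : 'M[R]_(r, m)) (B : 'M[R]_(m, N)) (v : 'rV[R]_N) i j :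
  moment U B v (i + j).+1 = \sum_(p : 'I_r * 'I_N) v 0 p.2 *
    ((U *m mxpow (gram B v) i *m B) p.1 p.2 * (U *m mxpow (gram B v) j *m B) p.1 p.2).
Proof.
rewrite -mxtrace_weighted /moment -addnS mxpowD /=; congr (\tr _).
by rewrite !trmx_mul mxpow_sym ?gram_sym // /gram !mulmxA.
Qed.

Lemma moment_ge0 (R : realFieldType) r m N (U : 'M[R]_(r, m)) (B : 'M[R]_(m, N)) (v : 'rV[R]_N) j :
  (forall l, 0 <= v 0 l) -> 0 <= moment U B v j.
Proof.
move=> v0; rewrite -(odd_double_half j) -addnn; case: (odd j); rewrite ?add0n ?add1n.
  by rewrite moment_odd; apply: sumr_ge0 => p _; rewrite mulr_ge0 // -expr2 sqr_ge0.
by rewrite moment_even; apply: sumr_ge0 => p _; rewrite -expr2 sqr_ge0.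
Qed.

(** Cauchy-Schwarz between two consecutive half powers: in the plain inner product for even [j], and
    for odd [j] in the one weighted by [v], the middle factor being split as [B], [v], [B^T]. *)
Lemma moment_logconvex (R : realFieldType) r m N (U : 'M[R]_(r, m)) (B : 'M[R]_(m, N)) (v : 'rV[R]_N) j :
  (forall l, 0 <= v 0 l) ->
  moment U B v j.+1 ^+ 2 <= moment U B v j * moment U B v j.+2.
Proof.
move=> v0; rewrite -(odd_double_half j); set i := j./2; rewrite -addnn.
case: (odd j); rewrite ?add0n ?add1n.
- have -> : ((i + i).+2 = (i + i.+1).+1)%N by lia.
  have -> : ((i + i.+1).+2 = (i.+1 + i.+1).+1)%N by lia.
  by rewrite !moment_odd; apply: cauchy_schwarz => p.
- have -> : ((i + i).+1 = (i + i.+1))%N by lia.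
  have -> : ((i + i.+1).+1 = (i.+1 + i.+1))%N by lia.
  rewrite !moment_even.
  exact: cauchy_schwarz1.
Qed.

(** The Frobenius norm of a power of the Gram matrix bounds its operator norm. *)
Lemma moment_row_le (R : realFieldType) m N (b : 'rV[R]_m) (B : 'M[R]_(m, N)) (v : 'rV[R]_N) i :
  moment b B v (i + i) <= moment b B v 0 * moment 1%:M B v (i + i).
Proof.
have E0 : moment b B v 0 = \sum_k b 0 k ^+ 2.
  rewrite (moment_even b B v 0 0) -(pair_bigA _ (fun i j => (b *m mxpow (gram B v) 0) i j * (b *m mxpow (gram B v) 0) i j)) /= big_ord1.
  by apply: eq_bigr => k _; rewrite mulmx1 expr2.
rewrite E0 !moment_even mul1mx; set X := mxpow _ i.
rewrite -(pair_bigA _ (fun i j => (b *m X) i j * (b *m X) i j)) /= big_ord1.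
rewrite -(pair_bigA _ (fun i j => X i j * X i j)) /= exchange_big /= mulr_sumr.
apply: ler_sum => c _; rewrite -expr2 mxE.
exact: cauchy_schwarz1.
Qed.

(** Weighted Cauchy-Schwarz bounds [|B z|^2] by the largest eigenvalue times the sum of [z^2 / v];
    the ratio of two consecutive traces replaces that eigenvalue at the cost of a factor 2. For
    [b = B z], the first ratio of the moments at [b] is compared with the last ratio of the
    traces. *)
Lemma gram_dual (R : realFieldType) m N (B : 'M[R]_(m, N)) (v : 'rV[R]_N) (z : 'cV[R]_N) :
  (forall l, 0 < v 0 l) ->
  (\sum_c (B *m z) c 0 ^+ 2) * moment 1%:M B v (m + m).+1
  <= 2 * moment 1%:M B v (m.+1 + m.+1) * \sum_l z l 0 ^+ 2 / v 0 l.
Proof.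
move=> v0; have v0' l : 0 <= v 0 l by apply: ltW.
pose b := (B *m z)^T.
pose bm := moment b B v; pose t := moment 1%:M B v; pose P := (m + m).+1.
have P1 : (m.+1 + m.+1 = P.+1)%N by rewrite /P; lia.
have bm0 j : 0 <= bm j by apply: moment_ge0.
have t0 j : 0 <= t j by apply: moment_ge0.
have h1 : bm 1%N ^+ P.+1 <= bm 0%N ^+ P * bm P.+1.
  by apply: logconvex_first => // j; apply: moment_logconvex.
have h2 : t P ^+ P.+1 <= t 0%N * t P.+1 ^+ P.
  by apply: logconvex_last => // j; apply: moment_logconvex.
have h3 : bm P.+1 <= bm 0%N * t P.+1 by rewrite /bm /t -P1; apply: moment_row_le.
have t0E : t 0%N = m%:R by rewrite /t /moment /mxpow /= trmx1 !mulmx1 mxtrace1.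
have main : bm 1%N * t P <= 2 * (bm 0%N * t P.+1).
  have p0 : 0 <= 2 * (bm 0%N * t P.+1) by rewrite !mulr_ge0.
  rewrite -(@ler_pXn2r _ P.+1) ?nnegrE ?mulr_ge0 //.
  rewrite !exprMn.
  apply: (@le_trans _ _ (bm 0%N ^+ P * (bm 0%N * t P.+1) * (m%:R * t P.+1 ^+ P))).
    apply: ler_pM; rewrite ?exprn_ge0 //; last by rewrite -t0E.
    by apply: le_trans h1 _; rewrite ler_wpM2l // exprn_ge0.
  have -> : bm 0%N ^+ P * (bm 0%N * t P.+1) * (m%:R * t P.+1 ^+ P)
    = m%:R * (bm 0%N ^+ P.+1 * t P.+1 ^+ P.+1) by rewrite !exprS; ring.
  apply: ler_wpM2r; first by rewrite mulr_ge0 // exprn_ge0.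
  (* The dimension [m], which is the trace of the zeroth power, enters only through its
     [(2 m + 2)]-th root, at most 2; hence the choice of the power. *)
  rewrite -natrX ler_nat; apply: leq_trans (ltnW (ltn_expl m (ltnSn 1))) _.
  by rewrite leq_exp2l // /P; lia.
have E0 : bm 0%N = \sum_c (B *m z) c 0 ^+ 2.
  rewrite /bm (moment_even b B v 0 0) -(pair_bigA _ (fun i j => (b *m mxpow (gram B v) 0) i j * (b *m mxpow (gram B v) 0) i j)) /= big_ord1.
  by apply: eq_bigr => k _; rewrite mulmx1 mxE expr2.
have E1 : bm 1%N = \sum_l v 0 l * (b *m B) 0 l ^+ 2.
  rewrite /bm (moment_odd b B v 0 0) -(pair_bigA _ (fun i j => v 0 j * ((b *m mxpow (gram B v) 0 *m B) i j * (b *m mxpow (gram B v) 0 *m B) i j))) /= big_ord1.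
  by apply: eq_bigr => k _; rewrite mulmx1 expr2.
set Z := \sum_l z l 0 ^+ 2 / v 0 l.
have Z0 : 0 <= Z by apply: sumr_ge0 => l _; rewrite mulr_ge0 ?sqr_ge0 ?invr_ge0 //.
have cs : bm 0%N ^+ 2 <= bm 1%N * Z.
  have -> : bm 0%N = \sum_l v 0 l * ((b *m B) 0 l * (z l 0 / v 0 l)).
    rewrite E0 -[LHS](_ : (b *m (B *m z)) 0 0 = _); last first.
      by rewrite mxE; apply: eq_bigr => c _; rewrite /b mxE expr2.
    rewrite mulmxA mxE; apply: eq_bigr => l _.
    by field; rewrite lt0r_neq0.
  rewrite E1 (_ : Z = \sum_l v 0 l * (z l 0 / v 0 l) ^+ 2).
    exact: cauchy_schwarz.
  by apply: eq_bigr => l _; field; rewrite lt0r_neq0.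
rewrite -E0 P1 -/P -/t.
have := bm0 0%N; rewrite le0r => /orP[/eqP ->|bp].
  by rewrite mul0r !mulr_ge0.
rewrite -(ler_pM2l bp).
have := ler_wpM2r (t0 P) cs; have := ler_wpM2r Z0 main; move: (t P) (t P.+1) => x y; nra.
Qed.

(** Settles the degenerate round: the first moment vanishes as well, and it is a sum of squares of
    the entries of [B] with positive weights. *)
Lemma gram_trace_eq0 (R : realFieldType) m N (B : 'M[R]_(m, N)) (v : 'rV[R]_N) :
  (forall l, 0 < v 0 l) -> moment 1%:M B v (m + m).+1 = 0 -> B = 0.
Proof.
move=> v0 t0; have v0' l : 0 <= v 0 l by apply: ltW.
have h1 : moment 1%:M B v 1 ^+ (m + m).+1 <= 0.
  have := @logconvex_first R (moment 1%:M B v) (fun j => moment_ge0 _ _ _ v0')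
    (fun j => moment_logconvex _ _ _ v0') (m + m).
  by rewrite t0 mulr0.
have {h1} : moment 1%:M B v 1 = 0.
  apply/eqP; have := h1; rewrite le_eqVlt ltNge exprn_ge0 ?moment_ge0 // orbF.
  by rewrite expf_eq0 => /andP[].
rewrite (moment_odd _ B v 0 0) => /eqP; rewrite psumr_eq0; last first.
  by move=> p _; rewrite mulr_ge0 // -expr2 sqr_ge0.
move=> /allP H; apply/matrixP => c l; rewrite mxE.
have := H (c, l); rewrite mem_index_enum => /(_ isT) /=.
rewrite mulf_eq0 (gt_eqF (v0 l)) /= mulmx1 mul1mx -expr2 sqrf_eq0.
by move/eqP.
Qed.

Local Close Scope ring_scope.

Local Open Scope ring_scope.

(** * One round of the primal-dual method in integers *)

(** Matrices and vectors are total functions on [nat], so that the arrays of the program can be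
    plugged in directly. *)
Definition qf m N (B : nat -> nat -> int) (z : nat -> int) : int :=
  \sum_(c < m) (\sum_(l < N) B c l * z l) ^+ 2.

Lemma qf_ge0 m N B z : 0 <= qf m N B z.
Proof. by apply: sumr_ge0 => c _; rewrite sqr_ge0. Qed.

Definition mxB m N (B : nat -> nat -> int) : 'M[int]_(m, N) := \matrix_(c, l) B c l.
Definition rowv N (v : nat -> int) : 'rV[int]_N := \row_l v l.

Lemma map_mxpow (R S : comRingType) (f : {rmorphism R -> S}) m (M : 'M[R]_m) j :
  map_mx f (mxpow M j) = mxpow (map_mx f M) j.
Proof.
elim: j => [|j IH]; first by rewrite map_mx1.
by rewrite -[mxpow M j.+1]/(M *m mxpow M j) map_mxM IH.
Qed.

Lemma map_moment (R S : comRingType) (f : {rmorphism R -> S}) r m N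
    (U : 'M[R]_(r, m)) (B : 'M[R]_(m, N)) (v : 'rV[R]_N) j :
  moment (map_mx f U) (map_mx f B) (map_mx f v) j = f (moment U B v j).
Proof.
rewrite /moment -trace_map_mx !map_mxM map_trmx map_mxpow /gram.
by rewrite !map_mxM map_diag_mx map_trmx.
Qed.

Section Round.
Variables (m N : nat) (B : nat -> nat -> int) (v : nat -> int) (g : nat -> nat -> int).
Variables (cc S : int).
Hypothesis v_gt0 : forall l, (l < N)%N -> 0 < v l.
Let H := mxpow (gram (mxB m N B) (rowv N v)) m.
Hypothesis gE : forall (c : 'I_m) (l : 'I_N), g c l = \sum_(c' < m) B c' l * H c' c.
Let nrm := \sum_(c < m) \sum_(l < N) v l * g c l ^+ 2.
Hypothesis cc_le : cc ^+ 2 * nrm <= S ^+ 2.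
Hypothesis cc_ge : nrm = 0 \/ S ^+ 2 <= 4 * (cc ^+ 2 * nrm).
Let x c l := cc * v l * g c l.
Let qt := \sum_(c < m) qf m N B (x c).

Lemma H_sym (c c' : 'I_m) : H c c' = H c' c.
Proof. by rewrite -[H in LHS](mxpow_sym _ (gram_sym _ _)) mxE. Qed.

(** The vectors [x c] are the rows of [H B diag(v)] times the scale [cc], where [H] is the [m]-th
    power of the Gram matrix. So [nrm] and [qt] are, up to [cc ^+ 2], the traces of its powers
    [2 m + 1] and [2 m + 2], the two compared in [gram_dual]. *)
Lemma nrm_moment : nrm = moment 1%:M (mxB m N B) (rowv N v) (m + m).+1.
Proof.
rewrite moment_odd mul1mx -/H /nrm.
rewrite -(pair_bigA _ (fun i j => rowv N v 0 j * ((H *m mxB m N B) i j * (H *m mxB m N B) i j))) /=.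
apply: eq_bigr => c _; apply: eq_bigr => l _; rewrite mxE -expr2; congr (_ * _ ^+ 2).
by rewrite gE mxE; apply: eq_bigr => c' _; rewrite mxE H_sym mulrC.
Qed.

Lemma qt_moment : qt = cc ^+ 2 * moment 1%:M (mxB m N B) (rowv N v) (m.+1 + m.+1).
Proof.
rewrite moment_even mul1mx -/H; set G := mxpow _ m.+1.
rewrite -(pair_bigA _ (fun i j => G i j * G i j)) /= exchange_big /= mulr_sumr.
apply: eq_bigr => c _; rewrite /qf mulr_sumr; apply: eq_bigr => c' _.
rewrite -expr2 -exprMn; congr (_ ^+ 2).
rewrite /G /mxpow /= -/(mxpow _ m) -/H /gram -mulmxA mxE mulr_sumr.
apply: eq_bigr => l _; rewrite mul_mx_diag !mxE /x gE.
have -> : \sum_j (mxB m N B)^T l j * H j c = \sum_(j < m) B j l * H j c.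
  by apply: eq_bigr => j _; rewrite !mxE.
ring.
Qed.

(** The constant 8 is the factor 2 of [gram_dual] times the factor 4 lost in choosing the scale [cc]
    among powers of 2. *)
Lemma round_dual (z : nat -> int) :
  (qf m N B z)%:~R * (S ^+ 2)%:~R <= 8 * qt%:~R * \sum_(l < N) (z l ^+ 2)%:~R / (v l)%:~R :> rat.
Proof.
pose f : {rmorphism int -> rat} := intr.
pose Bq := map_mx f (mxB m N B); pose vq := map_mx f (rowv N v).
pose zq : 'cV[rat]_N := \col_l (z l)%:~R.
have vq0 l : 0 < vq 0 l by rewrite !mxE ltr0z v_gt0.
have mE j : moment 1%:M Bq vq j = (moment 1%:M (mxB m N B) (rowv N v) j)%:~R.
  by rewrite -(map_mx1 f) map_moment.
have qE : (qf m N B z)%:~R = \sum_c (Bq *m zq) c 0 ^+ 2.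
  rewrite rmorph_sum /=; apply: eq_bigr => c _; rewrite rmorphXn /=; congr (_ ^+ 2).
  by rewrite mxE rmorph_sum /=; apply: eq_bigr => l _; rewrite !mxE rmorphM.
have ZE : \sum_(l < N) (z l ^+ 2)%:~R / (v l)%:~R = \sum_l zq l 0 ^+ 2 / vq 0 l.
  by apply: eq_bigr => l _; rewrite !mxE rmorphXn.
have Z0 : 0 <= \sum_l zq l 0 ^+ 2 / vq 0 l.
  by apply: sumr_ge0 => l _; rewrite mulr_ge0 ?sqr_ge0 ?invr_ge0 ?ltW.
have qt0 : 0 <= qt by apply: sumr_ge0 => c _; apply: qf_ge0.
case: cc_ge => [n0|ccS].
  have B0 : Bq = 0.
    by apply: (gram_trace_eq0 vq0); rewrite mE -nrm_moment n0.
  rewrite qE B0 ZE big1; last by move=> c _; rewrite mul0mx mxE expr0n.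
  by rewrite mul0r !mulr_ge0 // ler0z.
have := gram_dual Bq zq vq0; rewrite !mE -nrm_moment -qE -ZE => D.
have D2 := ler_wpM2l (_ : 0 <= 4 * (cc ^+ 2)%:~R) D.
apply: (@le_trans _ _ ((qf m N B z)%:~R * (4 * (cc ^+ 2 * nrm))%:~R)).
  by rewrite ler_wpM2l ?ler0z ?qf_ge0 // ler_int.
have := D2; rewrite mulr_ge0 ?ler0z ?sqr_ge0 // => /(_ isT).
rewrite qt_moment !rmorphM /= => D3.
by apply: le_trans (le_trans D3 _); rewrite le_eqVlt; apply/orP; left; apply/eqP; ring.
Qed.

(** [v l * g c l ^+ 2], summed over [c], is one of the terms of [nrm]. With [v l <= 2 * N] this
    limits the width of an update. *)
Lemma round_col (l : nat) : (l < N)%N ->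
  \sum_(c < m) x c l ^+ 2 <= v l * S ^+ 2.
Proof.
move=> lN; apply: le_trans (_ : v l * (cc ^+ 2 * nrm) <= _); last first.
  by rewrite ler_wpM2l // ltW // v_gt0.
rewrite /nrm !mulr_sumr; apply: ler_sum => c _.
rewrite (bigD1 (Ordinal lN)) //= mulrDr mulrDr /x -[leLHS]addr0.
apply: lerD; first by rewrite le_eqVlt; apply/orP; left; apply/eqP; ring.
apply: mulr_ge0; first by rewrite ltW // v_gt0.
apply: mulr_ge0; first exact: sqr_ge0.
by apply: sumr_ge0 => j _; rewrite mulr_ge0 ?sqr_ge0 // ltW // v_gt0.
Qed.

Lemma round_total (W : nat -> int) SW : 0 <= SW ->
  (forall l, (l < N)%N -> W l * v l <= 2 * SW) ->
  \sum_(l < N) W l * \sum_(c < m) x c l ^+ 2 <= 2 * SW * S ^+ 2.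
Proof.
move=> SW0 HW; apply: le_trans (_ : 2 * SW * (cc ^+ 2 * nrm) <= _); last first.
  by rewrite ler_wpM2l // mulr_ge0.
rewrite /nrm exchange_big /= !mulr_sumr; apply: ler_sum => l _.
rewrite !mulr_sumr; apply: ler_sum => c _.
have -> : W l * x c l ^+ 2 = (W l * v l) * (cc ^+ 2 * (v l * g c l ^+ 2)).
  by rewrite /x; ring.
apply: ler_wpM2r; last exact: HW.
apply: mulr_ge0; first exact: sqr_ge0.
by apply: mulr_ge0; rewrite ?sqr_ge0 // ltW // v_gt0.
Qed.

End Round.

(** Up to rounding, [v] is 2 over [w / SW + 1 / N]. The uniform share keeps [v], hence the width of
    the updates, below [2 * N]; the other share keeps the weighted total bounded. [om] is an integer
    substitute for [2 * N / v]. *)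
Lemma round_weights (N w SW : nat) : (0 < N)%N -> (0 < w)%N -> (w <= SW)%N ->
  let v := ((2 * N * SW) %/ (N * w + SW))%N in let om := (1 + (N * w) %/ SW)%N in
  [/\ (0 < v)%N, (v <= 2 * N)%N, (N <= 2 * om * v)%N, (w * v <= 2 * SW)%N
    & (om * SW <= SW + N * w)%N].
Proof.
move=> N0 w0 wS v om.
have D0 : (0 < N * w + SW)%N by lia.
have S0 : (0 < SW)%N by lia.
have v1 : (v * (N * w + SW) <= 2 * N * SW)%N by rewrite leq_trunc_div.
have v2 : (2 * N * SW < v.+1 * (N * w + SW))%N by rewrite -ltn_divLR.
have o1 : (om * SW <= SW + N * w)%N.
  by rewrite /om mulnDl mul1n leq_add2l leq_trunc_div.
have o2 : (N * w < om * SW)%N by rewrite -ltn_divLR // /om add1n.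
have vp : (0 < v)%N by rewrite divn_gt0 //; nia.
split=> //.
- nia.
- have h : (N * SW <= v * (N * w + SW))%N.
    have : (v.+1 * (N * w + SW) <= 2 * v * (N * w + SW))%N by rewrite leq_mul2r; lia.
    by lia.
  have h2 : (N * w + SW <= 2 * om * SW)%N.
    by have : (SW <= om * SW)%N by [rewrite leq_pmull]; lia.
  rewrite -(leq_pmul2r S0); apply: leq_trans h _.
  have -> : (2 * om * v * SW = v * (2 * om * SW))%N by rewrite mulnC mulnCA mulnA mulnAC mulnC; lia.
  by rewrite leq_mul2l h2 orbT.
- nia.
Qed.

(** Clears denominators: [1 / v l] is replaced by the upper bound [2 * om l / N]. *)
Lemma round_dual_int m N (B : nat -> nat -> int) (z v om : nat -> int) (S qt : int) :
  0 <= qt -> (forall l, (l < N)%N -> 0 < v l) ->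
  (forall l, (l < N)%N -> N%:Z <= 2 * om l * v l) ->
  (qf m N B z)%:~R * (S ^+ 2)%:~R <= 8 * qt%:~R * \sum_(l < N) (z l ^+ 2)%:~R / (v l)%:~R :> rat ->
  qf m N B z * (N%:Z * S ^+ 2) <= 16 * \sum_(l < N) qt * om l * z l ^+ 2.
Proof.
move=> qt0 v0 ov H.
have q0 : (0 : rat) <= 8 * qt%:~R by rewrite mulr_ge0 // ler0z.
have le1 : N%:R * (\sum_(l < N) (z l ^+ 2)%:~R / (v l)%:~R) <=
    2 * (\sum_(l < N) om l * z l ^+ 2)%:~R :> rat.
  rewrite rmorph_sum /= !mulr_sumr; apply: ler_sum => l _.
  have vp : (0 : rat) < (v l)%:~R by rewrite ltr0z v0.
  rewrite mulrA ler_pdivrMr // [(om l * _)%:~R]rmorphM /=.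
  have := ov l (ltn_ord l); rewrite -(ler_int rat) !rmorphM /= => h.
  have := ler_wpM2r (_ : 0 <= (z l ^+ 2)%:~R) h; rewrite ler0z sqr_ge0 => /(_ isT).
  rewrite -[N%:Z%:~R]/(N%:R) !expr2 !rmorphM /=.
  by move: (v l)%:~R (om l)%:~R (z l)%:~R N%:R => a b c e; nra.
have := ler_wpM2l (ler0n rat N) H.
have := ler_wpM2l q0 le1 => h1 h2.
rewrite -(ler_int rat) !rmorphM /=.
have -> : \sum_(l < N) qt * om l * z l ^+ 2 = qt * \sum_(l < N) om l * z l ^+ 2.
  by rewrite mulr_sumr; apply: eq_bigr => l _; rewrite mulrA.
rewrite rmorphM /= -[N%:Z%:~R]/(N%:R).
move: h1 h2; set a := \sum_(l < N) _ / _; set b := (\sum_(l < N) om l * _)%:~R.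
have -> : (S ^+ 2)%:~R = S%:~R * S%:~R :> rat by rewrite expr2 rmorphM.
by lra.
Qed.

Lemma expR_half_le (R : realType) (u : R) : 0 <= u -> u <= 1 -> expR (u / 2) <= 1 + u.
Proof.
move=> u0 u1; have h : 1 - u / 2 <= expR (- (u / 2)) by rewrite expR_ge1Dx.
have p : 0 < expR (u / 2) by rewrite expR_gt0.
have e1 : expR (u / 2) * expR (- (u / 2)) = 1 by rewrite expRN divff // gt_eqF.
rewrite -(ler_pM2r (_ : 0 < 1 - u / 2)); last by lra.
apply: (@le_trans _ _ 1); last by nra.
by rewrite -[leRHS]e1 ler_pM2l.
Qed.

Local Close Scope ring_scope.

Local Open Scope ring_scope.

(** * Potential of the weights, choice of signs, truncation *)

(** The update factor is [Z * (1 + x / Z)], at least [Z * exp (x / (2 Z))] because [x <= Z]; the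
    weight thus records in its exponent the squares accumulated so far. *)
Lemma mw_potential_step (R : realType) (Z s x W : int) t :
  0 < Z -> 0 <= x -> x <= Z ->
  expR (s%:~R / (2 * Z%:~R)) * Z%:~R ^+ t <= W%:~R :> R ->
  expR ((s + x)%:~R / (2 * Z%:~R)) * Z%:~R ^+ t.+1 <= (W * (Z + x))%:~R :> R.
Proof.
move=> Z0 x0 xZ H.
have Zp : (0 : R) < Z%:~R by rewrite ltr0z.
have u0 : (0 : R) <= x%:~R / Z%:~R by rewrite divr_ge0 ?ler0z // ltW.
have u1 : x%:~R / Z%:~R <= 1 :> R by rewrite ler_pdivrMr // mul1r ler_int.
have E := expR_half_le u0 u1.
have -> : (s + x)%:~R / (2 * Z%:~R) = s%:~R / (2 * Z%:~R) + x%:~R / Z%:~R / 2 :> R.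
  by rewrite rmorphD /=; field; rewrite gt_eqF.
rewrite expRD exprSr rmorphM rmorphD /=.
have -> : Z%:~R + x%:~R = (1 + x%:~R / Z%:~R) * Z%:~R :> R by field; rewrite gt_eqF.
have -> (a b c e : R) : a * b * (c * e) = a * c * (b * e) by ring.
apply: ler_pM => //.
- by rewrite mulr_ge0 ?expR_ge0 // exprn_ge0 // ltW.
- by rewrite mulr_ge0 ?expR_ge0 // ltW.
by rewrite ler_wpM2r // ltW.
Qed.

(* (1 + 1/N)^(N^2) and N are both at most e^N. *)
Lemma mw_flat (R : realType) (N : nat) (Z s W SW : int) :
  (0 < N)%N -> 0 < Z -> W <= SW ->
  SW * N%:Z ^+ (N * N) <= N%:Z * (Z * (N%:Z + 1)) ^+ (N * N) ->
  expR (s%:~R / (2 * Z%:~R)) * Z%:~R ^+ (N * N) <= W%:~R :> R -> s <= 4 * N%:Z * Z.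
Proof.
move=> N0 Z0 WS H1 H2.
have Zp : (0 : R) < Z%:~R by rewrite ltr0z.
have Np : (0 : R) < N%:R by rewrite ltr0n.
have h : expR (s%:~R / (2 * Z%:~R)) * (Z%:~R * N%:R) ^+ (N * N) <=
    N%:R * (1 + N%:R^-1) ^+ (N * N) * (Z%:~R * N%:R) ^+ (N * N) :> R.
  have := H1; rewrite -(ler_int R) !rmorphM !rmorphXn !rmorphM rmorphD /= -!pmulrn => h1.
  apply: (@le_trans _ _ (SW%:~R * N%:R ^+ (N * N))).
    rewrite exprMn mulrA ler_wpM2r ?exprn_ge0 // ?ler0n //.
    by apply: le_trans H2 _; rewrite ler_int.
  apply: le_trans h1 _; rewrite -mulrA -exprMn le_eqVlt; apply/orP; left; apply/eqP.
  by congr (_ * _ ^+ _); field; rewrite gt_eqF.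
rewrite ler_pM2r ?exprn_gt0 ?mulr_gt0 // in h.
have e1 : N%:R <= expR N%:R :> R.
  by apply: le_trans (expR_ge1Dx _); rewrite lerDr.
have e2 : (1 + N%:R^-1) ^+ (N * N) <= expR N%:R :> R.
  rewrite [X in _ <= expR X](_ : _ = N%:R^-1 * (N * N)%:R); last first.
    by rewrite natrM mulKf // gt_eqF.
  rewrite expRM_natr; apply: lerXn2r; rewrite ?nnegrE ?expR_ge0 //; last exact: expR_ge1Dx.
  by rewrite addr_ge0 // invr_ge0 ler0n.
have {}h : expR (s%:~R / (2 * Z%:~R)) <= expR (N%:R + N%:R) :> R.
  apply: le_trans h _; rewrite expRD; apply: ler_pM => //.
  by rewrite exprn_ge0 // addr_ge0 // invr_ge0 ler0n.
rewrite ler_expR ler_pdivrMr ?mulr_gt0 // in h.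
rewrite -(ler_int R) !rmorphM /= -!pmulrn; apply: le_trans h _.
by rewrite le_eqVlt; apply/orP; left; apply/eqP; ring.
Qed.

Definition pairing m N (B : nat -> nat -> int) (y x : nat -> int) : int :=
  \sum_(c < m) (\sum_(l < N) B c l * y l) * (\sum_(l < N) B c l * x l).

Lemma qfD m N B (y x : nat -> int) (e : int) :
  qf m N B (fun l => y l + e * x l) =
  qf m N B y + 2 * e * pairing m N B y x + e ^+ 2 * qf m N B x.
Proof.
rewrite /qf /pairing !mulr_sumr -!big_split /=; apply: eq_bigr => c _.
have -> : \sum_(l < N) B c l * (y l + e * x l) =
    (\sum_(l < N) B c l * y l) + e * (\sum_(l < N) B c l * x l).
  by rewrite mulr_sumr -big_split /=; apply: eq_bigr => l _; ring.
ring.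
Qed.

(** The fourth moment of [y + g] for a centred Gaussian [g] of variance [F - s]: [F] is a budget of
    variance and [s] the part already spent. *)
Definition quartic N (F : int) (lam y s : nat -> int) : int :=
  \sum_(l < N) lam l * (y l ^+ 4 + 6 * y l ^+ 2 * (F - s l) + 3 * (F - s l) ^+ 2).

Definition drift m N B beta F (lam y s x : nat -> int) : int :=
  beta * pairing m N B y x - \sum_(l < N) lam l *
    (2 * y l ^+ 3 * x l + 2 * y l * x l ^+ 3 + 6 * y l * x l * (F - s l - x l ^+ 2)).

(* The odd powers of e contribute 2 e times the drift; the even part of the
   quartic decreases, as 6 y^2 (F - s) + 3 (F - s)^2 is the conditional
   expectation of the remaining terms up to - 2 x^4. *)
Lemma sign_step m N B beta F (lam y s x : nat -> int) (e : int) :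
  e ^+ 2 = 1 -> (forall l, (l < N)%N -> 0 <= lam l) ->
  0 <= e * drift m N B beta F lam y s x ->
  beta * qf m N B y - quartic N F lam y s + beta * qf m N B x <=
  beta * qf m N B (fun l => y l + e * x l)
  - quartic N F lam (fun l => y l + e * x l) (fun l => s l + x l ^+ 2).
Proof.
move=> e1 lam0 De.
have E : quartic N F lam (fun l => y l + e * x l) (fun l => s l + x l ^+ 2)
  = quartic N F lam y s - 2 * (\sum_(l < N) lam l * x l ^+ 4) + 2 * e * (\sum_(l < N) lam l *
    (2 * y l ^+ 3 * x l + 2 * y l * x l ^+ 3 + 6 * y l * x l * (F - s l - x l ^+ 2))).
  rewrite /quartic !mulr_sumr -sumrB -big_split /=; apply: eq_bigr => l _.
  have e3 : e ^+ 3 = e by rewrite exprS e1 mulr1.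
  have e4 : e ^+ 4 = 1 by rewrite exprS e3 -expr2.
  have -> : (y l + e * x l) ^+ 4 = y l ^+ 4 + 4 * e * y l ^+ 3 * x l
    + 6 * e ^+ 2 * y l ^+ 2 * x l ^+ 2 + 4 * e ^+ 3 * y l * x l ^+ 3 + e ^+ 4 * x l ^+ 4.
    by ring.
  have -> : (y l + e * x l) ^+ 2 = y l ^+ 2 + 2 * e * y l * x l + e ^+ 2 * x l ^+ 2 by ring.
  rewrite e4 e3 e1; ring.
have x4 : 0 <= \sum_(l < N) lam l * x l ^+ 4.
  by apply: sumr_ge0 => l _; rewrite mulr_ge0 ?lam0 // (exprM _ 2 2) sqr_ge0.
rewrite qfD e1 E; move: De x4; rewrite /drift.
set a := \sum_(l < N) _; set b := \sum_(l < N) _; lia.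
Qed.

(** The excess over the clamp satisfies [(|y| - M) * M <= y^2], so its square is controlled by a
    fourth power. The clamp is written with comparison bits, as the program evaluates it. *)
Lemma clamp_quartic (y M : int) : 0 <= M ->
  let t := y + (- M - y) * (y < - M)%R%:Z + (M - y) * (M < y)%R%:Z in
  `|t| <= M /\ (y - t) ^+ 2 * M ^+ 2 <= y ^+ 4.
Proof.
move=> M0 /=; case: ltP => h1; case: ltP => h2; rewrite ?mulr1 ?mulr0 ?addr0; split.
- lia.
- lia.
- lia.
- have h : 0 <= (- M - y) * M by apply: mulr_ge0; lia.
  have h3 : (- M - y) * M <= y * y.
    have -> : y * y = (- M - y) * M + (y + M) ^+ 2 + (- y) * M by ring.
    by rewrite -addrA lerDl addr_ge0 ?sqr_ge0 // mulr_ge0 //; lia.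
  have -> : (y - (y + (- M - y))) ^+ 2 * M ^+ 2 = ((- M - y) * M) ^+ 2 by ring.
  have -> : y ^+ 4 = (y * y) ^+ 2 by ring.
  by rewrite lerXn2r ?nnegrE // -expr2 sqr_ge0.
- lia.
- have h : 0 <= (y - M) * M by apply: mulr_ge0; lia.
  have h3 : (y - M) * M <= y * y.
    have -> : y * y = (y - M) * M + (y - M) ^+ 2 + y * M by ring.
    by rewrite -addrA lerDl addr_ge0 ?sqr_ge0 // mulr_ge0 //; lia.
  have -> : (y - (y + (M - y))) ^+ 2 * M ^+ 2 = ((y - M) * M) ^+ 2 by ring.
  have -> : y ^+ 4 = (y * y) ^+ 2 by ring.
  by rewrite lerXn2r ?nnegrE // -expr2 sqr_ge0.
- lia.
- by rewrite subrr expr0n mul0r (exprM _ 2 2) sqr_ge0.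
Qed.

(** The cut-off part [e = y - yt] is bounded pointwise by [y^2 / M], so [dual] bounds its form by
    the sum of [lam * y^4], which the potential already charges. *)
Lemma truncation m N (B : nat -> nat -> int) (lam y s yt : nat -> int) (S Q : int) :
  (0 < N)%N -> 0 < S ->
  (forall l, (l < N)%N -> 0 <= lam l) ->
  (forall l, (l < N)%N -> s l <= 8 * N%:Z ^+ 2 * S ^+ 2) ->
  \sum_(l < N) lam l <= 2 * N%:Z * Q ->
  (forall z : nat -> int, qf m N B z * (N%:Z ^+ 3 * S ^+ 2)
     <= 16 * \sum_(l < N) lam l * z l ^+ 2) ->
  (forall l, (l < N)%N -> (y l - yt l) ^+ 2 * (160 * S * N%:Z) ^+ 2 <= y l ^+ 4) ->
  let F := 8 * N%:Z ^+ 2 * S ^+ 2 in let beta := 12 * F ^+ 2 * N%:Z in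
  beta * Q - 3 * F ^+ 2 * (\sum_(l < N) lam l) <= beta * qf m N B y - quartic N F lam y s ->
  Q <= 4 * qf m N B yt.
Proof.
move=> N0 S0 lam0 sF lamQ dual ytP F beta H.
have Np : 0 < N%:Z by rewrite ltz_nat.
pose Y4 := \sum_(l < N) lam l * y l ^+ 4.
have q4 : Y4 <= quartic N F lam y s.
  apply: ler_sum => l _; apply: ler_wpM2l; first exact: lam0.
  have h : 0 <= F - s l by rewrite subr_ge0 sF.
  move: (F - s l) h => f h; rewrite -addrA lerDl; apply: addr_ge0.
    by rewrite mulr_ge0 // mulr_ge0 // sqr_ge0.
  by rewrite mulr_ge0 // sqr_ge0.
pose e l := y l - yt l.
have qe : 1600 * (N%:Z ^+ 5 * S ^+ 4) * qf m N B e <= Y4.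
  have h : (160 * S * N%:Z) ^+ 2 * (qf m N B e * (N%:Z ^+ 3 * S ^+ 2)) <= 16 * Y4.
    have h := ler_wpM2l (sqr_ge0 (160 * S * N%:Z)) (dual e).
    apply: le_trans h _; rewrite mulrCA ler_wpM2l // mulr_sumr; apply: ler_sum => l _.
    rewrite mulrCA ler_wpM2l ?lam0 //; by rewrite mulrC ytP.
  have -> : 1600 * (N%:Z ^+ 5 * S ^+ 4) * qf m N B e =
     100 * (16 * (N%:Z ^+ 5 * S ^+ 4) * qf m N B e) by ring.
  have E : (160 * S * N%:Z) ^+ 2 * (qf m N B e * (N%:Z ^+ 3 * S ^+ 2)) =
     1600 * (16 * (N%:Z ^+ 5 * S ^+ 4) * qf m N B e) by ring.
  by move: h; rewrite E; lia.
have qy : qf m N B y <= 2 * qf m N B yt + 2 * qf m N B e.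
  rewrite /qf !mulr_sumr -big_split /=; apply: ler_sum => c _.
  have -> : \sum_(l < N) B c l * y l =
      (\sum_(l < N) B c l * yt l) + (\sum_(l < N) B c l * e l).
    by rewrite -big_split /=; apply: eq_bigr => l _; rewrite /e; ring.
  move: (\sum_(l < N) B c l * yt l) (\sum_(l < N) B c l * e l) => a b.
  have -> : 2 * a ^+ 2 + 2 * b ^+ 2 = (a + b) ^+ 2 + (a - b) ^+ 2 by ring.
  by rewrite lerDl sqr_ge0.
pose G := N%:Z ^+ 5 * S ^+ 4.
have G0 : 0 < G by rewrite mulr_gt0 ?exprn_gt0.
(* The hypothesis becomes [384 G Q <= 768 G qf(y) - Y4]. Since [qf(y) <= 2 qf(yt) + 2 qf(e)] and
   [1536 < 1600], the term [Y4] pays for [e], and [1536 / 384 = 4] remains. *)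
have bE : beta = 768 * G by rewrite /beta /F /G; ring.
have FE : 3 * F ^+ 2 * (2 * N%:Z * Q) = 384 * G * Q by rewrite /F /G; ring.
have lq : 3 * F ^+ 2 * (\sum_(l < N) lam l) <= 384 * G * Q.
  by rewrite -FE ler_wpM2l // mulr_ge0 // sqr_ge0.
rewrite -(ler_pM2l G0); move: H; rewrite bE => H.
have gy := ler_wpM2l (ltW G0) qy.
have qe0 : 0 <= G * qf m N B e by rewrite mulr_ge0 ?qf_ge0 // ltW.
move: H lq q4 qe0 qe gy; rewrite -/G.
move: (3 * F ^+ 2 * _) (quartic _ _ _ _ _) Y4 (qf m N B y) (qf m N B yt) (qf m N B e).
by move: G {G0 bE FE} => G a b c f g h; lia.
Qed.

Local Close Scope ring_scope.

Local Open Scope ring_scope.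

(** * Gains of the three product distributions *)

Lemma sum_ord_mul (R : nmodType) n d (F : nat -> R) :
  \sum_(l < n * d) F l = \sum_(u < n) \sum_(i < d) F (u * d + i)%N.
Proof.
elim: n => [|n IH]; first by rewrite mul0n !big_ord0.
rewrite big_ord_recr /= -IH mulSnr -!(big_mkord xpredT F).
rewrite (big_cat_nat (n := (n * d)%N)) ?leq_addr //=; congr (_ + _).
rewrite -{1}[(n * d)%N]add0n big_addn addKn big_mkord.
by apply: eq_bigr => i _; rewrite addnC.
Qed.

Lemma expR_le1D (R : realType) (z : R) : `|z| <= 4^-1 -> expR (z - z ^+ 2) <= 1 + z.
Proof.
rewrite ler_norml => /andP[z1 z2].
pose a := z - z ^+ 2.
have e1 : expR a * expR (- a) = 1 by rewrite expRN divff // gt_eqF // expR_gt0.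
suff [b b0 [b1 b2]] : exists2 b, 0 < b & b <= expR (- a) /\ 1 <= (1 + z) * b.
  rewrite -(ler_pM2r b0); apply: le_trans b2.
  by rewrite -[leRHS]e1 ler_pM2l // expR_gt0.
case: (lerP 0 z) => z0.
  exists (1 - a); first by rewrite /a; nra.
  by split; [exact: expR_ge1Dx | rewrite /a; nra].
have a0 : 0 <= - a by rewrite /a; nra.
(* For negative [z] the linear bound [1 - a] fails, as [(1 + z) * (1 - a) = 1 + z^3]; squaring the
   bound at half the argument gains the missing second-order term. *)
exists ((1 + - a / 2) ^+ 2); first by rewrite exprn_gt0 //; lra.
split.
  have -> : - a = (- a / 2) * 2%:R by field.
  rewrite expRM_natr mulfK ?pnatr_eq0 //; apply: lerXn2r; rewrite ?nnegrE ?expR_ge0 //.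
    lra.
  exact: expR_ge1Dx.
have -> : - a = (- z) * (1 + (- z)) by rewrite /a; ring.
have w0 : 0 <= - z by lra.
have w1 : - z <= 4^-1 by lra.
have -> : 1 + z = 1 - (- z) by rewrite opprK.
move: (- z) w0 w1 => w w0 w1.
have -> : (1 - w) * (1 + w * (1 + w) / 2) ^+ 2 =
  1 + w ^+ 2 * ((1 + w) * (1 - w ^+ 2) / 4 - w) by field.
by rewrite lerDl mulr_ge0 ?sqr_ge0 //; nra.
Qed.

(** Since the squares sum to at most 1/4, each product is at least 3/4 of the exponential of plus or
    minus the sum [s]. One of these exponentials is [exp |s|], at least [1 + s^2 / 2], so the
    unknown sign of [s] does not matter for the two together. *)
Lemma prod_pm (R : realType) n (z : 'I_n -> R) :
  (forall u, `|z u| <= 4^-1) -> \sum_u z u ^+ 2 <= 4^-1 ->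
  (\sum_u z u) ^+ 2 / 4 <= \prod_u (1 + z u) + \prod_u (1 - z u).
Proof.
move=> zb zs; set s := \sum_u z u; set q := \sum_u z u ^+ 2 in zs.
have half (e : R) : e ^+ 2 = 1 -> `|e| = 1 ->
    3 / 4 * expR (e * s) <= \prod_u (1 + e * z u).
  move=> e2 en; apply: (@le_trans _ _ (\prod_u expR (e * z u - (e * z u) ^+ 2))).
    rewrite -expR_sum sumrB -mulr_sumr -/s.
    have -> : \sum_u (e * z u) ^+ 2 = q.
      by apply: eq_bigr => u _; rewrite exprMn e2 mul1r.
    rewrite expRD mulrC ler_wpM2l ?expR_ge0 //.
    by apply: le_trans (expR_ge1Dx _); lra.
  apply: ler_prod => u _; rewrite expR_ge0 /=; apply: expR_le1D.
  by rewrite normrM en mul1r.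
have h1 := half 1 (expr1n _ _) (normr1 _).
have h2 := half (-1) (etrans (sqrrN 1) (expr1n _ _)) (etrans (normrN 1) (normr1 _)).
have E1 : \prod_u (1 + 1 * z u) = \prod_u (1 + z u).
  by apply: eq_bigr => u _; rewrite mul1r.
have E2 : \prod_u (1 + -1 * z u) = \prod_u (1 - z u).
  by apply: eq_bigr => u _; rewrite mulN1r.
rewrite E1 mul1r in h1; rewrite E2 mulN1r in h2.
have h3 : 1 + s ^+ 2 / 2 <= expR s + expR (- s).
  have := expR_ge1Dxn 1 (normr_ge0 s); rewrite real_normK ?num_real //.
  have -> : (2`!%:R : R) = 2 by [].
  move=> h; apply: le_trans h _.
  case: (lerP 0 s) => hs.
    by rewrite (ger0_norm hs) lerDl expR_ge0.
  by rewrite (ltr0_norm hs) lerDr expR_ge0.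
have s2 := sqr_ge0 s; lra.
Qed.

Section Gain.
Variables (R : realType) (n d m K r : nat) (cl : nat -> nat -> nat) (yt lam : nat -> R).
Variables (S Q : R) (x : nat -> nat).
Hypothesis d2 : (2 <= d)%N.
Hypothesis n0 : (0 < n)%N.
Hypothesis K0 : (0 < K)%N.
Hypothesis r_ge : (K <= r ^ 2)%N.
Hypothesis r_le : (r ^ 2 <= 4 * K)%N.
Hypothesis cl_le : forall c u, (c < m)%N -> (u < n)%N -> (cl c u <= d)%N.
Hypothesis szK : forall c, (c < m)%N -> (\sum_(u < n) (cl c u != 0) <= K)%N.
Hypothesis S0 : 0 < S.
Hypothesis x_lt : forall u, (u < n)%N -> (x u < d)%N.
Let N := (n * d)%N.
Let Mt : R := 160 * S * N%:R.
Hypothesis ytM : forall l, (l < N)%N -> `|yt l| <= Mt.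
Hypothesis lam0 : forall l, (l < N)%N -> 0 <= lam l.
Hypothesis lamQ : \sum_(l < N) lam l <= 2 * N%:R * Q.

(** [cl c u] is 0 when clause [c] leaves [u] free and otherwise the required value plus one; the
    index [l] stands for the variable [l %/ d] with the value [l %% d]. *)
Definition Bf c l : R := d%:R * (cl c (l %/ d) == (l %% d).+1)%:R - (cl c (l %/ d) != 0)%:R.

Hypothesis dual : forall z : nat -> bool,
  (\sum_(c < m) (\sum_(l < N) Bf c l * (z l)%:R) ^+ 2) * (N%:R ^+ 3 * S ^+ 2)
  <= 16 * \sum_(l < N) lam l * (z l)%:R.
Hypothesis Q_le : Q <= 4 * \sum_(c < m) (\sum_(l < N) Bf c l * yt l) ^+ 2.

Let Dn : R := 8 * d%:R ^+ 2 * Mt * r%:R.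
(** Centred over the values of a variable, so adding a multiple of it to the uniform distribution
    preserves the total mass. *)
Definition yc l : R := d%:R * yt l - \sum_(i < d) yt (l %/ d * d + i)%N.
Definition lamu u : R := \sum_(i < d) lam (u * d + i)%N.
(** More than 15 times the average of [lam] over the values of the variable; by Markov at most
    [d / 15] values are heavy. *)
Definition heavy l : bool := 15 * lamu (l %/ d) < d%:R * lam l.
(** [Dn ^+ n] times the expected number of satisfied clauses when [u] takes the value [i] with
    probability [p (u * d + i) / Dn]. *)
Definition phi (p : nat -> R) : R :=
  \sum_(c < m) \prod_(u < n) (if cl c u == 0%N then Dn else p (u * d + (cl c u).-1)%N).
Definition sat c := [forall u : 'I_n, (cl c u == 0%N) || (cl c u == (x u).+1)].
Let O := [set c : 'I_m | sat c].

Let dp : (0 < d)%N. Proof. exact: ltnW. Qed.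
Let dR : (0 : R) < d%:R. Proof. by rewrite ltr0n. Qed.
Let N0 : (0 < N)%N. Proof. by rewrite muln_gt0 n0. Qed.
Let NR : (0 : R) < N%:R. Proof. by rewrite ltr0n. Qed.
Let KR : (0 : R) < K%:R. Proof. by rewrite ltr0n. Qed.
Let Mt0 : 0 < Mt. Proof. by rewrite /Mt !mulr_gt0. Qed.
Let r0 : (0 < r)%N. Proof. by move: r_ge; case: (r) => //; rewrite exp0n //; lia. Qed.
Let rR : (0 : R) < r%:R. Proof. by rewrite ltr0n. Qed.
Let Dn0 : 0 < Dn. Proof. by rewrite /Dn !mulr_gt0 // exprn_gt0. Qed.

Lemma divmod_lt u i : (i < d)%N -> ((u * d + i) %/ d = u)%N /\ ((u * d + i) %% d = i)%N.
Proof.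
move=> id; rewrite divnMDl //.
by rewrite modnMDl divn_small // modn_small // addn0.
Qed.

Lemma row_sum c (z : nat -> R) : (c < m)%N ->
  \sum_(l < N) Bf c l * z l = \sum_(u < n) (if cl c u == 0%N then 0 else
     d%:R * z (u * d + (cl c u).-1)%N - \sum_(i < d) z (u * d + i)%N).
Proof.
move=> cm; rewrite (sum_ord_mul n d (fun l => Bf c l * z l)); apply: eq_bigr => u _.
have := cl_le cm (ltn_ord u).
case: eqP => [c0 _|/eqP c0 cd].
  apply: big1 => i _; rewrite /Bf; have [-> ->] := divmod_lt u (ltn_ord i).
  by rewrite c0 /= mulr0 subr0 mul0r.
have cd' : ((cl c u).-1 < d)%N by move: c0 cd; clear; lia.
transitivity (\sum_(i < d) (d%:R * (i == Ordinal cd')%:R * z (u * d + i)%N - z (u * d + i)%N)).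
  apply: eq_bigr => i _; rewrite /Bf; have [-> ->] := divmod_lt u (ltn_ord i).
  rewrite c0 mulrBl mul1r -val_eqE /=; congr (_ * _%:R * _ - _).
  by move: c0; clear; lia.
rewrite sumrB; congr (_ - _); rewrite (bigD1 (Ordinal cd')) //= eqxx mulr1 big1 ?addr0 //.
by move=> i /negbTE ->; rewrite mulr0 mul0r.
Qed.

Lemma prod_inv c : (c < m)%N ->
  d%:R ^- K <= \prod_(u < n) (d%:R^-1 : R) ^+ (cl c u != 0%N).
Proof.
move=> cm; rewrite prodrXr -exprVn; apply: ler_wiXn2l; last exact: szK.
  by rewrite invr_ge0 ltW.
by rewrite invf_le1 // ler1n.
Qed.

Lemma yc_bound l : (l < N)%N -> `|yc l| <= 2 * d%:R * Mt.
Proof.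
move=> lN; have un : (l %/ d < n)%N by rewrite ltn_divLR.
rewrite /yc; apply: le_trans (ler_normB _ _) _.
have -> : 2 * d%:R * Mt = d%:R * Mt + d%:R * Mt by ring.
apply: lerD; first by rewrite normrM gtr0_norm // ler_pM2l // ytM.
apply: le_trans (ler_norm_sum _ _ _) _.
have -> : d%:R * Mt = \sum_(i < d) Mt by rewrite sumr_const card_ord mulr_natl.
apply: ler_sum => i _; apply: ytM; rewrite /N.
apply: leq_trans (_ : (l %/ d).+1 * d <= _)%N; first by rewrite mulSn addnC ltn_add2r.
by rewrite leq_mul2r un orbT.
Qed.

(** The choice [K <= r ^ 2] makes each relative perturbation at most [1 / (4 r)], so over a clause
    the squares sum to at most 1/4 and [prod_pm] applies. Conversely [r ^ 2 <= 4 * K] limits the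
    loss to a factor linear in [K]. *)
Lemma gain_flat :
  Dn ^+ n * d%:R ^- K * (\sum_(c < m) (\sum_(l < N) Bf c l * yt l) ^+ 2)
    / (1024 * K%:R * d%:R ^+ 2 * Mt ^+ 2)
  <= phi (fun l => 8 * d%:R * Mt * r%:R + yc l) + phi (fun l => 8 * d%:R * Mt * r%:R - yc l).
Proof.
rewrite /phi -big_split /= mulr_sumr mulr_suml; apply: ler_sum => c _.
pose D := 8 * d%:R * Mt * r%:R.
have D0 : 0 < D by rewrite /D !mulr_gt0.
pose z (u : 'I_n) := if cl c u == 0%N then 0 else yc (u * d + (cl c u).-1) / D.
have lt_l (u : 'I_n) : cl c u != 0%N -> (u * d + (cl c u).-1 < N)%N.
  move=> h; have := cl_le (ltn_ord c) (ltn_ord u) => h2.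
  apply: leq_trans (_ : u.+1 * d <= _)%N; first by move: h h2; rewrite mulSn; clear; lia.
  by rewrite leq_mul2r ltn_ord orbT.
have zb u : `|z u| <= (4 * r%:R)^-1.
  rewrite /z; case: eqP => [_|/eqP h]; first by rewrite normr0 invr_ge0 mulr_ge0 // ltW.
  rewrite normrM normfV (gtr0_norm D0) ler_pdivrMr //.
  apply: le_trans (yc_bound (lt_l u h)) _; rewrite /D le_eqVlt; apply/orP; left; apply/eqP.
  by field; rewrite gt_eqF.
have zb4 u : `|z u| <= 4^-1.
  apply: le_trans (zb u) _; rewrite lef_pV2 ?posrE ?mulr_gt0 // ler_peMr // ler1n.
  exact: r0.
have zs : \sum_u z u ^+ 2 <= 4^-1.
  apply: (@le_trans _ _ (\sum_(u < n) (cl c u != 0%N)%:R * (16 * K%:R)^-1)).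
    apply: ler_sum => u _; rewrite /z; case: eqP => [_|/eqP h].
      by rewrite expr0n mul0r.
    have := zb u; rewrite /z (negbTE h) mul1r -real_normK ?num_real // => zu.
    apply: (@le_trans _ _ ((4 * r%:R)^-1 ^+ 2)); first by rewrite lerXn2r ?nnegrE // invr_ge0 mulr_ge0 // ltW.
    rewrite exprVn lef_pV2 ?posrE ?exprn_gt0 ?mulr_gt0 // exprMn.
    have -> : (4 : R) ^+ 2 = 16 by ring.
    by rewrite ler_pM2l // -natrX ler_nat.
  rewrite -mulr_suml -natr_sum; have := szK (ltn_ord c); rewrite -(ler_nat R) => h.
  rewrite ler_pdivrMr ?mulr_gt0 //; apply: le_trans h _.
  have -> : 4^-1 * (16 * K%:R) = 4 * K%:R :> R by field.
  by rewrite ler_peMl ?ler1n // ltW.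
have P := prod_pm zb4 zs.
have zsum : \sum_u z u = (\sum_(l < N) Bf c l * yt l) / D.
  rewrite row_sum // mulr_suml; apply: eq_bigr => u _; rewrite /z.
  case: eqP => [_|/eqP h]; first by rewrite mul0r.
  rewrite /yc; have [|-> _] := @divmod_lt u (cl c u).-1; last by [].
  by have := cl_le (ltn_ord c) (ltn_ord u); move: h; clear; lia.
have wE (e : R) : \prod_(u < n) (if cl c u == 0%N then Dn else D + e * yc (u * d + (cl c u).-1))
   = Dn ^+ n * \prod_(u < n) (d%:R^-1 : R) ^+ (cl c u != 0%N) * \prod_u (1 + e * z u).
  have -> : Dn ^+ n = \prod_(u < n) Dn by rewrite prodr_const card_ord.
  rewrite -!big_split /=; apply: eq_bigr => u _; rewrite /z; case: eqP => [_|/eqP h].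
    by rewrite expr0 mulr0 addr0 !mulr1.
  by rewrite expr1 /Dn /D; field; rewrite !gt_eqF.
have -> : \prod_(u < n) (if cl c u == 0%N then Dn else D + yc (u * d + (cl c u).-1)) =
  Dn ^+ n * \prod_(u < n) (d%:R^-1 : R) ^+ (cl c u != 0%N) * \prod_u (1 + z u).
  transitivity (\prod_(u < n) (if cl c u == 0%N then Dn else D + 1 * yc (u * d + (cl c u).-1))).
    by apply: eq_bigr => u _; rewrite mul1r.
  by rewrite wE; congr (_ * _); apply: eq_bigr => u _; rewrite mul1r.
have -> : \prod_(u < n) (if cl c u == 0%N then Dn else D - yc (u * d + (cl c u).-1)) =
  Dn ^+ n * \prod_(u < n) (d%:R^-1 : R) ^+ (cl c u != 0%N) * \prod_u (1 - z u).
  transitivity (\prod_(u < n) (if cl c u == 0%N then Dn else D + -1 * yc (u * d + (cl c u).-1))).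
    by apply: eq_bigr => u _; rewrite mulN1r.
  by rewrite wE; congr (_ * _); apply: eq_bigr => u _; rewrite mulN1r.
rewrite -mulrDr zsum in P *.
set T := \sum_(l < N) _ in P *.
have Dnn : 0 <= Dn ^+ n by rewrite exprn_ge0 // ltW.
apply: (@le_trans _ _ (Dn ^+ n * d%:R ^- K * ((T / D) ^+ 2 / 4))).
  have -> : Dn ^+ n * d%:R ^- K * T ^+ 2 / (1024 * K%:R * d%:R ^+ 2 * Mt ^+ 2) =
    Dn ^+ n * d%:R ^- K * (T ^+ 2 / (1024 * K%:R * d%:R ^+ 2 * Mt ^+ 2)) by rewrite mulrA.
  apply: ler_wpM2l; first by rewrite mulr_ge0 // invr_ge0 exprn_ge0 // ltW.
  have -> : (T / D) ^+ 2 / 4 = T ^+ 2 / (D ^+ 2 * 4) by field; rewrite gt_eqF.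
  apply: ler_wpM2l; first exact: sqr_ge0.
  rewrite lef_pV2 ?posrE ?mulr_gt0 ?exprn_gt0 //.
  have -> : D ^+ 2 * 4 = 256 * (d%:R ^+ 2 * Mt ^+ 2) * r%:R ^+ 2 by rewrite /D; ring.
  have -> : 1024 * K%:R * d%:R ^+ 2 * Mt ^+ 2 = 256 * (d%:R ^+ 2 * Mt ^+ 2) * (4 * K%:R) by ring.
  have rl : r%:R ^+ 2 <= 4 * K%:R :> R by rewrite -natrX -natrM ler_nat.
  by apply: ler_wpM2l; rewrite // !mulr_ge0 ?exprn_ge0 // ltW.
apply: ler_pM => //.
- by rewrite mulr_ge0 // invr_ge0 exprn_ge0 // ltW.
- by rewrite mulr_ge0 ?sqr_ge0 ?invr_ge0.
by rewrite ler_wpM2l // prod_inv.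
Qed.

Definition sz c := (\sum_(u < n) (cl c u != 0%N))%N.
Definition nheavy c := (\sum_(u < n) ((cl c u != 0%N) && heavy (u * d + x u)))%N.
Definition nlight c := (\sum_(u < n) ((cl c u != 0%N) && ~~ heavy (u * d + x u)))%N.

Lemma sz_split c : (nheavy c + nlight c)%N = sz c.
Proof.
by rewrite /nheavy /nlight /sz -big_split /=; apply: eq_bigr => u _; case: eqP; case: heavy.
Qed.

Lemma sat_cl c (u : 'I_n) : sat c -> cl c u != 0%N -> (cl c u).-1 = x u.
Proof. by move=> /forallP/(_ u) /orP[/eqP ->|/eqP ->]. Qed.

Let zz l := (x (l %/ d) == (l %% d)%N) && ~~ heavy l.

Lemma zz_at u i : (i < d)%N -> zz (u * d + i) = (x u == i) && ~~ heavy (u * d + i).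
Proof. by move=> id; rewrite /zz; have [-> ->] := divmod_lt u id. Qed.

Lemma zz_row (u : 'I_n) (f : nat -> R) : \sum_(i < d) f i * (zz (u * d + i))%:R =
  f (x u) * (~~ heavy (u * d + x u))%:R.
Proof.
rewrite (bigD1 (Ordinal (x_lt (ltn_ord u)))) //= zz_at ?x_lt // eqxx big1 ?addr0 //.
move=> i; rewrite -val_eqE /= => ne; rewrite zz_at // eq_sym (negbTE ne) /= mulr0.
by [].
Qed.

Lemma light_row (c : 'I_m) : sat c ->
  \sum_(l < N) Bf c l * (zz l)%:R = (d%:R - 1) * (nlight c)%:R.
Proof.
move=> sc; rewrite (row_sum (fun l => (zz l)%:R)) // /nlight natr_sum mulr_sumr.
apply: eq_bigr => u _; case: eqP => [_|/eqP h]; first by rewrite mulr0.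
rewrite (sat_cl sc h) zz_at ?x_lt // eqxx /=.
have -> : \sum_(i < d) (zz (u * d + i))%:R = (~~ heavy (u * d + x u))%:R :> R.
  by rewrite -[RHS]mul1r -(zz_row u (fun=> 1)); apply: eq_bigr => i _; rewrite mul1r.
by rewrite /= mulrBl mul1r.
Qed.

(** This is [dual] at the indicator [zz] of the light pairs chosen by [x]. On a clause satisfied by
    [x] the form equals [d - 1] times the number of its light pairs, while lightness bounds each
    [lam] involved by [15 / d] of its row sum. *)
Lemma light_le : Q * (960 * 1024) <= K%:R ^+ 2 * d%:R ^+ 3 * N%:R ^+ 2 * S ^+ 2 * #|O|%:R ->
  \sum_(c in O) (nlight c)%:R ^+ 2 <= K%:R ^+ 2 * #|O|%:R / 512 :> R.
Proof.
move=> HQ; set L := \sum_(c in O) _.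
have h1 : (d%:R - 1) ^+ 2 * L <= \sum_(c < m) (\sum_(l < N) Bf c l * (zz l)%:R) ^+ 2.
  rewrite (bigID (mem O)) /= -[leLHS]addr0; apply: lerD; last first.
    by apply: sumr_ge0 => c _; rewrite sqr_ge0.
  rewrite /L mulr_sumr; apply: ler_sum => c; rewrite inE => sc.
  by rewrite light_row // exprMn.
have h2 : \sum_(l < N) lam l * (zz l)%:R <= 30 * N%:R * Q / d%:R.
  apply: (@le_trans _ _ (15 / d%:R * \sum_(l < N) lam l)); last first.
    have -> : 30 * N%:R * Q / d%:R = 15 / d%:R * (2 * N%:R * Q).
      by field; rewrite gt_eqF.
    by rewrite ler_wpM2l // divr_ge0 // ltW.
  rewrite (sum_ord_mul n d (fun l => lam l * (zz l)%:R)) (sum_ord_mul n d lam) mulr_sumr.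
  apply: ler_sum => u _; rewrite (zz_row u (fun i => lam (u * d + i)%N)).
  have l0 : 0 <= lamu u.
    apply: sumr_ge0 => i _; apply: lam0; apply: leq_trans (_ : u.+1 * d <= _)%N.
      by rewrite mulSn addnC ltn_add2r.
    by rewrite leq_mul2r ltn_ord orbT.
  rewrite -/(lamu u); case: (boolP (heavy _)) => hv; first by rewrite mulr0 mulr_ge0 // divr_ge0 // ltW.
  rewrite mulr1 mulrAC ler_pdivlMr // mulrC.
  by move: hv; rewrite /heavy; have [-> _] := divmod_lt u (x_lt (ltn_ord u)); rewrite -leNgt.
have d4 : d%:R ^+ 2 / 4 <= (d%:R - 1) ^+ 2 :> R.
  by have : (2 : R) <= d%:R; [rewrite ler_nat | nra].
have L0 : 0 <= L by apply: sumr_ge0 => c _; rewrite sqr_ge0.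
have NS : 0 < N%:R ^+ 3 * S ^+ 2 by rewrite mulr_gt0 ?exprn_gt0.
have h3 : d%:R ^+ 2 / 4 * L * (N%:R ^+ 3 * S ^+ 2) <= 16 * (30 * N%:R * Q / d%:R).
  apply: (@le_trans _ _ (16 * \sum_(l < N) lam l * (zz l)%:R)); last by rewrite ler_pM2l.
  apply: le_trans (dual zz); rewrite ler_pM2r //; apply: le_trans h1.
  by rewrite ler_wpM2r.
have P0 : 0 < d%:R ^+ 3 * N%:R ^+ 3 * S ^+ 2 by rewrite !mulr_gt0 ?exprn_gt0.
rewrite -(ler_pM2r P0).
apply: (@le_trans _ _ (1920 * N%:R * Q)).
  have d40 : 0 <= 4 * d%:R :> R by rewrite mulr_ge0 // ltW.
  have := ler_wpM2r d40 h3.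
  have -> : 16 * (30 * N%:R * Q / d%:R) * (4 * d%:R) = 1920 * N%:R * Q by field; rewrite gt_eqF.
  have -> : d%:R ^+ 2 / 4 * L * (N%:R ^+ 3 * S ^+ 2) * (4 * d%:R) =
    L * (d%:R ^+ 3 * N%:R ^+ 3 * S ^+ 2) by field.
  by [].
have := ler_wpM2r (ltW NR) HQ.
set A := (X in X * _ <= _ -> _); set C := (X in _ <= X -> _).
have -> : K%:R ^+ 2 * #|O|%:R / 512 * (d%:R ^+ 3 * N%:R ^+ 3 * S ^+ 2) = C / 512.
  by rewrite /C; field.
rewrite /A; move: C => C; lra.
Qed.

Lemma expR_le_exp2 j : (K <= 2 * j)%N -> expR (K%:R / 8) <= 2 ^+ j :> R.
Proof.
move=> Kj; apply: (@le_trans _ _ (expR (4^-1 * j%:R))).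
  by rewrite ler_expR; move: Kj; rewrite -(ler_nat R) natrM; lra.
rewrite expRM_natr; apply: lerXn2r; rewrite ?nnegrE ?expR_ge0 //.
have := @expR_half_le R (2^-1) _ _; have -> : 2^-1 / 2 = 4^-1 :> R by field.
by move=> /(_ _ _); lra.
Qed.

(** [Dn / (2 d)] for an ordinary value and 16 times that for a heavy one: half of the uniform mass
    everywhere, the other half paying for the boosts. *)
Definition p2 l : R := (1 + 15 * (heavy l)%:R) * (4 * d%:R * Mt * r%:R).

Lemma p2_ge0 l : 0 <= p2 l.
Proof. by rewrite /p2 mulr_ge0 ?addr_ge0 ?mulr_ge0 // ?ler0n // ltW. Qed.

Lemma phi2_clause (c : 'I_m) : sat c ->
  \prod_(u < n) (if cl c u == 0%N then Dn else p2 (u * d + (cl c u).-1)) =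
  Dn ^+ n * (d%:R^-1 ^+ sz c * (2^-1 ^+ sz c * 16 ^+ nheavy c)).
Proof.
move=> sc; have -> : Dn ^+ n = \prod_(u < n) Dn by rewrite prodr_const card_ord.
rewrite /sz /nheavy -!prodrXr -!big_split /=; apply: eq_bigr => u _.
case: eqP => [_|/eqP h]; first by rewrite !expr0 !mulr1.
rewrite (sat_cl sc h) /p2 /Dn; case: (heavy _); rewrite /= ?expr1 ?expr0 ?mulr1 ?mulr0; field; by rewrite gt_eqF.
Qed.

(** A clause much shorter than [K] wins the factor [d ^ (K - sz)], at least [2 ^ (K - sz)]. A mostly
    heavy one wins 16 on at least three quarters of its pairs, which outweighs the halving on all of
    them. Both reach [2 ^ (K / 2)]. *)
Lemma good_clause (c : 'I_m) : sat c -> (4 * sz c <= K)%N || (4 * nlight c <= sz c)%N ->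
  d%:R ^- K * expR (K%:R / 8) <= d%:R^-1 ^+ sz c * (2^-1 ^+ sz c * 16 ^+ nheavy c) :> R.
Proof.
move=> sc good; have szc : (sz c <= K)%N := szK (ltn_ord c).
have := sz_split c => ss.
pose j := uphalf K.
have Kj : (K <= 2 * j)%N by rewrite /j; clear; lia.
apply: le_trans (ler_wpM2l _ (expR_le_exp2 Kj)) _; first by rewrite invr_ge0 exprn_ge0 // ltW.
have E : d%:R ^- K = d%:R ^- sz c * d%:R ^- (K - sz c) :> R.
  by rewrite -invfM -exprD subnKC.
rewrite !exprVn E -mulrA; apply: ler_wpM2l; first by rewrite invr_ge0 exprn_ge0 // ltW.
rewrite ler_pdivrMl ?exprn_gt0 //.
apply: (@le_trans _ _ (2 ^+ (K - sz c) * (2 ^- sz c * 16 ^+ nheavy c))); last first.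
  apply: ler_wpM2r; first by rewrite mulr_ge0 ?invr_ge0 ?exprn_ge0.
  by apply: lerXn2r; rewrite ?nnegrE // ler_nat.
rewrite mulrCA ler_pdivlMl ?exprn_gt0 //.
have -> : (16 : R) = 2 ^+ 4 by ring.
rewrite -exprM -!exprD; apply: ler_weXn2l; first by rewrite ler1n.
by move: good ss szc; rewrite /j; clear; lia.
Qed.

Lemma gain_heavy : Q * (960 * 1024) <= K%:R ^+ 2 * d%:R ^+ 3 * N%:R ^+ 2 * S ^+ 2 * #|O|%:R ->
  Dn ^+ n * (d%:R ^- K * expR (K%:R / 8)) * (#|O|%:R / 2) <= phi p2.
Proof.
move=> HQ; have LL := light_le HQ.
pose good (c : 'I_m) := (4 * sz c <= K)%N || (4 * nlight c <= sz c)%N.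
pose bad := [set c in O | ~~ good c].
(* A bad clause has [16 * nlight > K], so by the second-moment bound of [light_le] at most half of
   the clauses in [O] are bad. *)
have bad_le : #|bad|%:R <= #|O|%:R / 2 :> R.
  have h : #|bad|%:R * K%:R ^+ 2 <= 256 * \sum_(c in O) (nlight c)%:R ^+ 2 :> R.
    have sb : bad \subset O by apply/subsetP => c; rewrite inE => /andP[].
    rewrite mulr_sumr (big_setID bad) /= (setIidPr sb) -[leLHS]addr0; apply: lerD; last first.
      by apply: sumr_ge0 => c _; rewrite mulr_ge0 ?sqr_ge0.
    rewrite mulr_natl -sumr_const; apply: ler_sum => c; rewrite inE => /andP[_ ng].
    have -> : 256 * (nlight c)%:R ^+ 2 = (16 * (nlight c)%:R) ^+ 2 :> R by ring.
    apply: lerXn2r; rewrite ?nnegrE ?mulr_ge0 ?ler0n // -natrM ler_nat.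
    by move: ng; rewrite /good negb_or; clear; lia.
  have K2 : 0 < K%:R ^+ 2 :> R by rewrite exprn_gt0.
  rewrite -(ler_pM2r K2); apply: le_trans h _.
  have := ler_wpM2l (_ : (0 : R) <= 256) LL; rewrite ler0n => /(_ isT) h; apply: le_trans h _.
  by rewrite le_eqVlt; apply/orP; left; apply/eqP; field.
set X := Dn ^+ n * _.
have X0 : 0 <= X.
  by rewrite !mulr_ge0 ?exprn_ge0 ?invr_ge0 ?exprn_ge0 ?expR_ge0 // ltW.
have cO : #|O|%:R = #|bad|%:R + #|O :\: bad|%:R :> R.
  rewrite -natrD; congr _%:R; rewrite -(cardsID bad O); congr (_ + _)%N.
  by apply: eq_card => c; rewrite !inE; case: (sat c).
apply: (@le_trans _ _ (X * #|O :\: bad|%:R)); first by rewrite ler_wpM2l //; lra.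
rewrite mulr_natr -sumr_const -[leLHS]addr0 /phi [leRHS](bigID (mem (O :\: bad))) /=; apply: lerD.
  apply: ler_sum => c; rewrite !inE => /andP[]; case: (boolP (sat c)) => //= sc + _.
  rewrite negbK => gc; rewrite phi2_clause //; apply: ler_wpM2l; first by rewrite exprn_ge0 // ltW.
  exact: good_clause.
apply: sumr_ge0 => c _; apply: prodr_ge0 => u _.
by case: eqP => _; [rewrite ltW | rewrite p2_ge0].
Qed.

(** The threshold on [Q] is the hypothesis of [light_le]. Above it, the two signed distributions
    together gain at least [K * d] over [4 * 960 * 1024 * 1024 * 160 ^ 2], about [10 ^ 14]; half of
    this is still above the constant [10 ^- 15]. *)
Lemma gain : exists j : nat, (j < 3)%N /\
  10 ^- 15 * (Num.min (K * d)%:R (expR (K%:R / 8)) * #|O|%:R) * (Dn ^+ n * d%:R ^- K)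
  <= phi (fun l => if j == 0%N then 8 * d%:R * Mt * r%:R + yc l
                   else if j == 1%N then 8 * d%:R * Mt * r%:R - yc l else p2 l).
Proof.
have X0 : 0 <= Dn ^+ n * d%:R ^- K by rewrite mulr_ge0 ?invr_ge0 ?exprn_ge0 // ltW.
have o0 : 0 <= #|O|%:R :> R by rewrite ler0n.
case: (lerP (Q * (960 * 1024)) (K%:R ^+ 2 * d%:R ^+ 3 * N%:R ^+ 2 * S ^+ 2 * #|O|%:R)) => HQ.
  exists 2%N; split=> //=; apply: le_trans (gain_heavy HQ).
  have -> : Dn ^+ n * (d%:R ^- K * expR (K%:R / 8)) * (#|O|%:R / 2) =
    2^-1 * (expR (K%:R / 8) * #|O|%:R) * (Dn ^+ n * d%:R ^- K) by ring.
  apply: ler_wpM2r => //; apply: ler_pM; rewrite ?invr_ge0 ?exprn_ge0 ?mulr_ge0 ?le_min ?ler0n ?expR_ge0 //.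
    by rewrite lef_pV2 ?posrE ?exprn_gt0 // -natrX ler_nat.
  by rewrite ler_wpM2r // ge_min lexx orbT.
have F := gain_flat.
set q := \sum_(c < m) _ in F.
have H : 2 * (10 ^- 15 * (Num.min (K * d)%:R (expR (K%:R / 8)) * #|O|%:R) * (Dn ^+ n * d%:R ^- K))
   <= phi (fun l => 8 * d%:R * Mt * r%:R + yc l) + phi (fun l => 8 * d%:R * Mt * r%:R - yc l).
  apply: le_trans F.
  have -> : Dn ^+ n * d%:R ^- K * q / (1024 * K%:R * d%:R ^+ 2 * Mt ^+ 2) =
    q / (1024 * K%:R * d%:R ^+ 2 * Mt ^+ 2) * (Dn ^+ n * d%:R ^- K) by ring.
  rewrite mulrA; apply: ler_wpM2r => //.
  have P0 : 0 < 1024 * K%:R * d%:R ^+ 2 * Mt ^+ 2 by rewrite !mulr_gt0 ?exprn_gt0.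
  rewrite ler_pdivlMr //.
  apply: (@le_trans _ _ (2 * (10 ^- 15 * (K%:R * d%:R * #|O|%:R)) * (1024 * K%:R * d%:R ^+ 2 * Mt ^+ 2))).
    apply: ler_wpM2r; first exact: ltW.
    do 2!(apply: ler_wpM2l; first by rewrite ?invr_ge0 ?exprn_ge0).
    by apply: ler_wpM2r => //; rewrite ge_min natrM lexx.
  have q4 : Q / 4 <= q by rewrite ler_pdivrMr // mulrC.
  apply: le_trans q4; rewrite /Mt.
  set Y := K%:R ^+ 2 * d%:R ^+ 3 * N%:R ^+ 2 * S ^+ 2 * #|O|%:R in HQ.
  have -> : 2 * (10 ^- 15 * (K%:R * d%:R * #|O|%:R)) * (1024 * K%:R * d%:R ^+ 2 * (160 * S * N%:R) ^+ 2)
    = 50 * 1024 * 1024 * 10 ^- 15 * Y by rewrite /Y; ring.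
  have Y0 : 0 <= Y by rewrite /Y !mulr_ge0 ?exprn_ge0 ?ler0n // ltW.
  have e0 : 0 <= 10 ^- 15 :> R by rewrite invr_ge0 exprn_ge0.
  have e1 : 10 ^- 15 * 10 ^+ 15 = 1 :> R by rewrite mulVf // expf_neq0 // pnatr_eq0.
  move: (10 ^- 15) e0 e1 HQ => e e0 e1; move: Y Y0 => Y Y0 HQ.
  have c15 : e * (50 * 1024 * 1024) * (4 * 960 * 1024) <= 1 by lra.
  have := ler_wpM2r Y0 c15; lra.
set a := 10 ^- 15 * _ * _ in H *.
set p := phi _ in H; set p' := phi (fun l => _ - _) in H.
case: (lerP a p) => hp; first by exists 0%N.
by exists 1%N; split=> //=; rewrite -/p'; lra.
Qed.

End Gain.

Local Close Scope ring_scope.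

(** * The program in the source language *)

Notation "a +^ b" := (EB BAdd a b) (at level 50, left associativity).
Notation "a -^ b" := (EB BSub a b) (at level 50, left associativity).
Notation "a *^ b" := (EB BMul a b) (at level 40, left associativity).
Notation "a /^ b" := (EB BDiv a b) (at level 40, left associativity).
Notation "a <^ b" := (EB BLt a b) (at level 60).
Notation "s1 ;; s2" := (SSeq s1 s2) (at level 90, right associativity).
Notation esum := (EBig false).
Notation eprod := (EBig true).

Definition eeq a b := EC 1 -^ (a <^ b) -^ (b <^ a).
Definition sq e := e *^ e.
Definition ek := EI (EC 0).
Definition ed := EI (EC 1).
Definition en := EI (EC 2).
Definition em := EI (EC 3).
Definition eN := en *^ ed.
Fixpoint epow e k := if k is k'.+1 then epow e k' *^ e else EC 1.
(** The number of bits of the scale [S]. The exponent 13 is the level at which [nrm] is bounded, so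
    that [nrm <= S] and the search for [cc] can start at 1. *)
Definition eE := epow (en +^ em +^ EC 2) 13.
(** With [T] rounds the potential bounds the accumulated squares of a coordinate by
    [2 Z (log N + T / N)]; at [T = N ^ 2] the second term dominates. *)
Definition eT := eN *^ eN.
Definition eJ := eT *^ em.

(** Arrays: 0 the clauses, 1 the forms, 2 the weights, 3 [v], 4 the Gram matrix, 5 its power, 6 a
    buffer, 7 [g], 8 the vectors of all rounds, 9 [lam], 10 the signed sum [y], 11 the squares
    spent, 12 the truncated [y], 13 the three distributions, 14 the one being rounded, 15 the
    output. Arrays 16 to 25 hold scalars in cell 0. *)
Definition clx c u := EG 0 (c *^ en +^ u).
Definition Bx c l := EG 1 (c *^ eN +^ l).
Definition SW := EG 16 (EC 0).
Definition nrmx := EG 17 (EC 0).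
Definition ccx := EG 18 (EC 0).
Definition Sx := EG 19 (EC 0).
Definition qtx := EG 20 (EC 0).
Definition sgx := EG 21 (EC 0).
Definition rx := EG 22 (EC 0).
Definition jbx := EG 23 (EC 0).
Definition posx := EG 24 (EC 0).
Definition szx := EG 25 (EC 0).

Definition s_parse :=
  SSet 24 (EC 0) (EC 4) ;;
  SFor 1 em (
    SSet 25 (EC 0) (EI posx) ;;
    SFor 5 szx (SSet 0 (EV 1 *^ en +^ EI (posx +^ EC 1 +^ EC 2 *^ EV 5))
                       (EI (posx +^ EC 2 +^ EC 2 *^ EV 5) +^ EC 1)) ;;
    SSet 24 (EC 0) (posx +^ EC 1 +^ EC 2 *^ szx)).

Definition s_default := SFor 2 en (SSet 15 (EV 2) (EG 0 (EV 2) -^ (EC 0 <^ EG 0 (EV 2)))).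

Definition s_B :=
  SFor 1 em (SFor 2 eN (SSet 1 (EV 1 *^ eN +^ EV 2)
    (ed *^ eeq (clx (EV 1) (EV 2 /^ ed)) (EV 2 -^ ed *^ (EV 2 /^ ed) +^ EC 1)
     -^ (EC 0 <^ clx (EV 1) (EV 2 /^ ed))))).

Definition s_S := SSet 19 (EC 0) (EC 1) ;; SFor 6 eE (SSet 19 (EC 0) (EC 2 *^ Sx)).
Definition s_W0 := SFor 2 eN (SSet 2 (EV 2) (EC 1)).

Definition r1 := SSet 16 (EC 0) (esum 3 eN (EG 2 (EV 3))).
Definition r2 := SFor 2 eN (SSet 3 (EV 2) ((EC 2 *^ eN *^ SW) /^ (eN *^ EG 2 (EV 2) +^ SW))).
Definition r3 := SFor 1 em (SFor 7 em (SSet 4 (EV 1 *^ em +^ EV 7)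
  (esum 3 eN (EG 3 (EV 3) *^ Bx (EV 1) (EV 3) *^ Bx (EV 7) (EV 3))))).
Definition r4 := SFor 1 em (SFor 7 em (SSet 5 (EV 1 *^ em +^ EV 7) (eeq (EV 1) (EV 7)))).
Definition r5a := SFor 1 em (SFor 7 em (SSet 6 (EV 1 *^ em +^ EV 7)
  (esum 4 em (EG 4 (EV 1 *^ em +^ EV 4) *^ EG 5 (EV 4 *^ em +^ EV 7))))).
Definition r5b := SFor 1 em (SFor 7 em (SSet 5 (EV 1 *^ em +^ EV 7) (EG 6 (EV 1 *^ em +^ EV 7)))).
Definition r5 := SFor 5 em (r5a ;; r5b).
Definition r6 := SFor 1 em (SFor 2 eN (SSet 7 (EV 1 *^ eN +^ EV 2)
  (esum 4 em (Bx (EV 4) (EV 2) *^ EG 5 (EV 4 *^ em +^ EV 1))))).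
Definition r7 := SSet 17 (EC 0) (esum 1 em (esum 2 eN
  (EG 3 (EV 2) *^ sq (EG 7 (EV 1 *^ eN +^ EV 2))))).
Definition r8 := SSet 18 (EC 0) (EC 1) ;; SFor 6 eE (SSet 18 (EC 0)
  (ccx +^ ccx *^ (EC 1 -^ (Sx *^ Sx <^ EC 4 *^ (ccx *^ ccx *^ nrmx))))).
Definition r9 := SFor 1 em (SFor 2 eN (SSet 8 ((EV 0 *^ em +^ EV 1) *^ eN +^ EV 2)
  (ccx *^ EG 3 (EV 2) *^ EG 7 (EV 1 *^ eN +^ EV 2)))).
Definition Xx := EG 8 ((EV 0 *^ em +^ EV 1) *^ eN +^ EV 2).
Definition r10 := SSet 20 (EC 0) (esum 1 em (esum 7 em (sq (esum 2 eN (Bx (EV 7) (EV 2) *^ Xx))))).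
Definition r11 := SFor 2 eN (SSet 9 (EV 2)
  (EG 9 (EV 2) +^ qtx *^ (EC 1 +^ (eN *^ EG 2 (EV 2)) /^ SW))).
Definition r12 := SFor 2 eN (SSet 2 (EV 2)
  (EG 2 (EV 2) *^ (EC 2 *^ eN *^ (Sx *^ Sx) +^ esum 1 em (sq Xx)))).
Definition s_round := r1 ;; r2 ;; r3 ;; r4 ;; r5 ;; r6 ;; r7 ;; r8 ;; r9 ;; r10 ;; r11 ;; r12.
Definition s_MW := SFor 0 eT s_round.

Definition yx := EG 10 (EV 2).
Definition xx := EG 8 (EV 0 *^ eN +^ EV 2).
Definition Fx := EC 8 *^ sq eN *^ sq Sx.
Definition betax := EC 12 *^ sq Fx *^ eN.
Definition driftx :=
  betax *^ esum 1 em (esum 2 eN (Bx (EV 1) (EV 2) *^ yx) *^ esum 2 eN (Bx (EV 1) (EV 2) *^ xx))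
  -^ esum 2 eN (EG 9 (EV 2) *^ (EC 2 *^ (yx *^ yx *^ yx) *^ xx +^ EC 2 *^ yx *^ (xx *^ xx *^ xx)
       +^ EC 6 *^ yx *^ xx *^ (Fx -^ EG 11 (EV 2) -^ xx *^ xx))).
Definition g1 := SSet 21 (EC 0) (EC 1 -^ EC 2 *^ (driftx <^ EC 0)).
Definition g2 := SFor 2 eN (SSet 10 (EV 2) (yx +^ sgx *^ xx)).
Definition g3 := SFor 2 eN (SSet 11 (EV 2) (EG 11 (EV 2) +^ xx *^ xx)).
Definition s_sign := SFor 0 eJ (g1 ;; g2 ;; g3).

Definition Mtx := EC 160 *^ Sx *^ eN.
Definition s_yt := SFor 2 eN (SSet 12 (EV 2)
  (yx +^ (EC 0 -^ Mtx -^ yx) *^ (yx <^ EC 0 -^ Mtx) +^ (Mtx -^ yx) *^ (Mtx <^ yx))).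
Definition Kx := ek +^ (en -^ ek) *^ (en <^ ek).
Definition s_r := SSet 22 (EC 0) (EC 1) ;; SFor 6 en (SSet 22 (EC 0) (rx +^ (rx *^ rx <^ Kx))).
Definition Dx := EC 8 *^ ed *^ Mtx *^ rx.
Definition Dnx := ed *^ Dx.
Definition rowx t := esum 3 ed (EG t ((EV 2 /^ ed) *^ ed +^ EV 3)).
Definition ycx := ed *^ EG 12 (EV 2) -^ rowx 12.
Definition s_w0 := SFor 2 eN (SSet 13 (EV 2) (Dx +^ ycx)).
Definition s_w1 := SFor 2 eN (SSet 13 (eN +^ EV 2) (Dx -^ ycx)).
Definition s_w2 := SFor 2 eN (SSet 13 (eN +^ eN +^ EV 2)
  ((EC 1 +^ EC 15 *^ (EC 15 *^ rowx 9 <^ ed *^ EG 9 (EV 2))) *^ (EC 4 *^ ed *^ Mtx *^ rx))).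
Definition c14 := clx (EV 1) (EV 4).
Definition phix j := esum 1 em (eprod 4 en (eeq c14 (EC 0) *^ Dnx +^
  (EC 1 -^ eeq c14 (EC 0)) *^ EG 13 (j *^ eN +^ (EV 4 *^ ed +^ (c14 -^ EC 1))))).
Definition s_jb := SSet 23 (EC 0) (EC 0) ;;
  SFor 5 (EC 3) (SSet 23 (EC 0) (jbx +^ (EV 5 -^ jbx) *^ (phix jbx <^ phix (EV 5)))).
Definition s_P := SFor 2 eN (SSet 14 (EV 2) (EG 13 (jbx *^ eN +^ EV 2))).
(** The expectation after replacing the row of variable [EV 0] in array 14 by a point mass at [e],
    evaluated without writing. *)
Definition gx e := esum 1 em (eprod 4 en (eeq c14 (EC 0) *^ Dnx +^
  (EC 1 -^ eeq c14 (EC 0)) *^ (eeq (EV 4) (EV 0) *^ (Dnx *^ eeq c14 (e +^ EC 1)) +^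
     (EC 1 -^ eeq (EV 4) (EV 0)) *^ EG 14 (EV 4 *^ ed +^ (c14 -^ EC 1))))).
Definition outx := EG 15 (EV 0).
Definition h1 := SSet 15 (EV 0) (EC 0).
Definition h2 := SFor 5 ed (SSet 15 (EV 0) (outx +^ (EV 5 -^ outx) *^ (gx outx <^ gx (EV 5)))).
Definition h3 := SFor 5 ed (SSet 14 (EV 0 *^ ed +^ EV 5) (Dnx *^ eeq (EV 5) outx)).
Definition s_greedy := SFor 0 en (h1 ;; h2 ;; h3).

Definition s_main := s_B ;; s_S ;; s_W0 ;; s_MW ;; s_sign ;; s_yt ;; s_r ;;
  s_w0 ;; s_w1 ;; s_w2 ;; s_jb ;; s_P ;; s_greedy.
(** The last loop is a conditional, its bound being the comparison bit; otherwise the default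
    assignment remains in array 15. *)
Definition program := s_parse ;; s_default ;; SFor 8 (ed <^ em) s_main.

(** * Reasoning principles for source programs *)

Fixpoint writes (c : st) : seq nat :=
  match c with
  | SSet t _ _ => [:: t]
  | SSeq c1 c2 => writes c1 ++ writes c2
  | SFor _ _ c1 => writes c1
  end.

Lemma sem_frame p V A c t : t \notin writes c -> sem p V A c t = A t.
Proof.
elim: c V A => [t' e1 e2|c1 IH1 c2 IH2|x b c IH] V A /=.
- by rewrite inE => /negbTE tt; apply/funext => j; rewrite /upd2 tt.
- by rewrite mem_cat negb_or => /andP[h1 h2]; rewrite IH2 // IH1.
- by move=> h; elim: (minn _ _) => //= i; rewrite IH.
Qed.

Lemma sem_for p V A x b c k : ev p V A b = Posz k -> k <= nu p ->
  sem p V A (SFor x b c) = iteri k (fun i A' => sem p (upd V x i) A' c) A.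
Proof. by move=> /= -> /minn_idPl /= ->. Qed.

Lemma ev_esum p V A x b e k : ev p V A b = Posz k -> k <= nu p ->
  ev p V A (esum x b e) = (\sum_(i < k) ev p (upd V x i) A e)%R.
Proof. by move=> /= -> /minn_idPl /= ->. Qed.

Lemma ev_eprod p V A x b e k : ev p V A b = Posz k -> k <= nu p ->
  ev p V A (eprod x b e) = (\prod_(i < k) ev p (upd V x i) A e)%R.
Proof. by move=> /= -> /minn_idPl /= ->. Qed.

Lemma ev_eeq p V A a b : ev p V A (eeq a b) = Posz (ev p V A a == ev p V A b).
Proof. by rewrite /=; case: ltgtP. Qed.

Lemma clip_id c z : absz z <= c -> clip c z = z.
Proof. by rewrite /clip => ->. Qed.

(* [A'] is [A] with the entries [idx i], i < k, of array [t] set to [F i]. *)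
Definition filled (A A' : nat -> nat -> int) t k (idx : nat -> nat) (F : nat -> int) :=
  [/\ forall t', t' <> t -> A' t' = A t', forall i, i < k -> A' t (idx i) = F i
    & forall j, (forall i, i < k -> j <> idx i) -> A' t j = A t j].

Lemma sem_fill p V A x b t e1 e2 k idx F : ev p V A b = Posz k -> k <= nu p ->
  (forall i j, i < k -> j < k -> idx i = idx j -> i = j) ->
  (forall i A', i < k -> filled A A' t i idx F ->
     [/\ absz (ev p (upd V x i) A' e1) = idx i, ev p (upd V x i) A' e2 = F i
       & absz (F i) <= cap p]) ->
  filled A (sem p V A (SFor x b (SSet t e1 e2))) t k idx F.
Proof.
move=> bk knu inj H; rewrite (sem_for _ _ bk knu).
suff: forall i, i <= k -> filled A (iteri i (fun i A' => sem p (upd V x i) A' (SSet t e1 e2)) A) t i idx F.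
  exact.
elim=> [_|i IH ik] //.
rewrite [iteri _ _ _]/=; set A' := iteri _ _ _ in IH *.
have [f1 f2 f3] := IH (ltnW ik).
have [h1 h2 h3] := H i A' ik (IH (ltnW ik)).
rewrite h1 h2 clip_id //; split.
- by move=> t' tt; rewrite -f1 //; apply/funext => j; rewrite /upd2; case: eqP.
- move=> i'; rewrite ltnS leq_eqVlt => /orP[/eqP ->|lt]; rewrite /upd2 eqxx /= ?eqxx //.
  case: eqP => [e|_]; last exact: f2.
  by have := inj _ _ (ltn_trans lt ik) ik e; lia.
- move=> j hj; rewrite /upd2 eqxx /=; case: eqP => [e|_]; first by case: (hj i).
  by apply: f3 => i' lt; apply: hj; apply: ltnW.
Qed.

Lemma sem_fill_id p V A x b t e2 k F : ev p V A b = Posz k -> k <= nu p ->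
  (forall i A', i < k -> (forall t', t' <> t -> A' t' = A t') -> A' t i = A t i ->
     ev p (upd V x i) A' e2 = F i /\ absz (F i) <= cap p) ->
  filled A (sem p V A (SFor x b (SSet t (EV x) e2))) t k id F.
Proof.
move=> bk knu H; apply: sem_fill => // i A' ik [f1 f2 f3].
have [|h1 h2] := H i A' ik f1; first by apply: f3 => j lt; lia.
by split=> //=; rewrite /upd eqxx.
Qed.

Lemma flat_inj N c l c' l' : l < N -> l' < N -> c * N + l = c' * N + l' -> c = c' /\ l = l'.
Proof.
move=> h h' e; have N0 : 0 < N by lia.
have := congr1 (divn^~ N) e; have := congr1 (modn^~ N) e.
by rewrite /= !modnMDl !divnMDl // !divn_small // !modn_small // !addn0.
Qed.

(** The offset lets a round append its block of [m] rows to array 8 without disturbing those of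
    earlier rounds. *)
Definition filled2 (A A' : nat -> nat -> int) t off a b (F : nat -> nat -> int) :=
  [/\ forall t', t' <> t -> A' t' = A t',
      forall c l, c < a -> l < b -> A' t ((off + c) * b + l) = F c l
    & forall c l, l < b -> c < off \/ off + a <= c -> A' t (c * b + l) = A t (c * b + l)].

Lemma sem_fill2 p V A x y bx by_ t e1 e2 off a b F :
  ev p V A bx = Posz a -> a <= nu p ->
  (forall V A', ev p V A' by_ = Posz b) -> b <= nu p ->
  (forall c l A', c < a -> l < b -> (forall t', t' <> t -> A' t' = A t') ->
     (forall c' l', l' < b -> c' < off \/ off + c <= c' ->
        (c' = off + c -> l <= l') -> A' t (c' * b + l') = A t (c' * b + l')) ->
     [/\ absz (ev p (upd (upd V x c) y l) A' e1) = (off + c) * b + l,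
         ev p (upd (upd V x c) y l) A' e2 = F c l & absz (F c l) <= cap p]) ->
  filled2 A (sem p V A (SFor x bx (SFor y by_ (SSet t e1 e2)))) t off a b F.
Proof.
move=> ba anu bb bnu H; rewrite (sem_for _ _ ba anu).
set f := fun i A' => sem p (upd V x i) A' _.
suff: forall i, i <= a -> filled2 A (iteri i f A) t off i b F by exact.
elim=> [_|i IH ik]; first by split=> // c l lb [] //; rewrite addn0.
rewrite [iteri _ _ _]/=; set A' := iteri _ _ _ in IH *.
have [f1 f2 f3] := IH (ltnW ik).
have [||g1 g2 g3] := @sem_fill p (upd V x i) A' y by_ t e1 e2 b
    (fun l => (off + i) * b + l) (F i) (bb _ _) bnu.
- by move=> l l' lb lb' /flat_inj[].
- move=> l A'' lb [k1 k2 k3]; apply: H => //.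
    by move=> t' tt; rewrite k1 // f1.
  move=> c' l' lb' cc ll; rewrite k3; first exact: f3.
  move=> l'' lt'' /(flat_inj lb' (ltn_trans lt'' lb))[e1' e2'].
  by have := ll e1'; lia.
rewrite -/(f i A') in g1 g2 g3; split.
- by move=> t' tt; rewrite g1 // f1.
- move=> c l; rewrite ltnS leq_eqVlt => /orP[/eqP ->|lt] lb; first exact: g2.
  rewrite g3; first exact: f2.
  by move=> l' lb' /(flat_inj lb lb')[]; lia.
- move=> c l lb cc; rewrite g3; first by apply: f3 => //; lia.
  by move=> l' lb' /(flat_inj lb lb')[]; lia.
Qed.

Record context (p : conf) (k n d m : nat) : Prop := Ctx {
  ctx_k : nth 0 (inp p) 0 = k;
  ctx_d : nth 0 (inp p) 1 = d;
  ctx_n : nth 0 (inp p) 2 = n;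
  ctx_m : nth 0 (inp p) 3 = m;
  ctx_nu : nu p = (n + m + 2) ^ 30;
  ctx_cap : 2 ^ nu p <= cap p;
  ctx_n0 : 0 < n;
  ctx_d2 : 2 <= d;
  ctx_dm : d < m
}.

Lemma evA p V A a b : ev p V A (a +^ b) = (ev p V A a + ev p V A b)%R. Proof. by []. Qed.
Lemma evB p V A a b : ev p V A (a -^ b) = (ev p V A a - ev p V A b)%R. Proof. by []. Qed.
Lemma evM p V A a b : ev p V A (a *^ b) = (ev p V A a * ev p V A b)%R. Proof. by []. Qed.
Lemma evQ p V A a b : ev p V A (a /^ b) = Posz (absz (ev p V A a) %/ absz (ev p V A b)).
Proof. by []. Qed.
Lemma evL p V A a b : ev p V A (a <^ b) = Posz (ev p V A a < ev p V A b)%R. Proof. by []. Qed.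
Lemma evC p V A c : ev p V A (EC c) = Posz c. Proof. by []. Qed.
Lemma evV p V A x : ev p V A (EV x) = Posz (V x). Proof. by []. Qed.
Lemma evG p V A t e : ev p V A (EG t e) = A t (absz (ev p V A e)). Proof. by []. Qed.
Lemma flatE c N l : absz (Posz c * Posz N + Posz l)%R = c * N + l. Proof. by rewrite -PoszM -PoszD. Qed.
Lemma flatE3 t m c N l : absz ((Posz t * Posz m + Posz c) * Posz N + Posz l)%R = (t * m + c) * N + l.
Proof. by rewrite -PoszM -PoszD flatE. Qed.

(** * Magnitudes of intermediate values *)

Section Bounds.
Variable a : nat.
Hypothesis a6 : 6 <= a.

(** Level [e] means at most [a ^ e] bits. As [a >= 6], a sum, a product, or a sum of up to [a ^ 5]
    terms costs one level; all levels met stay at most 30, the exponent in [nu]. *)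
Definition sm e (z : int) := absz z <= 2 ^ (a ^ e).

Let ae e : 0 < a ^ e. Proof. by rewrite expn_gt0; lia. Qed.

Lemma sm_le e e' z : e <= e' -> sm e z -> sm e' z.
Proof.
move=> le h; apply: leq_trans h _; rewrite leq_exp2l // leq_pexp2l //; lia.
Qed.

Lemma smD e x y : sm e x -> sm e y -> sm e.+1 (x + y)%R.
Proof.
rewrite /sm => hx hy; apply: (@leq_trans (2 ^ (a ^ e).+1)); first by rewrite expnS; lia.
by rewrite leq_exp2l // expnS; have := ae e; nia.
Qed.

Lemma smM e x y : sm e x -> sm e y -> sm e.+1 (x * y)%R.
Proof.
rewrite /sm abszM => hx hy; apply: leq_trans (leq_mul hx hy) _.
by rewrite -expnD leq_exp2l // expnS; have := ae e; nia.
Qed.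

Lemma smN e x : sm e x -> sm e (- x)%R. Proof. by rewrite /sm; lia. Qed.
Lemma smB e x y : sm e x -> sm e y -> sm e.+1 (x - y)%R.
Proof. by move=> hx hy; apply: smD => //; apply: smN. Qed.

Lemma a_exp2 e : a ^ e <= 2 ^ (a * e).
Proof. by rewrite expnM; apply: leq_exp2r_weak; apply/ltnW/ltn_expl. Qed.

Lemma sm_nat x e : 0 < e -> x <= a ^ e -> sm e (Posz x).
Proof. by move=> e0 h; apply: leq_trans h _; apply/ltnW/ltn_expl. Qed.

Lemma sm_sum e k (F : nat -> int) : 0 < e -> k <= a ^ 5 ->
  (forall i, i < k -> sm e (F i)) -> sm e.+1 (\sum_(i < k) F i)%R.
Proof.
move=> e0 ka H.
have h : absz (\sum_(i < k) F i)%R <= k * 2 ^ (a ^ e).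
  elim: k {ka} H => [|k IH] H; first by rewrite big_ord0.
  rewrite big_ord_recr /= mulSn.
  have := IH (fun i ik => H i (leqW ik)); have := H k (ltnSn k); rewrite /sm.
  by move: (\sum_(i < k) F i)%R (F k) (2 ^ _) => s x y; lia.
apply: leq_trans h _.
apply: (@leq_trans (2 ^ (a * 5) * 2 ^ (a ^ e))).
  by rewrite leq_mul2r; apply/orP; right; apply: leq_trans ka (a_exp2 5).
rewrite -expnD leq_exp2l //.
have : a <= a ^ e by rewrite -{1}(expn1 a) leq_pexp2l //; lia.
rewrite expnS; nia.
Qed.

Lemma sm_small e z : 0 < e -> absz z <= 1 -> sm e z.
Proof. by move=> e0 h; apply: leq_trans h _; rewrite expn_gt0. Qed.
End Bounds.

(** * Bounds for the loops, the scale, and the matrix powers *)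

Section Main.
Variables (p : conf) (k n d m : nat).
Hypothesis ctx : context p k n d m.
Let N := n * d.
Let a := n + m + 2.

Lemma a6 : 6 <= a. Proof. by have := ctx_n0 ctx; have := ctx_d2 ctx; have := ctx_dm ctx; rewrite /a; lia. Qed.
Lemma N_gt0 : 0 < N. Proof. by rewrite muln_gt0 (ctx_n0 ctx); have := ctx_d2 ctx; lia. Qed.
Lemma N_le : N <= a ^ 2.
Proof. by have := ctx_dm ctx; rewrite /N /a -mulnn => h; apply: leq_mul; lia. Qed.
Lemma m_le : m <= a. Proof. by rewrite /a; lia. Qed.
Lemma n_le : n <= a. Proof. by rewrite /a; lia. Qed.
Lemma d_le : d <= a. Proof. by have := ctx_dm ctx; rewrite /a; lia. Qed.
Lemma ale e e' : e <= e' -> a ^ e <= a ^ e'.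
Proof. by move=> h; rewrite leq_pexp2l //; have := a6; lia. Qed.
Lemma T_le : N * N <= a ^ 4.
Proof. by rewrite (_ : 4 = 2 + 2)%N // expnD leq_mul // N_le. Qed.
Lemma J_le : N * N * m <= a ^ 5.
Proof. by rewrite expnSr leq_mul ?T_le ?m_le. Qed.
Lemma le_a5 x e : x <= a ^ e -> e <= 5 -> x <= a ^ 5.
Proof. by move=> h e5; apply: leq_trans h (ale e5). Qed.
Lemma N5 : N <= a ^ 5. Proof. exact: le_a5 N_le _. Qed.
Lemma m5 : m <= a ^ 5. Proof. by apply: (@le_a5 _ 1); rewrite ?expn1 ?m_le. Qed.
Lemma n5 : n <= a ^ 5. Proof. by apply: (@le_a5 _ 1); rewrite ?expn1 ?n_le. Qed.
Lemma d5 : d <= a ^ 5. Proof. by apply: (@le_a5 _ 1); rewrite ?expn1 ?d_le. Qed.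
Lemma le_nu x e : x <= a ^ e -> e <= 30 -> x <= nu p.
Proof. by move=> h e30; rewrite (ctx_nu ctx); apply: leq_trans h (ale e30). Qed.
Lemma N_nu : N <= nu p. Proof. exact: le_nu N5 _. Qed.
Lemma m_nu : m <= nu p. Proof. exact: le_nu m5 _. Qed.
Lemma n_nu : n <= nu p. Proof. exact: le_nu n5 _. Qed.
Lemma d_nu : d <= nu p. Proof. exact: le_nu d5 _. Qed.
Lemma smcap e z : e <= 30 -> sm a e z -> absz z <= cap p.
Proof.
move=> e30 h; apply: leq_trans h (leq_trans _ (ctx_cap ctx)).
by rewrite leq_exp2l // (ctx_nu ctx) ale.
Qed.

Lemma evk V A : ev p V A ek = Posz k. Proof. by rewrite /= (ctx_k ctx). Qed.
Lemma evd V A : ev p V A ed = Posz d. Proof. by rewrite /= (ctx_d ctx). Qed.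
Lemma evn V A : ev p V A en = Posz n. Proof. by rewrite /= (ctx_n ctx). Qed.
Lemma evm V A : ev p V A em = Posz m. Proof. by rewrite /= (ctx_m ctx). Qed.
Lemma evN V A : ev p V A eN = Posz N. Proof. by rewrite /eN evM evn evd. Qed.
Lemma evT V A : ev p V A eT = Posz (N * N). Proof. by rewrite /eT evM evN. Qed.
Lemma evJ V A : ev p V A eJ = Posz (N * N * m). Proof. by rewrite /eJ evM evT evm. Qed.
Lemma ev_epow V A e x j : ev p V A e = Posz x -> ev p V A (epow e j) = Posz (x ^ j).
Proof. by move=> h; elim: j => //= j IH; rewrite IH h expnSr. Qed.
Lemma evE13 V A : ev p V A eE = Posz (a ^ 13).
Proof. by apply: ev_epow; rewrite !evA evn evm. Qed.

Definition evE := (evk, evT, evJ, evE13, evN, evd, evn, evm, ev_eeq, evA, evB, evM, evQ, evL, evC, evV, evG).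

Lemma evSN V A x e : ev p V A (esum x eN e) = (\sum_(i < N) ev p (upd V x i) A e)%R.
Proof. by apply: ev_esum N_nu; apply: evN. Qed.
Lemma evSm V A x e : ev p V A (esum x em e) = (\sum_(i < m) ev p (upd V x i) A e)%R.
Proof. by apply: ev_esum m_nu; apply: evm. Qed.
Lemma evSd V A x e : ev p V A (esum x ed e) = (\sum_(i < d) ev p (upd V x i) A e)%R.
Proof. by apply: ev_esum d_nu; apply: evd. Qed.
Lemma evPn V A x e : ev p V A (eprod x en e) = (\prod_(i < n) ev p (upd V x i) A e)%R.
Proof. by apply: ev_eprod n_nu; apply: evn. Qed.

Variable Bm : nat -> nat -> int.
Hypothesis Bm_le : forall c l, c < m -> l < N -> absz (Bm c l) <= d.

Definition B_ok (A : nat -> nat -> int) := forall c l, c < m -> l < N -> A 1 (c * N + l) = Bm c l.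
Let S : int := Posz (2 ^ (a ^ 13)).

Lemma smB1 c l : c < m -> l < N -> sm a 1 (Bm c l).
Proof.
move=> cm lN; apply: leq_trans (Bm_le cm lN) _; rewrite expn1.
by apply: leq_trans d_le _; apply/ltnW/ltn_expl.
Qed.

Lemma smS : sm a 13 S. Proof. exact: leqnn. Qed.
Lemma smNz : sm a 2 (Posz N). Proof. by apply: sm_nat N_le. Qed.

Lemma s_S_ok V A : sem p V A s_S 19 0 = S.
Proof.
rewrite -[sem p V A s_S]/(sem p V (sem p V A (SSet 19 (EC 0) (EC 1)))
  (SFor 6 eE (SSet 19 (EC 0) (EC 2 *^ Sx)))).
set A1 := sem p V A _.
have l13 : a ^ 13 <= nu p by apply: le_nu (leqnn _) _.
rewrite (sem_for _ _ (evE13 V A1) l13).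
suff: forall i, i <= a ^ 13 ->
    iteri i (fun i A' => sem p (upd V 6 i) A' (SSet 19 (EC 0) (EC 2 *^ Sx))) A1 19 0 = Posz (2 ^ i).
  by apply.
elim=> [_|i IH lt].
  by rewrite [iteri _ _ _]/= /A1 /= /upd2 /= clip_id // (@smcap 1) // sm_small.
rewrite [iteri _ _ _]/= /upd2 /= IH; last exact: ltnW.
rewrite -PoszM -expnS clip_id // (@smcap 13) // /sm leq_exp2l //.
Qed.

(* Matrix-valued state of the power iteration. *)
Definition M_of v := gram (mxB m N Bm) (rowv N v).

Lemma M_ofE v (c c' : 'I_m) : M_of v c c' = (\sum_(l < N) v l * Bm c l * Bm c' l)%R.
Proof.
rewrite /M_of /gram mxE; apply: eq_bigr => l _.
by rewrite mul_mx_diag !mxE; ring.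
Qed.

Lemma smM_of v (c c' : 'I_m) : (forall l, l < N -> sm a 2 (v l)) -> sm a 5 (M_of v c c').
Proof.
move=> hv; rewrite M_ofE; apply: (@sm_sum a a6 4 N (fun l => v l * Bm c l * Bm c' l)%R) N5 _ => // l lN.
apply: (smM a6); last by apply: sm_le (smB1 _ lN); rewrite // a6.
apply: (smM a6); first exact: hv.
by apply: sm_le (smB1 _ lN); rewrite // a6.
Qed.

Definition H_ok v j (A : nat -> nat -> int) t :=
  forall c c' : 'I_m, A t (c * m + c') = mxpow (M_of v) j c c'.

(** One level per multiplication would make the level depend on [j]; counting [a ^ 6] bits per
    factor keeps every power up to [m] at level 7. *)
Lemma smH v j (c c' : 'I_m) : (forall l, l < N -> sm a 2 (v l)) ->
  absz (mxpow (M_of v) j c c') <= 2 ^ (a ^ 6 * j).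
Proof.
move=> hv; elim: j c c' => [|j IH] c c'.
  by rewrite muln0 expn0 mxE; case: eqP.
rewrite -[mxpow _ _]/(M_of v *m mxpow (M_of v) j)%R mxE.
have h : absz (\sum_j0 M_of v c j0 * mxpow (M_of v) j j0 c')%R <=
   \sum_(j0 < m) 2 ^ (a ^ 5) * 2 ^ (a ^ 6 * j).
  apply: (big_ind2 (fun (x : int) (y : nat) => absz x <= y)) => //.
    by move=> x1 x2 y1 y2; lia.
  by move=> i _; rewrite abszM leq_mul //; apply: smM_of.
apply: leq_trans h _; rewrite sum_nat_const card_ord mulnS expnD mulnA leq_mul2r; apply/orP; right.
apply: (@leq_trans (2 ^ a * 2 ^ (a ^ 5))).
  by rewrite leq_mul2r; apply/orP; right; apply: leq_trans m_le (ltnW (ltn_expl _ _)).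
rewrite -expnD leq_exp2l // expnS.
have : a <= a ^ 5 by rewrite -{1}(expn1 a) ale.
have := a6; nia.
Qed.

Lemma smHm v j (c c' : 'I_m) : j <= m -> (forall l, l < N -> sm a 2 (v l)) ->
  sm a 7 (mxpow (M_of v) j c c').
Proof.
move=> jm hv; apply: leq_trans (smH j c c' hv) _; rewrite leq_exp2l //.
by rewrite (expnSr a 6) leq_mul2l (leq_trans jm m_le) orbT.
Qed.

Lemma smH7 v j (c c' : 'I_m) : j < m -> (forall l, l < N -> sm a 2 (v l)) ->
  sm a 7 (\sum_(i < m) M_of v c i * mxpow (M_of v) j i c')%R.
Proof.
move=> jm hv; rewrite -[X in sm a 7 X](_ : mxpow (M_of v) j.+1 c c' = _); first exact: smHm.
by rewrite -[mxpow _ j.+1]/(M_of v *m mxpow (M_of v) j)%R mxE.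
Qed.

Lemma r5_ok v V A : (forall l, l < N -> sm a 2 (v l)) ->
  (forall c c' : 'I_m, A 4 (c * m + c') = M_of v c c') -> H_ok v 0 A 5 ->
  H_ok v m (sem p V A r5) 5.
Proof.
move=> hv HM H0; rewrite /r5 (sem_for _ _ (evm V A) m_nu).
set f := fun i A' => sem p (upd V 5 i) A' _.
suff: forall i, i <= m -> H_ok v i (iteri i f A) 5 /\ iteri i f A 4 = A 4.
  by move=> /(_ m (leqnn m)) [].
elim=> [_|j IH jm] //; have {IH} [IH I4] := IH (ltnW jm).
rewrite [iteri _ _ _]/= {1 3}/f; set A' := iteri _ _ _ in IH I4 *.
rewrite -[sem _ _ _ _]/(sem p (upd V 5 j) (sem p (upd V 5 j) A' r5a) r5b).
have [|x1 x2 _] := @sem_fill2 p (upd V 5 j) A' 1 7 em em 6 (EV 1 *^ em +^ EV 7)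
   (esum 4 em (EG 4 (EV 1 *^ em +^ EV 4) *^ EG 5 (EV 4 *^ em +^ EV 7))) 0 m m
   (fun c c' => (\sum_(i < m) A' 4 (c * m + i)%N * A' 5 (i * m + c')%N)%R)
   (evm _ _) m_nu (fun V A => evm V A) m_nu.
  move=> c c' A'' cm cm' h _; split.
  - by rewrite !evE flatE /upd /= add0n.
  - rewrite evSm; apply: eq_bigr => i _; by rewrite !evE !flatE /upd /= h // h.
  - apply: (@smcap 7) => //.
    have := smH7 (Ordinal cm) (Ordinal cm') jm hv.
    congr (sm a 7); apply: eq_bigr => i _; rewrite I4.
    by rewrite -(HM (Ordinal cm) i) -(IH i (Ordinal cm')).
set A1 := sem p (upd V 5 j) A' r5a in x1 x2 *.
have [|y1 y2 _] := @sem_fill2 p (upd V 5 j) A1 1 7 em em 5 (EV 1 *^ em +^ EV 7)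
   (EG 6 (EV 1 *^ em +^ EV 7)) 0 m m (fun c c' => A1 6 (c * m + c'))
   (evm _ _) m_nu (fun V A => evm V A) m_nu.
  move=> c c' A'' cm cm' h _; split.
  - by rewrite !evE flatE /upd /= add0n.
  - by rewrite !evE !flatE /upd /= h.
  - apply: (@smcap 7) => //; have := x2 c c' cm cm'; rewrite add0n => ->.
    have := smH7 (Ordinal cm) (Ordinal cm') jm hv.
    congr (sm a 7); apply: eq_bigr => i _; rewrite I4.
    by rewrite -(HM (Ordinal cm) i) -(IH i (Ordinal cm')).
split; last by rewrite -/(sem p (upd V 5 j) A1 r5b) y1 // x1.
move=> c c'; have := y2 c c' (ltn_ord c) (ltn_ord c'); rewrite add0n => ->.
have := x2 c c' (ltn_ord c) (ltn_ord c'); rewrite add0n => ->.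
rewrite -[mxpow _ j.+1]/(M_of v *m mxpow (M_of v) j)%R mxE.
by apply: eq_bigr => i _; rewrite I4 HM IH.
Qed.

End Main.

Lemma sem_set0 p V A t e : sem p V A (SSet t (EC 0) e) t 0 = clip (cap p) (ev p V A e).
Proof. by rewrite /= /upd2 !eqxx. Qed.

(** * Execution of one round *)

Section MW.
Variables (R : realType) (p : conf) (k n d m : nat).
Hypothesis ctx : context p k n d m.
Variable Bm : nat -> nat -> int.
Let N := n * d.
Let a := n + m + 2.
Hypothesis Bm_le : forall c l, c < m -> l < N -> absz (Bm c l) <= d.
Let S : int := Posz (2 ^ (a ^ 13)).
Let Z : int := (2 * Posz N * (S * S))%R.
Let a6' : 6 <= a := a6 ctx.
Let evEc := evE ctx.
Let N0 : 0 < N := N_gt0 ctx.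

Lemma S_gt0 : (0 < S)%R. Proof. by rewrite /S ltz_nat expn_gt0. Qed.
Lemma Z_gt0 : (0 < Z)%R.
Proof. by rewrite /Z !mulr_gt0 ?S_gt0 // ltz_nat. Qed.

Definition Xr (A : nat -> nat -> int) j l := A 8 (j * N + l).
Definition Qs (A : nat -> nat -> int) j := (\sum_(i < j) qf m N Bm (Xr A i))%R.

(** [mw_SW] bounds the total weight from above and [mw_exp] each weight from below; together they
    will bound the squares accumulated in a coordinate. [mw_lamQ] and [mw_dual] say that [lam] is
    dual feasible, up to constants, at the value of the vectors found. *)
Record mw_inv t (A : nat -> nat -> int) : Prop := MwInv {
  mw_B : B_ok n d m Bm A;
  mw_S : A 19 0 = S;
  mw_W : forall l, l < N -> (0 < A 2 l)%R;
  mw_Wle : forall l, l < N -> absz (A 2 l) <= 2 ^ (a ^ 18 * t);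
  mw_SW : ((\sum_(l < N) A 2 l) * Posz N ^+ t <= Posz N * (Z * (Posz N + 1)) ^+ t)%R;
  mw_exp : forall l, l < N ->
    (expR ((\sum_(j < t * m) Xr A j l ^+ 2)%:~R / (2 * Z%:~R)) * Z%:~R ^+ t <= (A 2 l)%:~R :> R)%R;
  mw_lam : forall l, l < N -> (0 <= A 9 l)%R;
  mw_lamle : forall l, l < N -> absz (A 9 l) <= 2 ^ (a ^ 25) * t;
  mw_lamQ : (\sum_(l < N) A 9 l <= 2 * Posz N * Qs A (t * m))%R;
  mw_dual : forall z : nat -> int, (qf m N Bm z * (Posz t * (Posz N * S ^+ 2))
     <= 16 * \sum_(l < N) A 9 l * z l ^+ 2)%R;
  mw_X : forall j l, j < t * m -> l < N -> sm a 15 (Xr A j l)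
}.

Lemma double_le_exp x : 0 < x -> 2 * x <= 2 ^ x.
Proof. by case: x => // x _; rewrite expnS leq_mul2l /=; apply: ltn_expl. Qed.

(** [cc] doubles as long as the new value keeps [cc ^+ 2 * nrm] within [S ^+ 2]. If it never stops
    it ends at [S] itself, large enough because a nonzero integer [nrm] is at least 1. *)
Lemma norm_loop V A nrm : A 17 0 = nrm -> (0 <= nrm)%R -> (nrm <= S)%R -> A 19 0 = S ->
  exists cc : int, [/\ sem p V A r8 18 0 = cc, (0 <= cc)%R, sm a 13 cc, (cc ^+ 2 * nrm <= S ^+ 2)%R
    & nrm = 0%R \/ (S ^+ 2 <= 4 * (cc ^+ 2 * nrm))%R].
Proof.
move=> A17 nrm0 nrmS A19.
rewrite -[sem p V A r8]/(sem p V (sem p V A (SSet 18 (EC 0) (EC 1)))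
  (SFor 6 eE (SSet 18 (EC 0) (ccx +^ ccx *^ (EC 1 -^ (Sx *^ Sx <^ EC 4 *^ (ccx *^ ccx *^ nrmx))))))).
set A1 := sem p V A _.
have l13 : a ^ 13 <= nu p by apply: (le_nu ctx (leqnn _)).
rewrite (sem_for _ _ (evE13 ctx V A1) l13); set f := fun i A' => sem p (upd V 6 i) A' _.
have S1 : (1 <= S)%R by have := S_gt0; lia.
have H i : i <= a ^ 13 -> [/\ iteri i f A1 17 = A 17, iteri i f A1 19 = A 19 &
    exists x : nat, [/\ iteri i f A1 18 0 = Posz x, x <= 2 ^ i, 0 < x,
     (Posz x * Posz x * nrm <= S * S)%R &
     (S * S < 4 * (Posz x * Posz x * nrm))%R \/ x = 2 ^ i]].
  elim: i => [_|i IH lt].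
    split; try by rewrite /= /A1 sem_frame.
    exists 1; split=> //; last by right.
      by rewrite [iteri _ _ _]/= /A1 sem_set0 evC clip_id // (@smcap _ _ _ _ _ ctx 1) // sm_small.
    by rewrite !mul1r; nia.
  have [h17 h19 [x [h18 xle x0 xS xc]]] := IH (ltnW lt).
  rewrite [iteri _ _ _]/=; set A' := iteri i f A1 in h17 h19 h18 *.
  split; try by rewrite /f sem_frame.
  have E : ev p (upd V 6 i) A' (ccx +^ ccx *^ (EC 1 -^ (Sx *^ Sx <^ EC 4 *^ (ccx *^ ccx *^ nrmx)))) =
    (Posz x + Posz x * (1 - Posz (S * S < 4 * (Posz x * Posz x * nrm))%R))%R.
    by rewrite /ccx /Sx /nrmx !evEc /= h18 h17 h19 A17 A19.
  have Cle y : y <= 2 ^ i.+1 -> absz (Posz y) <= cap p.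
    move=> hy; apply: (@smcap _ _ _ _ _ ctx 13) => //; apply: leq_trans hy _.
    by rewrite leq_exp2l.
  case: (boolP (S * S < 4 * (Posz x * Posz x * nrm))%R) => hc.
    exists x; split=> //; [|by rewrite expnS; lia|by left].
    rewrite /f sem_set0 E hc.
    by rewrite subrr mulr0 addr0 clip_id // Cle // expnS; lia.
  have {}xc : x = 2 ^ i by case: xc => // h; rewrite h in hc.
  exists (2 * x); split=> //.
  - rewrite /f sem_set0 E (negbTE hc).
    by rewrite subr0 mulr1 -PoszD addnn -mul2n clip_id // Cle // expnS leq_mul2l.
  - by rewrite expnS leq_mul2l.
  - by lia.
  - rewrite -leNgt in hc; rewrite PoszM; apply: le_trans hc.
    by rewrite le_eqVlt; apply/orP; left; apply/eqP; ring.
  - by right; rewrite xc expnS.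
have [_ _ [x [hx xle x0 xS xc]]] := H (a ^ 13) (leqnn _).
exists (Posz x); split=> //; rewrite ?expr2 //.
case: xc => [h|h]; first by right; rewrite ltW.
case: (ltrP 0%R nrm) => hn; last by left; lia.
right; rewrite h -/S; have : (S * S <= S * S * nrm)%R by rewrite ler_peMr ?mulr_ge0 //; lia.
by lia.
Qed.

Definition computed t (A A' : nat -> nat -> int) := exists (v : nat -> int) (om : nat -> nat) (cc : int) (g : nat -> nat -> int) (sw : nat),
  let x c l := (cc * v l * g c l)%R in
  let nrm := (\sum_(c < m) \sum_(l < N) v l * g c l ^+ 2)%R in
  [/\ [/\ Posz sw = (\sum_(l < N) A 2 l)%R, A' 16 0 = Posz sw &
          forall l, l < N -> [/\ (0 < v l)%R, (v l <= 2 * Posz N)%R, (Posz N <= 2 * Posz (om l) * v l)%R,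
         (A 2 l * v l <= 2 * Posz sw)%R & om l = 1 + (N * absz (A 2 l)) %/ sw /\ om l * sw <= sw + N * absz (A 2 l)]],
      forall (c : 'I_m) (l : 'I_N), g c l = (\sum_(c' < m) Bm c' l * mxpow (M_of n d m Bm v) m c' c)%R,
      (cc ^+ 2 * nrm <= S ^+ 2)%R /\ (nrm = 0 \/ S ^+ 2 <= 4 * (cc ^+ 2 * nrm))%R,
      (forall c l, c < m -> l < N -> Xr A' (t * m + c) l = x c l /\ sm a 15 (x c l)) /\
      (forall j l, j < t * m -> l < N -> Xr A' j l = Xr A j l)
    & A' 20 0 = (\sum_(c < m) qf m N Bm (x c))%R /\ sm a 20 (A' 20 0)].

Lemma round_compute t A V : mw_inv t A -> t < N * N -> V 0 = t ->
  computed t A (sem p V A (r1 ;; r2 ;; r3 ;; r4 ;; r5 ;; r6 ;; r7 ;; r8 ;; r9 ;; r10)).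
Proof.
move=> inv tT V0.
have [iB iS iW iWle _ _ _ _ _ _ _] := inv.
pose w l := absz (A 2 l); pose sw := \sum_(l < N) w l.
have wE l : l < N -> A 2 l = Posz (w l) by move=> lN; rewrite /w gez0_abs // ltW // iW.
have w0 l : l < N -> 0 < w l by move=> lN; have := iW l lN; rewrite wE.
have swE : Posz sw = (\sum_(l < N) A 2 l)%R.
  by rewrite /sw (big_morph Posz PoszD (erefl _)); apply: eq_bigr => l _; rewrite wE.
have wsw l : l < N -> w l <= sw by move=> lN; rewrite /sw (bigD1 (Ordinal lN)) //= leq_addr.
(* A round adds at most [a ^ 18] bits to a weight, and there are at most [a ^ 4] rounds. *)
have smW l : l < N -> sm a 22 (A 2 l).
  move=> lN; apply: leq_trans (iWle l lN) _; rewrite leq_exp2l //.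
  rewrite (_ : 22 = 18 + 4) // expnD leq_mul2l; apply/orP; right.
  by apply: leq_trans (ltnW tT) (T_le ctx).
set A1 := sem p V A r1.
have E1 : A1 16 0 = Posz sw.
  rewrite /A1 /r1 sem_set0 (evSN ctx).
  have -> : (\sum_(i < n * d) ev p (upd V 3 i) A (EG 2 (EV 3)) = Posz sw)%R.
    by rewrite swE; apply: eq_bigr => l _; rewrite !evEc /upd /=.
  rewrite clip_id // (@smcap _ _ _ _ _ ctx 23) // swE.
  by apply: (@sm_sum a a6' 22 N (A 2)) (N5 ctx) smW.
have F1 t' : t' <> 16 -> A1 t' = A t' by move=> h; apply: sem_frame; rewrite inE; lia.
pose om l := 1 + (N * w l) %/ sw.
pose v l := Posz ((2 * N * sw) %/ (N * w l + sw)).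
have vP l : l < N -> [/\ (0 < v l)%R, (v l <= 2 * Posz N)%R, (Posz N <= 2 * Posz (om l) * v l)%R,
         (A 2 l * v l <= 2 * Posz sw)%R & om l * sw <= sw + N * w l].
  move=> lN; have [h1 h2 h3 h4 h5] := round_weights N0 (w0 l lN) (wsw l lN).
  rewrite wE // /v; split=> //; rewrite -?PoszM; by rewrite ?lez_nat // -?mulnA.
have smv l : l < N -> sm a 2 (v l).
  move=> lN; have [h1 h2 _ _ _] := vP l lN.
  apply: (@leq_trans (2 * N)); first by rewrite /v /= -lez_nat PoszM.
  by apply: leq_trans (double_le_exp N0) _; rewrite leq_exp2l // (N_le ctx).
have [|x1 x2 _] := @sem_fill_id p V A1 2 eN 3 ((EC 2 *^ eN *^ SW) /^ (eN *^ EG 2 (EV 2) +^ SW)) N v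
   (evN ctx V A1) (N_nu ctx).
  move=> l A' lN h _; split; last by apply: (@smcap _ _ _ _ _ ctx 2) => //; apply: smv.
  by rewrite /SW !evEc /upd /= h // h // E1 F1 // wE.
set A2 := sem p V A1 r2; rewrite -/A2 in x1 x2.
have F2 t' : t' <> 3 -> t' <> 16 -> A2 t' = A t' by move=> h h'; rewrite x1 // F1.
have vE l : l < N -> A2 3 l = v l by apply: x2.
have [|y1 y2 _] := @sem_fill2 p V A2 1 7 em em 4 (EV 1 *^ em +^ EV 7)
   (esum 3 eN (EG 3 (EV 3) *^ Bx (EV 1) (EV 3) *^ Bx (EV 7) (EV 3))) 0 m m
   (fun c c' => (\sum_(l < N) v l * Bm c l * Bm c' l)%R)
   (evm ctx _ _) (m_nu ctx) (fun V A => evm ctx V A) (m_nu ctx).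
  move=> c c' A' cm cm' h _; split.
  - by rewrite !evEc flatE /upd /= add0n.
  - rewrite (evSN ctx); apply: eq_bigr => l _; rewrite /Bx !evEc !flatE /upd /= !h //.
    by rewrite vE // F2 // !iB.
  - apply: (@smcap _ _ _ _ _ ctx 5) => //.
    by have := smM_of ctx Bm_le (Ordinal cm) (Ordinal cm') smv; rewrite M_ofE.
set A3 := sem p V A2 r3; rewrite -/A3 in y1 y2.
have ME (c c' : 'I_m) : A3 4 (c * m + c') = M_of n d m Bm v c c'.
  by have := y2 c c' (ltn_ord c) (ltn_ord c'); rewrite add0n M_ofE.
have [|z1 z2 _] := @sem_fill2 p V A3 1 7 em em 5 (EV 1 *^ em +^ EV 7) (eeq (EV 1) (EV 7)) 0 m m
   (fun c c' => Posz (c == c')) (evm ctx _ _) (m_nu ctx) (fun V A => evm ctx V A) (m_nu ctx).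
  move=> c c' A' cm cm' h _; split.
  - by rewrite !evEc flatE /upd /= add0n.
  - by rewrite ev_eeq !evV /upd /= eqz_nat.
  - by apply: (@smcap _ _ _ _ _ ctx 1) => //; apply: sm_small => //; case: eqP.
set A4 := sem p V A3 r4; rewrite -/A4 in z1 z2.
have M4E (c c' : 'I_m) : A4 4 (c * m + c') = M_of n d m Bm v c c' by rewrite z1.
have H0 : H_ok n d m Bm v 0 A4 5.
  move=> c c'; have := z2 c c' (ltn_ord c) (ltn_ord c'); rewrite add0n => ->.
  by rewrite /mxpow /= mxE -val_eqE /=; case: eqP.
have H5 := r5_ok ctx Bm_le V smv M4E H0.
set A5 := sem p V A4 r5 in H5.
have F5 t' : t' \notin [:: 16; 3; 4; 5; 6] -> A5 t' = A t'.
  rewrite !inE !negb_or => /and5P[/eqP ? /eqP ? /eqP ? /eqP h5 /eqP h6].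
  rewrite /A5 sem_frame; last by rewrite /r5 /= !inE; lia.
  by rewrite z1 // y1 // F2.
have v5 l : l < N -> A5 3 l = v l.
  by move=> lN; rewrite /A5 sem_frame // z1 // y1 // vE.
pose g c l := (\sum_(c' < m) Bm c' l * A5 5 (c' * m + c)%N)%R.
have gE (c : 'I_m) (l : 'I_N) : g c l = (\sum_(c' < m) Bm c' l * mxpow (M_of n d m Bm v) m c' c)%R.
  by apply: eq_bigr => c' _; rewrite H5.
have smg c l : c < m -> l < N -> sm a 9 (g c l).
  move=> cm lN; apply: (@sm_sum a a6' 8 m (fun c' => Bm c' l * A5 5 (c' * m + c)%N)%R) (m5 ctx) _ => // c' cm'.
  apply: (smM a6'); first by apply: sm_le (smB1 ctx Bm_le cm' lN).
  by rewrite (H5 (Ordinal cm') (Ordinal cm)); apply: (smHm ctx Bm_le).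
have [|u1 u2 _] := @sem_fill2 p V A5 1 2 em eN 7 (EV 1 *^ eN +^ EV 2)
   (esum 4 em (Bx (EV 4) (EV 2) *^ EG 5 (EV 4 *^ em +^ EV 1))) 0 m N g
   (evm ctx _ _) (m_nu ctx) (fun V A => evN ctx V A) (N_nu ctx).
  move=> c l A' cm lN h _; split.
  - by rewrite !evEc flatE /upd /= add0n.
  - rewrite (evSm ctx); apply: eq_bigr => c' _; rewrite /Bx !evEc !flatE /upd /= !h //.
    by rewrite F5 // iB.
  - by apply: (@smcap _ _ _ _ _ ctx 9) => //; apply: smg.
set A6 := sem p V A5 r6; rewrite -/A6 in u1 u2.
have g6 c l : c < m -> l < N -> A6 7 (c * N + l) = g c l.
  by move=> cm lN; have := u2 c l cm lN; rewrite add0n.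
pose nrm := (\sum_(c < m) \sum_(l < N) v l * g c l ^+ 2)%R.
have smnrm : sm a 13 nrm.
  apply: (@sm_sum a a6' 12 m (fun c => \sum_(l < N) v l * g c l ^+ 2)%R) (m5 ctx) _ => // c cm.
  apply: (@sm_sum a a6' 11 N (fun l => v l * g c l ^+ 2)%R) (N5 ctx) _ => // l lN.
  apply: (smM a6'); first by apply: sm_le (smv l lN).
  by rewrite expr2; apply: (smM a6'); apply: smg.
have E7 : sem p V A6 r7 17 0 = nrm.
  rewrite /r7 sem_set0 (evSm ctx).
  have -> : (\sum_(i < m) ev p (upd V 1 i) A6 (esum 2 eN (EG 3 (EV 2) *^ sq (EG 7 (EV 1 *^ eN +^ EV 2)))) = nrm)%R.
    apply: eq_bigr => c _; rewrite (evSN ctx); apply: eq_bigr => l _.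
    by rewrite /sq !evEc !flatE /upd /= g6 // u1 // v5 // expr2.
  by rewrite clip_id // (@smcap _ _ _ _ _ ctx 13).
set A7 := sem p V A6 r7 in E7.
have F7 t' : t' \notin [:: 16; 3; 4; 5; 6; 7; 17] -> A7 t' = A t'.
  rewrite !inE !negb_or => /and5P[h1 h2 h3 h4 /and3P[h5 h6 h7]].
  by rewrite /A7 sem_frame ?inE // u1; [rewrite F5 // !inE !negb_or h1 h2 h3 h4 | apply/eqP].
have nrm0 : (0 <= nrm)%R.
  by apply: sumr_ge0 => c _; apply: sumr_ge0 => l _; rewrite mulr_ge0 ?sqr_ge0.
have nrmS : (nrm <= S)%R by have := smnrm; rewrite /sm /S; lia.
have S7 : A7 19 0 = S by rewrite F7.
have [cc [E8 cc0 smcc cc1 cc2]] := norm_loop V E7 nrm0 nrmS S7.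
set A8 := sem p V A7 r8 in E8.
have v8 l : l < N -> A8 3 l = v l.
  by move=> lN; rewrite /A8 sem_frame // /A7 sem_frame // u1 // v5.
have g8 c l : c < m -> l < N -> A8 7 (c * N + l) = g c l.
  by move=> cm lN; rewrite /A8 sem_frame // /A7 sem_frame // g6.
have F8 t' : t' \notin [:: 16; 3; 4; 5; 6; 7; 17; 18] -> A8 t' = A t'.
  rewrite !inE !negb_or => h; rewrite /A8 sem_frame; last by rewrite /= !inE; lia.
  by rewrite F7 // !inE; lia.
pose x c l := (cc * v l * g c l)%R.
have smx c l : c < m -> l < N -> sm a 15 (x c l).
  move=> cm lN; apply: (smM a6'); last by apply: sm_le (smg _ _ cm lN).
  by apply: (smM a6') => //; apply: sm_le (smv l lN).
have [|k1 k2 k3] := @sem_fill2 p V A8 1 2 em eN 8 ((EV 0 *^ em +^ EV 1) *^ eN +^ EV 2)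
   (ccx *^ EG 3 (EV 2) *^ EG 7 (EV 1 *^ eN +^ EV 2)) (t * m) m N x
   (evm ctx _ _) (m_nu ctx) (fun V A => evN ctx V A) (N_nu ctx).
  move=> c l A' cm lN h _; split.
  - by rewrite !evEc flatE3 /upd /= V0.
  - by rewrite /ccx !evEc !flatE /upd /= !h // E8 v8 // g8.
  - by apply: (@smcap _ _ _ _ _ ctx 15) => //; apply: smx.
set A9 := sem p V A8 r9; rewrite -/A9 in k1 k2 k3.
pose qt := (\sum_(c < m) qf m N Bm (x c))%R.
have smqt : sm a 20 qt.
  apply: (@sm_sum a a6' 19 m (fun c => qf m N Bm (x c))) (m5 ctx) _ => // c cm.
  apply: (@sm_sum a a6' 18 m (fun c' => (\sum_(l < N) Bm c' l * x c l) ^+ 2)%R) (m5 ctx) _ => // c' cm'.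
  have h : sm a 17 (\sum_(l < N) Bm c' l * x c l)%R.
    apply: (@sm_sum a a6' 16 N (fun l => Bm c' l * x c l)%R) (N5 ctx) _ => // l lN.
    by apply: (smM a6'); [apply: sm_le (smB1 ctx Bm_le cm' lN) | apply: smx].
  by rewrite expr2; apply: (smM a6').
have E10 : sem p V A9 r10 20 0 = qt.
  rewrite /r10 sem_set0 (evSm ctx).
  have -> : (\sum_(i < m) ev p (upd V 1 i) A9 (esum 7 em (sq (esum 2 eN (Bx (EV 7) (EV 2) *^ Xx)))) = qt)%R.
    apply: eq_bigr => c _; rewrite (evSm ctx); apply: eq_bigr => c' _.
    rewrite /sq evM (evSN ctx) expr2.
    have -> : (\sum_(i < n * d) ev p (upd (upd (upd V 1 c) 7 c') 2 i) A9 (Bx (EV 7) (EV 2) *^ Xx)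
      = \sum_(l < N) Bm c' l * x c l)%R; last by [].
    apply: eq_bigr => l _; rewrite /Bx /Xx !evEc flatE flatE3 /upd /= V0.
    by rewrite k2 // k1 // F8 // iB.
  by rewrite clip_id // (@smcap _ _ _ _ _ ctx 20).
exists v, om, cc, g, sw.
rewrite -[sem p V A _]/(sem p V A9 r10).
have F10 t' : t' <> 20 -> sem p V A9 r10 t' = A9 t'.
  by move=> h; apply: sem_frame; rewrite inE; apply/eqP.
split=> //.
- split=> //.
    rewrite F10 // k1 // /A8 sem_frame // /A7 sem_frame // u1 // /A5 sem_frame // z1 // y1 // x1 //.
  by move=> l lN; have [? ? ? ? ?] := vP l lN; split.
- split.
    by move=> c l cm lN; rewrite /Xr F10 // k2 //; split=> //; apply: smx.
  by move=> j l jt lN; rewrite /Xr F10 // k3 //; [rewrite F8|left].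
- by rewrite E10.
Qed.

End MW.

Lemma absz_addle (x y : int) : absz (x + y)%R <= absz x + absz y.
Proof. lia. Qed.

Lemma exp_step x y b : x <= y -> 6 <= b -> y + x <= b * y.
Proof. nia. Qed.

(** * Invariant of the multiplicative weights *)

Section Flat.
Variables (R : realType) (p : conf) (k n d m : nat).
Hypothesis ctx : context p k n d m.
Variable Bm : nat -> nat -> int.
Let N := n * d.
Let a := n + m + 2.
Hypothesis Bm_le : forall c l, c < m -> l < N -> absz (Bm c l) <= d.
Let S : int := Posz (2 ^ (a ^ 13)).
Let Z : int := (2 * Posz N * (S * S))%R.
Let a6' : 6 <= a := a6 ctx.
Let evEc := evE ctx.
Let N0 : 0 < N := N_gt0 ctx.
Let S0 : (0 < S)%R := S_gt0 n m.
Let Z0 : (0 < Z)%R := Z_gt0 ctx.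

Lemma sm2 e x : 2 * x <= a ^ e -> 0 < e -> sm a e (Posz (2 * x)).
Proof. by move=> h e0; apply: sm_nat. Qed.

Lemma smZ : sm a 15 Z.
Proof.
apply: (smM a6'); last by apply: sm_le (smM a6' (smS n m) (smS n m)); rewrite // a6'.
apply: (@sm_le a a6' 3) => //; rewrite -PoszM; apply: sm_nat => //.
rewrite expnS; apply: leq_mul; first exact: leq_trans a6'.
exact: N_le ctx.
Qed.

Lemma round_ok t A V : mw_inv R n d m Bm t A -> t < N * N -> V 0 = t ->
  mw_inv R n d m Bm t.+1 (sem p V A s_round).
Proof.
move=> inv tT V0.
have [iB iS iW iWle iSW iexp ilam ilamle ilamQ idual iX] := inv.
set A' := sem p V A (r1 ;; r2 ;; r3 ;; r4 ;; r5 ;; r6 ;; r7 ;; r8 ;; r9 ;; r10).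
have [v [om [cc [g [sw [[swE SWE vP] gE [cc1 cc2] [XE Xold] [qtE smqt]]]]]]] :=
  round_compute ctx Bm_le inv tT V0.
rewrite -/A' in XE Xold qtE smqt SWE.
pose x c l := (cc * v l * g c l)%R.
pose qt := (\sum_(c < m) qf m N Bm (x c))%R.
have qtE' : A' 20 0 = qt by exact: qtE.
have FA t' : t' \in [:: 1; 2; 9; 19] -> A' t' = A t'.
  by rewrite !inE => /or4P[] /eqP ->; apply: sem_frame.
have -> : sem p V A s_round = sem p V (sem p V A' r11) r12 by [].
have qt0 : (0 <= qt)%R by apply: sumr_ge0 => c _; apply: qf_ge0.
have tle : t.+1 <= a ^ 4 by apply: leq_trans (T_le ctx).
have smW l : l < N -> sm a 22 (A 2 l).
  move=> lN; apply: leq_trans (iWle l lN) _; rewrite leq_exp2l //.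
  rewrite (_ : 22 = 18 + 4) // expnD leq_mul2l; apply/orP; right.
  exact: leq_trans (ltnW tT) (T_le ctx).
have smom l : l < N -> sm a 24 (Posz (om l)).
  move=> lN; have [_ _ _ _ [-> _]] := vP l lN.
  rewrite PoszD; apply: (smD a6'); first exact: sm_small.
  apply: leq_trans (_ : absz (Posz N * A 2 l)%R <= _).
    by rewrite abszM /=; apply: leq_div.
  apply: (smM a6'); last exact: smW.
  by apply: (@sm_le a a6' 2) => //; apply: smNz ctx.
have smqo l : l < N -> sm a 25 (qt * Posz (om l))%R.
  move=> lN; apply: (smM a6'); last exact: smom.
  by apply: (@sm_le a a6' 20) => //; rewrite -qtE'.
pose lam' l := (A 9 l + qt * Posz (om l))%R.
have lamle' l : l < N -> absz (lam' l) <= 2 ^ (a ^ 25) * t.+1.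
  move=> lN; rewrite mulnS addnC.
  apply: leq_trans (absz_addle _ _) _.
  by apply: leq_add; [exact: ilamle | exact: smqo].
have capl l : l < N -> absz (lam' l) <= cap p.
  move=> lN; apply: (@smcap _ _ _ _ _ ctx 26) => //.
  apply: leq_trans (lamle' l lN) _.
  apply: (@leq_trans (2 ^ (a ^ 25) * 2 ^ (a ^ 4))).
    by rewrite leq_mul2l; apply/orP; right; apply: leq_trans tle (ltnW (ltn_expl _ _)).
  rewrite -expnD leq_exp2l // (expnS a 25).
  exact: exp_step (ale ctx (isT : 4 <= 25)) a6'.
have [|x1 x2 _] := @sem_fill_id p V A' 2 eN 9 (EG 9 (EV 2) +^ qtx *^ (EC 1 +^ (eN *^ EG 2 (EV 2)) /^ SW))
   N lam' (evN ctx V A') (N_nu ctx).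
  move=> l A'' lN h h9; split; last exact: capl.
  have [_ _ _ _ [omE _]] := vP l lN.
  rewrite /qtx /SW !evEc /upd /= h9 !h // qtE' SWE !FA // /lam'; congr (_ + _ * _)%R.
  by rewrite omE PoszD; congr (_ + Posz (_ %/ _))%R; rewrite abszM.
set A1 := sem p V A' r11; rewrite -/A1 in x1 x2.
pose xs l := (\sum_(c < m) x c l ^+ 2)%R.
pose W' l := (A 2 l * (Z + xs l))%R.
have smxs l : l < N -> sm a 17 (xs l).
  move=> lN; apply: (@sm_sum a a6' 16 m (fun c => x c l ^+ 2)%R) (m5 ctx) _ => // c cm.
  by have [_ h] := XE c l cm lN; rewrite expr2; apply: (smM a6').
have smf l : l < N -> sm a 18 (Z + xs l)%R.
  move=> lN; apply: (smD a6'); last exact: smxs.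
  by apply: (@sm_le a a6' 15) => //; apply: smZ.
have Wle' l : l < N -> absz (W' l) <= 2 ^ (a ^ 18 * t.+1).
  move=> lN; rewrite /W' abszM mulnS expnD [X in X <= _]mulnC.
  by apply: leq_mul; [exact: smf | exact: iWle].
have capW l : l < N -> absz (W' l) <= cap p.
  move=> lN; apply: (@smcap _ _ _ _ _ ctx 22) => //; apply: leq_trans (Wle' l lN) _.
  by rewrite leq_exp2l // (_ : 22 = 18 + 4) // expnD leq_mul2l tle orbT.
have [|y1 y2 _] := @sem_fill_id p V A1 2 eN 2
   (EG 2 (EV 2) *^ (EC 2 *^ eN *^ (Sx *^ Sx) +^ esum 1 em (sq Xx))) N W' (evN ctx V A1) (N_nu ctx).
  move=> l A'' lN h h2; split; last exact: capW.
  have Es : (\sum_(i < m) ev p (upd (upd V 2 l) 1 i) A'' (sq Xx) = xs l)%R.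
    apply: eq_bigr => c _.
    rewrite /sq /Xx !evEc !flatE3 /upd /= h // x1 // V0.
    by have [hx _] := XE c l (ltn_ord c) lN; rewrite -[A' 8 _]/(Xr n d A' (t * m + c) l) hx expr2.
  rewrite evM evA (evSm ctx) Es /Sx !evEc /upd /= h2 h // !x1 // !FA // iS -/S.
  by rewrite /W' /Z.
set A2 := sem p V A1 r12; rewrite -/A2 in y1 y2.
have lamE l : l < N -> A2 9 l = lam' l by move=> lN; rewrite y1 // x2.
have WE l : l < N -> A2 2 l = W' l by move=> lN; rewrite y2.
have X2 j l : Xr n d A2 j l = Xr n d A' j l by rewrite /Xr y1 // x1.
have Xnew c l : c < m -> l < N -> Xr n d A2 (t * m + c) l = x c l.
  by move=> cm lN; rewrite X2; have [] := XE c l cm lN.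
have Xold2 j l : j < t * m -> l < N -> Xr n d A2 j l = Xr n d A j l.
  by move=> jt lN; rewrite X2 Xold.
have v0 l : l < N -> (0 < v l)%R by move=> lN; have [] := vP l lN.
have split_sum (T : nmodType) (F : nat -> T) :
    (\sum_(j < t.+1 * m) F j = \sum_(j < t * m) F j + \sum_(c < m) F (t * m + c)%N)%R.
  by rewrite mulSnr big_split_ord /=.
have qfext (z z' : nat -> int) : (forall l, l < N -> z l = z' l) -> qf m N Bm z = qf m N Bm z'.
  by move=> h; apply: eq_bigr => c _; congr (_ ^+ 2)%R; apply: eq_bigr => l _; rewrite h.
have QE : Qs n d m Bm A2 (t.+1 * m) = (Qs n d m Bm A (t * m) + qt)%R.
  rewrite /Qs (split_sum _ (fun j => qf m N Bm (Xr n d A2 j))); congr (_ + _)%R.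
    by apply: eq_bigr => j _; apply: qfext => l lN; apply: Xold2.
  by apply: eq_bigr => c _; apply: qfext => l lN; apply: Xnew.
have xs0 l : (0 <= xs l)%R by apply: sumr_ge0 => c _; rewrite sqr_ge0.
have xsZ l : l < N -> (xs l <= Z)%R.
  move=> lN; apply: le_trans (round_col v0 cc1 lN) _.
  have [_ h _ _ _] := vP l lN; rewrite /Z expr2.
  by apply: ler_wpM2r; [rewrite mulr_ge0 // ltW | exact: h].
split.
- by move=> c l cm lN; rewrite y1 // x1 // FA // iB.
- by rewrite y1 // x1 // FA.
- by move=> l lN; rewrite WE // /W' mulr_gt0 ?iW // ltr_wpDr ?xs0.
- by move=> l lN; rewrite WE // Wle'.
- have -> : (\sum_(l < N) A2 2 l = \sum_(l < N) (A 2 l * Z + A 2 l * xs l))%R.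
    by apply: eq_bigr => l _; rewrite WE // /W' mulrDr.
  rewrite big_split /= -mulr_suml -swE.
  (* The total weight grows by a factor of at most [Z + 2 S^2], which is [Z (1 + 1 / N)] by the
     choice of [Z]. *)
  have h : (\sum_(l < N) A 2 l * xs l <= 2 * Posz sw * S ^+ 2)%R.
    by apply: (round_total v0 cc1) => // l lN; have [] := vP l lN.
  set X := (\sum_(l < N) A 2 l * xs l)%R in h *.
  have E1 : ((Posz sw * Z + X) * Posz N ^+ t.+1 = (Posz sw * Z + X) * Posz N * Posz N ^+ t)%R.
    by rewrite exprS mulrA.
  rewrite E1; apply: (@le_trans _ _ (Posz sw * (Z * (Posz N + 1)) * Posz N ^+ t)%R).
    apply: ler_wpM2r; first by rewrite exprn_ge0.
    have -> : (Posz sw * (Z * (Posz N + 1)) = (Posz sw * Z + 2 * Posz sw * S ^+ 2) * Posz N)%R.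
      by rewrite /Z; ring.
    by apply: ler_wpM2r => //; rewrite lerD2l.
  have E3 : (Posz sw * (Z * (Posz N + 1)) * Posz N ^+ t = Posz sw * Posz N ^+ t * (Z * (Posz N + 1)))%R.
    by rewrite mulrAC.
  have E4 : (Posz N * (Z * (Posz N + 1)) ^+ t.+1 =
      Posz N * (Z * (Posz N + 1)) ^+ t * (Z * (Posz N + 1)))%R by rewrite exprSr mulrA.
  rewrite E3 E4 swE; apply: ler_wpM2r; last exact: iSW.
  by apply: mulr_ge0 => //; apply: ltW.
- move=> l lN; rewrite WE //.
  have -> : (\sum_(j < t.+1 * m) Xr n d A2 j l ^+ 2 = \sum_(j < t * m) Xr n d A j l ^+ 2 + xs l)%R.
    rewrite (split_sum _ (fun j => Xr n d A2 j l ^+ 2)%R); congr (_ + _)%R.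
      by apply: eq_bigr => j _; rewrite Xold2.
    by apply: eq_bigr => c _; rewrite Xnew.
  by apply: mw_potential_step => //; [exact: xsZ | exact: iexp].
- by move=> l lN; rewrite lamE // /lam' addr_ge0 ?ilam // mulr_ge0.
- by move=> l lN; rewrite lamE // lamle'.
- rewrite QE mulrDr.
  have -> : (\sum_(l < N) A2 9 l = \sum_(l < N) (A 9 l + qt * Posz (om l)))%R.
    by apply: eq_bigr => l _; rewrite lamE.
  rewrite big_split /=; apply: lerD; first exact: ilamQ.
  rewrite -mulr_sumr [X in (_ <= X)%R]mulrC; apply: ler_wpM2l => //.
  have sw0 : 0 < sw.
    rewrite -ltz_nat swE (bigD1 (Ordinal N0)) //= ltr_pwDl ?iW //.
    by apply: sumr_ge0 => l _; rewrite ltW // iW.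
  (* Each [om l] exceeds 1 by at most [N * W l / SW], and these excesses sum to at most [N]; so the
     total of [lam] grows by at most [2 * N * qt]. *)
  have H : (\sum_(l < N) om l) * sw <= 2 * N * sw.
    have -> : 2 * N * sw = N * sw + N * sw by rewrite -mulnA mul2n addnn.
    rewrite big_distrl /=; apply: (@leq_trans (\sum_(l < N) (sw + N * absz (A 2 l)))).
      by apply: leq_sum => l _; have [_ _ _ _ []] := vP l (ltn_ord l).
    rewrite big_split /= sum_nat_const card_ord leq_add2l -big_distrr /= leq_mul2l; apply/orP; right.
    rewrite -lez_nat swE (big_morph Posz PoszD (erefl _)); apply: ler_sum => l _.
    by rewrite gez0_abs // ltW // iW.
  rewrite leq_pmul2r // in H.
  by rewrite -(big_morph Posz PoszD (erefl _)) -PoszM lez_nat.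
- move=> z.
  have E : (\sum_(l < N) A2 9 l * z l ^+ 2 =
     \sum_(l < N) A 9 l * z l ^+ 2 + \sum_(l < N) qt * Posz (om l) * z l ^+ 2)%R.
    by rewrite -big_split /=; apply: eq_bigr => l _; rewrite lamE // /lam' mulrDl.
  rewrite E mulrDr -addn1 PoszD mulrDl mulrDr; apply: lerD; first exact: idual.
  rewrite mul1r; apply: (@round_dual_int m N Bm z v (fun l => Posz (om l)) S qt) => //.
    by move=> l lN; have [] := vP l lN.
  exact: (round_dual v0 gE cc2).
- move=> j l jt lN; case: (ltnP j (t * m)) => jtm; first by rewrite Xold2 // iX.
  have cm : j - t * m < m by rewrite ltn_subLR // addnC -mulSn.
  by rewrite -(subnKC jtm) Xnew //; have [] := XE _ l cm lN.
Qed.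

Lemma mw_loop V A : B_ok n d m Bm A -> A 19 0 = S -> (forall l, l < N -> A 2 l = 1%R) ->
  (forall l, A 9 l = 0%R) -> mw_inv R n d m Bm (N * N) (sem p V A s_MW).
Proof.
move=> iB iS iW il; have TN : N * N <= nu p by apply: (le_nu ctx (T_le ctx)).
rewrite /s_MW (sem_for _ _ (evT ctx V A) TN).
suff: forall i, i <= N * N -> mw_inv R n d m Bm i (iteri i (fun i A' => sem p (upd V 0 i) A' s_round) A).
  by apply.
elim=> [_|i IH lt]; last by apply: round_ok => //; exact: IH (ltnW lt).
have WN : (\sum_(l < N) A 2 l = Posz N)%R.
  rewrite (eq_bigr (fun=> 1%R)) => [|l _]; last by rewrite iW.
  by rewrite sumr_const card_ord natz.
split=> //=.
- by move=> l lN; rewrite iW.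
- by move=> l lN; rewrite iW // muln0.
- by rewrite WN !expr0 !mulr1.
- by move=> l lN; rewrite iW // big_ord0 mul0r expR0 expr0 mulr1.
- by move=> l lN; rewrite il.
- by move=> l lN; rewrite il.
- by rewrite /Qs big_ord0 mulr0 big1 // => l _; rewrite il.
- by move=> z; rewrite mul0r mulr0 big1 ?mulr0 // => l _; rewrite il mul0r.
Qed.

End Flat.

(** * Signed sum of the vectors and its truncation *)

Section Signs.
Variables (R : realType) (p : conf) (k n d m : nat).
Hypothesis ctx : context p k n d m.
Variable Bm : nat -> nat -> int.
Let N := n * d.
Let a := n + m + 2.
Hypothesis Bm_le : forall c l, c < m -> l < N -> absz (Bm c l) <= d.
Let S : int := Posz (2 ^ (a ^ 13)).
Let a6' : 6 <= a := a6 ctx.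
Let evEc := evE ctx.
Let N0 : 0 < N := N_gt0 ctx.
Let S0 : (0 < S)%R := S_gt0 n m.
Let F : int := (8 * Posz N ^+ 2 * S ^+ 2)%R.
Let beta : int := (12 * F ^+ 2 * Posz N)%R.

(** In [si_pot] the potential starts at minus the quartic of the zero vector, [3 F^2] times the
    total of [lam], and each sign adds at least [beta] times the form of its vector. *)
Record sign_inv (A0 : nat -> nat -> int) j (A : nat -> nat -> int) : Prop := SignInv {
  si_frame : forall t, t \in [:: 0; 1; 8; 9; 19; 22; 23] -> A t = A0 t;
  si_s : forall l, l < N -> A 11 l = (\sum_(i < j) Xr n d A0 i l ^+ 2)%R;
  si_sle : forall l, l < N -> absz (A 11 l) <= 2 ^ (a ^ 16) * j;
  si_y : forall l, l < N -> absz (A 10 l) <= 2 ^ (a ^ 15) * j;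
  si_pot : (beta * Qs n d m Bm A0 j - 3 * F ^+ 2 * (\sum_(l < N) A0 9 l) <=
    beta * qf m N Bm (A 10) - quartic N F (A0 9) (A 10) (A 11))%R
}.

Lemma exp_mul_le e j : 0 < e -> j <= a ^ 5 -> 2 ^ (a ^ e) * j <= 2 ^ (a ^ e.+1).
Proof.
move=> e0 ja; apply: (@leq_trans (2 ^ (a ^ e) * 2 ^ (a * 5))).
  by rewrite leq_mul2l; apply/orP; right; apply: leq_trans ja (a_exp2 a 5).
rewrite -expnD leq_exp2l // expnS.
have ae : a <= a ^ e by rewrite -{1}(expn1 a) (ale ctx).
have := leq_mul a6' (leqnn (a ^ e)); move: (a ^ e) ae; clear; lia.
Qed.

Lemma driftE V A0 A x : B_ok n d m Bm A -> A 19 0 = S ->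
  (forall l, l < N -> A 8 (V 0 * N + l) = x l) -> A 9 = A0 9 ->
  ev p V A driftx = drift m N Bm beta F (A0 9) (A 10) (A 11) x.
Proof.
move=> iB iS iX i9.
have EF W A' : A' 19 = A 19 -> ev p W A' Fx = F.
  by move=> h; rewrite /Fx /sq /Sx !evEc /= h iS /F !expr2.
have EFA W : ev p W A Fx = F by apply: EF.
have Eb W : ev p W A betax = beta by rewrite /betax /sq 2!evM evM EFA evC (evN ctx) /beta expr2.
rewrite /driftx evB evM Eb /drift /pairing; congr (_ * _ - _)%R.
  rewrite (evSm ctx); apply: eq_bigr => c _; rewrite evM !(evSN ctx); congr (_ * _)%R.
    by apply: eq_bigr => l _; rewrite /Bx /yx !evEc !flatE /upd /= iB.
  by apply: eq_bigr => l _; rewrite /Bx /xx !evEc !flatE /upd /= iB // iX.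
rewrite (evSN ctx); apply: eq_bigr => l _.
have Ex : ev p (upd V 2 l) A xx = x l by rewrite /xx !evEc !flatE /upd /= iX.
have Ey : ev p (upd V 2 l) A yx = A 10 l by rewrite /yx !evEc /upd /=.
rewrite !(EFA, Ex, Ey, evM, evA, evB, evC) !evG !evV /upd /= i9; congr (_ * _)%R.
by ring.
Qed.

Lemma sign_ok A0 V j A : mw_inv R n d m Bm (N * N) A0 -> j < N * N * m -> V 0 = j ->
  sign_inv A0 j A -> sign_inv A0 j.+1 (sem p V A (g1 ;; g2 ;; g3)).
Proof.
move=> inv jJ V0 [fr sE sle yle pot].
have [iB iS iW iWle iSW iexp ilam ilamle ilamQ idual iX] := inv.
pose x l := Xr n d A0 j l.
have iXA l : l < N -> A 8 (V 0 * N + l) = x l by move=> lN; rewrite fr // V0.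
have BA : B_ok n d m Bm A by move=> c l cm lN; rewrite fr // iB.
have SA : A 19 0 = S by rewrite fr.
have DE := driftE BA SA iXA (fr 9 isT).
pose D := drift m N Bm beta F (A0 9) (A 10) (A 11) x.
pose e : int := (1 - 2 * Posz (D < 0)%R)%R.
have e2 : (e ^+ 2 = 1)%R by rewrite /e; case: ltP.
have eD : (0 <= e * D)%R.
  rewrite /e; case: (ltP D 0%R) => h.
    by rewrite (_ : (1 - 2 * Posz true = -1)%R) // mulN1r oppr_ge0 ltW.
  by rewrite (_ : (1 - 2 * Posz false = 1)%R) // mul1r.
have e1 : absz e <= 1 by rewrite /e; case: ltP.
have J5 : j.+1 <= a ^ 5 by apply: leq_trans (J_le ctx).
set A1 := sem p V A g1.
have E1 : A1 21 0 = e.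
  rewrite /A1 /g1 sem_set0 evB evM evL !evC DE -/D.
  rewrite clip_id //; apply: (@smcap _ _ _ _ _ ctx 1) => //; exact: sm_small.
have F1 t' : t' <> 21 -> A1 t' = A t' by move=> h; apply: sem_frame; rewrite inE; apply/eqP.
have smx l : l < N -> sm a 15 (x l) by move=> lN; apply: iX.
pose y' l := (A 10 l + e * x l)%R.
have yle' l : l < N -> absz (y' l) <= 2 ^ (a ^ 15) * j.+1.
  move=> lN; rewrite mulnS addnC.
  apply: leq_trans (absz_addle _ _) _.
  apply: leq_add; first exact: yle.
  by rewrite abszM -[X in _ <= X]mul1n leq_mul //; exact: smx.
have [|x1 x2 _] := @sem_fill_id p V A1 2 eN 10 (yx +^ sgx *^ xx) N y' (evN ctx V A1) (N_nu ctx).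
  move=> l A' lN h h10; split.
    rewrite /yx /sgx /xx !evEc !flatE /upd /= h10 !h // E1 !F1 // iXA //.
  apply: (@smcap _ _ _ _ _ ctx 16) => //; apply: leq_trans (yle' l lN) _.
  exact: exp_mul_le.
set A2 := sem p V A1 g2; rewrite -/A2 in x1 x2.
pose s' l := (A 11 l + x l ^+ 2)%R.
have sle' l : l < N -> absz (s' l) <= 2 ^ (a ^ 16) * j.+1.
  move=> lN; rewrite mulnS addnC.
  apply: leq_trans (absz_addle _ _) _.
  by apply: leq_add; [exact: sle | rewrite expr2; apply: (smM a6'); apply: smx].
have [|y1 y2 _] := @sem_fill_id p V A2 2 eN 11 (EG 11 (EV 2) +^ xx *^ xx) N s' (evN ctx V A2) (N_nu ctx).
  move=> l A' lN h h11; split.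
    by rewrite /xx !evEc !flatE /upd /= h11 !h // !x1 // !F1 // iXA // /s' expr2.
  apply: (@smcap _ _ _ _ _ ctx 17) => //; apply: leq_trans (sle' l lN) _.
  exact: exp_mul_le.
have -> : sem p V A (g1 ;; g2 ;; g3) = sem p V A2 g3 by [].
set A3 := sem p V A2 g3; rewrite -/A3 in y1 y2.
have qE : qf m N Bm (A3 10) = qf m N Bm y'.
  by apply: eq_bigr => c _; congr (_ ^+ 2)%R; apply: eq_bigr => l _; rewrite y1 // x2.
have rE : quartic N F (A0 9) (A3 10) (A3 11) = quartic N F (A0 9) y' s'.
  by apply: eq_bigr => l _; rewrite y1 // x2 // y2.
split.
- by move=> t ht; rewrite y1 ?x1 ?F1 ?fr // => e'; rewrite e' in ht.
- by move=> l lN; rewrite y2 // /s' sE // big_ord_recr.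
- by move=> l lN; rewrite y2 // sle'.
- by move=> l lN; rewrite y1 // x2 // yle'.
- rewrite qE rE; have := sign_step e2 ilam eD; rewrite -/y' -/s' => h.
  apply: le_trans h; rewrite /Qs big_ord_recr /= mulrDr.
  by rewrite addrAC lerD2r.
Qed.

Lemma sign_loop A0 V : mw_inv R n d m Bm (N * N) A0 -> (forall l, A0 10 l = 0%R) ->
  (forall l, A0 11 l = 0%R) -> sign_inv A0 (N * N * m) (sem p V A0 s_sign).
Proof.
move=> inv y0 s0; have JN : N * N * m <= nu p by apply: (le_nu ctx (J_le ctx)).
rewrite /s_sign (sem_for _ _ (evJ ctx V A0) JN).
suff: forall i, i <= N * N * m ->
  sign_inv A0 i (iteri i (fun i A' => sem p (upd V 0 i) A' (g1 ;; g2 ;; g3)) A0).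
  by apply.
elim=> [_|i IH lt]; last by apply: sign_ok => //; exact: IH (ltnW lt).
split=> //=.
- by move=> l lN; rewrite s0 big_ord0.
- by move=> l lN; rewrite s0.
- by move=> l lN; rewrite y0.
- rewrite /Qs big_ord0 mulr0 add0r.
  have -> : qf m N Bm (A0 10) = 0%R.
    apply: big1 => c _; rewrite big1 ?expr0n // => l _; by rewrite y0 mulr0.
  rewrite mulr0 add0r lerN2 /quartic mulr_sumr; apply: ler_sum => l _.
  rewrite y0 s0 !expr0n /= !mulr0 mul0r !add0r subr0 mulrC //.
Qed.

Let Mt : int := (160 * S * Posz N)%R.

(** All that rounding uses from the optimisation: a bounded primal vector and dual weights, within
    constants of the same [Q]. *)
Record flat_res (A : nat -> nat -> int) (Q : int) : Prop := FlatRes {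
  fl_B : B_ok n d m Bm A;
  fl_S : A 19 0 = S;
  fl_lam : forall l, l < N -> (0 <= A 9 l)%R;
  fl_lamQ : (\sum_(l < N) A 9 l <= 2 * Posz N * Q)%R;
  fl_dual : forall z : nat -> int, (qf m N Bm z * (Posz N ^+ 3 * S ^+ 2)
     <= 16 * \sum_(l < N) A 9 l * z l ^+ 2)%R;
  fl_yt : forall l, l < N -> (`|A 12 l| <= Mt)%R;
  fl_Q : (Q <= 4 * qf m N Bm (A 12))%R
}.

Lemma smMt : sm a 15 Mt.
Proof.
apply: (smM a6'); last by apply: (@sm_le a a6' 2) => //; apply: smNz ctx.
apply: (smM a6'); last exact: smS.
apply: (@sm_le a a6' 3) => //; apply: (sm_nat (e := 3)) => //.
by apply: (@leq_trans (6 ^ 3)) => //; apply: leq_exp2r_weak; exact: a6'.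
Qed.

Lemma flat_ok A0 V : mw_inv R n d m Bm (N * N) A0 -> (forall l, A0 10 l = 0%R) ->
  (forall l, A0 11 l = 0%R) ->
  flat_res (sem p V A0 (s_sign ;; s_yt)) (Qs n d m Bm A0 (N * N * m)).
Proof.
move=> inv y0 s0.
have -> : sem p V A0 (s_sign ;; s_yt) = sem p V (sem p V A0 s_sign) s_yt by [].
have [fr sE sle yle pot] := sign_loop V inv y0 s0.
set A := sem p V A0 s_sign in fr sE sle yle pot *.
have [iB iS iW iWle iSW iexp ilam ilamle ilamQ idual iX] := inv.
pose yt l := (A 10 l + (- Mt - A 10 l) * Posz (A 10 l < - Mt)%R + (Mt - A 10 l) * Posz (Mt < A 10 l)%R)%R.
have Mt0 : (0 <= Mt)%R by rewrite /Mt !mulr_ge0 // ltW.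
have ytP l := clamp_quartic (A 10 l) Mt0.
have [|x1 x2 _] := @sem_fill_id p V A 2 eN 12
   (yx +^ (EC 0 -^ Mtx -^ yx) *^ (yx <^ EC 0 -^ Mtx) +^ (Mtx -^ yx) *^ (Mtx <^ yx)) N yt
   (evN ctx V A) (N_nu ctx).
  move=> l A' lN h _; split.
    rewrite /yx /Mtx /Sx !evEc /upd /= !h // (fr 19 isT) iS -/S -/Mt.
    by rewrite /yt sub0r.
  apply: (@smcap _ _ _ _ _ ctx 15) => //; apply: leq_trans smMt.
  by have [h1 _] := ytP l; rewrite -lez_nat !abszE (ger0_norm Mt0).
set A' := sem p V A s_yt; rewrite -/A' in x1 x2.
split.
- by move=> c l cm lN; rewrite x1 // fr // iB.
- by rewrite x1 // fr.
- by move=> l lN; rewrite x1 // fr // ilam.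
- by rewrite x1 // fr.
(* The [N ^ 2] rounds contribute [N * S ^ 2] each to the denominator of the dual bound. *)
- move=> z; rewrite x1 // fr //; apply: le_trans (idual z); rewrite le_eqVlt; apply/orP; left; apply/eqP.
  change (qf m N Bm z * (Posz N ^+ 3 * S ^+ 2) = qf m N Bm z * (Posz N * Posz N * (Posz N * S ^+ 2)))%R.
    by ring.
- by move=> l lN; rewrite x2 //; have [] := ytP l.
- have -> : qf m N Bm (A' 12) = qf m N Bm yt.
    by apply: eq_bigr => c _; congr (_ ^+ 2)%R; apply: eq_bigr => l _; rewrite x2.
  apply: (@truncation m N Bm (A0 9) (A 10) (A 11) yt S) => //.
  (* [mw_flat] bounds the accumulated squares by [4 N Z], which is exactly the variance budget
     [F]. *)
  + move=> l lN; rewrite sE //.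
    have SWl : (A0 2 l <= \sum_(l < N) A0 2 l)%R.
      rewrite (bigD1 (Ordinal lN)) //= lerDl; apply: sumr_ge0 => i _; rewrite ltW // iW //.
    have := @mw_flat R N (2 * Posz N * (S * S)) _ _ _ N0 (Z_gt0 ctx) SWl iSW (iexp l lN).
    by move/le_trans; apply; rewrite le_eqVlt; apply/orP; left; apply/eqP; ring.
  + move=> z; apply: le_trans (idual z); rewrite le_eqVlt; apply/orP; left; apply/eqP.
    change (qf m N Bm z * (Posz N ^+ 3 * S ^+ 2) = qf m N Bm z * (Posz N * Posz N * (Posz N * S ^+ 2)))%R.
    by ring.
  + by move=> l lN; have [] := ytP l.
Qed.

End Signs.

Lemma sqrt_up_le r K : 0 < r -> 0 < K -> (1 < r -> r.-1 ^ 2 < K) -> r ^ 2 <= 4 * K.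
Proof.
case: r => [|[|r]] // _ K0 h; first by rewrite exp1n; lia.
by have := h isT; rewrite -!mulnn /=; nia.
Qed.

(** * Square root of the clause length, and conditional expectations *)

Section Rounding.
Variables (p : conf) (k n d m : nat).
Hypothesis ctx : context p k n d m.
Let N := n * d.
Let a := n + m + 2.
Let a6' : 6 <= a := a6 ctx.
Let evEc := evE ctx.
Let N0 : 0 < N := N_gt0 ctx.
Let d0 : 0 < d. Proof. exact: ltnW (ctx_d2 ctx). Qed.
Variable cl : nat -> nat -> nat.
Hypothesis cl_le : forall c u, c < m -> u < n -> cl c u <= d.
Definition cl_ok (A : nat -> nat -> int) :=
  forall c u, c < m -> u < n -> A 0 (c * n + u) = Posz (cl c u).
Let K := minn k n.

Lemma evK V A : ev p V A Kx = Posz K.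
Proof.
rewrite /Kx !evEc /K ltz_nat; case: (ltnP n k) => h; rewrite ?mulr1 ?mulr0 ?addr0 //.
by rewrite addrC subrK.
Qed.

(** [r] grows from 1 while [r ^ 2 < K]; as [K <= n], [n] iterations suffice. It ends at the
    rounded-up square root, and [r <= 2 (r - 1)] for [r > 1] gives the upper bound. *)
Lemma s_r_ok V A : exists r : nat, [/\ sem p V A s_r 22 0 = Posz r, 0 < r, r <= n.+1,
  K <= r ^ 2 & 0 < K -> r ^ 2 <= 4 * K].
Proof.
rewrite -[sem p V A s_r]/(sem p V (sem p V A (SSet 22 (EC 0) (EC 1)))
  (SFor 6 en (SSet 22 (EC 0) (rx +^ (rx *^ rx <^ Kx))))).
set A1 := sem p V A _.
rewrite (sem_for _ _ (evn ctx V A1) (n_nu ctx)); set f := fun i A' => sem p (upd V 6 i) A' _.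
have C x : x <= n.+1 -> absz (Posz x) <= cap p.
  move=> h; apply: (@smcap _ _ _ _ _ ctx 1) => //; apply: sm_nat => //; rewrite expn1.
  by apply: leq_trans h _; rewrite /a; clear; lia.
have H i : i <= n -> exists r : nat, [/\ iteri i f A1 22 0 = Posz r, 0 < r, r <= i.+1,
    K <= r ^ 2 \/ r = i.+1 & 1 < r -> r.-1 ^ 2 < K].
  elim: i => [_|i IH lt].
    by exists 1; split=> //; [rewrite [iteri _ _ _]/= /A1 sem_set0 evC clip_id // C | right].
  have [r [h22 r0 ri rc rb]] := IH (ltnW lt).
  rewrite [iteri _ _ _]/=; set A' := iteri i f A1 in h22 *.
  have E : ev p (upd V 6 i) A' (rx +^ (rx *^ rx <^ Kx)) = Posz (r + (r ^ 2 < K)).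
    by rewrite evA evL evK /rx evM evG evC /= h22 -PoszM ltz_nat mulnn PoszD.
  exists (r + (r ^ 2 < K)); split.
  - rewrite /f sem_set0 E clip_id // C //.
    by apply: leq_trans (leq_add ri (leq_b1 _)) _; rewrite addn1.
  - by rewrite addn_gt0 r0.
  - by apply: leq_trans (leq_add ri (leq_b1 _)) _; rewrite addn1.
  - case: (ltnP (r ^ 2) K) => h; rewrite ?addn0 ?addn1; last by left.
    by case: rc => [h'|->]; [move: h; rewrite ltnNge h' | right].
  - by case: (ltnP (r ^ 2) K) => h; rewrite ?addn0 ?addn1.
have [r [h22 r0 ri rc rb]] := H n (leqnn n); exists r; split=> //.
  case: rc => // ->; apply: leq_trans (geq_minr _ _) _; rewrite -mulnn; clear; nia.
by move=> K0; apply: sqrt_up_le.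
Qed.

Definition phiZ (Dn : int) (P : nat -> int) : int :=
  (\sum_(c < m) \prod_(u < n) (if cl c u == 0 then Dn else P (u * d + (cl c u).-1)%N))%R.

Definition point_row (Dn : int) (P : nat -> int) u i : nat -> int :=
  fun l => if l %/ d == u then (if l == u * d + i then Dn else 0%R) else P l.

Lemma lt_row u i : u < n -> i < d -> u * d + i < N.
Proof.
move=> un id; apply: leq_trans (_ : u.+1 * d <= _); first by rewrite mulSn addnC ltn_add2r.
by rewrite leq_mul2r un orbT.
Qed.

Lemma row_div u i : i < d -> (u * d + i) %/ d = u.
Proof. by move=> id; rewrite divnMDl // divn_small // addn0. Qed.

(* Conditional expectations: some value of variable u does at least as well as
   the average over its distribution. *)
Lemma greedy_step (Dn : int) (P : nat -> int) u b : u < n -> (0 <= Dn)%R ->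
  (forall l, l < N -> (0 <= P l)%R) -> (\sum_(i < d) P (u * d + i)%N <= Dn)%R ->
  (forall i, i < d -> (phiZ Dn (point_row Dn P u i) <= phiZ Dn (point_row Dn P u b))%R) ->
  (phiZ Dn P <= phiZ Dn (point_row Dn P u b))%R.
Proof.
move=> un D0 P0 Psum best; pose U := Ordinal un.
pose rr (c : 'I_m) := (\prod_(u' < n | u' != U) (if cl c u' == 0 then Dn else P (u' * d + (cl c u').-1)%N))%R.
have rr0 c : (0 <= rr c)%R.
  apply: prodr_ge0 => u' _; case: eqP => // /eqP h; apply: P0; apply: lt_row => //.
  by have := cl_le (ltn_ord c) (ltn_ord u'); move: h; clear; lia.
have E0 : phiZ Dn P = (\sum_(c < m) (if cl c u == 0 then Dn else P (u * d + (cl c u).-1)%N) * rr c)%R.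
  by apply: eq_bigr => c _; rewrite (bigD1 U).
have cd (c : 'I_m) (u' : 'I_n) : cl c u' != 0 -> (cl c u').-1 < d.
  by have := cl_le (ltn_ord c) (ltn_ord u'); clear; lia.
have Ei i : phiZ Dn (point_row Dn P u i) =
    (\sum_(c < m) (if cl c u == 0 then Dn else if (cl c u).-1 == i then Dn else 0) * rr c)%R.
  apply: eq_bigr => c _; rewrite (bigD1 U) //=; congr (_ * _)%R.
    by case: eqP => // /eqP h; rewrite /point_row row_div ?(cd c U) // eqxx eqn_add2l.
  apply: eq_bigr => u' ne; case: eqP => // /eqP h; rewrite /point_row row_div ?(cd c u') // ifN //.
pose r0 := (\sum_(c < m | cl c u == 0) rr c)%R.
pose ri i := (\sum_(c < m | (cl c u != 0) && ((cl c u).-1 == i)) rr c)%R.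
have Gi i : phiZ Dn (point_row Dn P u i) = (Dn * r0 + Dn * ri i)%R.
  rewrite Ei (bigID (fun c : 'I_m => cl c u == 0)) /=; congr (_ + _)%R.
    by rewrite mulr_sumr; apply: eq_bigr => c ->.
  rewrite /ri mulr_sumr big_mkcondr /=; apply: eq_bigr => c /negbTE ->.
  by case: eqP => // _; rewrite mul0r.
have G0 : phiZ Dn P = (Dn * r0 + \sum_(i < d) P (u * d + i)%N * ri i)%R.
  rewrite E0 (bigID (fun c : 'I_m => cl c u == 0)) /=; congr (_ + _)%R.
    by rewrite mulr_sumr; apply: eq_bigr => c ->.
  under [RHS]eq_bigr do rewrite /ri mulr_sumr big_mkcondr /=.
  rewrite exchange_big /=; apply: eq_bigr => c hc; rewrite (negbTE hc).
  rewrite (bigD1 (Ordinal (cd c U hc))) //= eqxx big1 ?addr0 // => i ne.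
  by rewrite ifN // eq_sym.
have ri0 i : (0 <= ri i)%R by apply: sumr_ge0 => c _.
rewrite G0 Gi lerD2l.
have le_b i : i < d -> (Dn * ri i <= Dn * ri b)%R.
  by move=> id; have := best i id; rewrite !Gi lerD2l.
move: D0; rewrite le0r => /orP[/eqP Dz|Dp].
  rewrite Dz mul0r; rewrite Dz in Psum.
  apply: sumr_le0 => i _; have Pi : (P (u * d + i)%N <= 0)%R.
    apply: le_trans Psum; rewrite (bigD1 i) //= lerDl; apply: sumr_ge0 => j _.
    by apply: P0; apply: lt_row.
  by rewrite mulr_le0_ge0.
apply: (@le_trans _ _ (\sum_(i < d) P (u * d + i)%N * ri b)%R).
  apply: ler_sum => i _; apply: ler_wpM2l; first by apply: P0; apply: lt_row.
  by rewrite -(ler_pM2l Dp) le_b.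
by rewrite -mulr_suml ler_wpM2r.
Qed.

Definition satx (x : nat -> nat) c := [forall u : 'I_n, (cl c u == 0) || (cl c u == (x u).+1)].

(** Once every row is a point mass each factor is [Dn] or 0, and the expectation has become a
    count. *)
Lemma phiZ_point (Dn : int) (P : nat -> int) (x : nat -> nat) :
  (forall u i, u < n -> i < d -> P (u * d + i)%N = if i == x u then Dn else 0%R) ->
  phiZ Dn P = (Dn ^+ n * Posz #|[set c : 'I_m | satx x c]|)%R.
Proof.
move=> HP; rewrite -sum1_card (big_morph Posz PoszD (erefl _)) mulr_sumr [RHS]big_mkcond /=.
apply: eq_bigr => c _; rewrite inE mulr1.
have E (u : 'I_n) : (if cl c u == 0 then Dn else P (u * d + (cl c u).-1)%N) =
    (Dn * Posz ((cl c u == 0) || (cl c u == (x u).+1)))%R.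
  have := cl_le (ltn_ord c) (ltn_ord u).
  case: eqP => [_ _|/eqP h hd]; first by rewrite mulr1.
  rewrite HP //; last by move: h hd; clear; lia.
  have -> : ((cl c u).-1 == x u) = (cl c u == (x u).+1) by move: h; clear; lia.
  by case: eqP; rewrite ?mulr1 ?mulr0.
rewrite (eq_bigr _ (fun u _ => E u)) big_split /= prodr_const card_ord.
case: (boolP (satx x c)) => [/forallP h|].
  by rewrite big1 ?mulr1 // => u _; rewrite h.
rewrite negb_forall => /existsP[u /negbTE hu].
by rewrite (bigD1 u) //= hu mul0r mulr0.
Qed.

End Rounding.

(** * The three distributions and the greedy rounding *)

Section Assemble.
Variables (p : conf) (k n d m : nat).
Hypothesis ctx : context p k n d m.
Let N := n * d.
Let a := n + m + 2.
Let a6' : 6 <= a := a6 ctx.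
Let evEc := evE ctx.
Let N0 : 0 < N := N_gt0 ctx.
Let d0 : 0 < d. Proof. exact: ltnW (ctx_d2 ctx). Qed.
Variable cl : nat -> nat -> nat.
Hypothesis cl_le : forall c u, c < m -> u < n -> cl c u <= d.
Let S : int := Posz (2 ^ (a ^ 13)).
Let Mt : int := (160 * S * Posz N)%R.

Section Weights.
Variables (A : nat -> nat -> int) (r : nat) (Q : int) (V : nat -> nat).
Hypothesis A19 : A 19 0 = S.
Hypothesis A22 : A 22 0 = Posz r.
Hypothesis r1' : 0 < r.
Hypothesis rn : r <= n.+1.
Hypothesis yt_le : forall l, l < N -> (`|A 12 l| <= Mt)%R.
Hypothesis lam0 : forall l, l < N -> (0 <= A 9 l)%R.

Let D : int := (8 * Posz d * Mt * Posz r)%R.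
Let Dn : int := (Posz d * D)%R.
Definition ycZ l : int := (Posz d * A 12 l - \sum_(i < d) A 12 (l %/ d * d + i)%N)%R.
Definition heavyZ l : bool := (15 * (\sum_(i < d) A 9 (l %/ d * d + i)%N) < Posz d * A 9 l)%R.
Definition wZ j l : int := if j == 0 then (D + ycZ l)%R else if j == 1 then (D - ycZ l)%R
  else ((1 + 15 * Posz (heavyZ l)) * (4 * Posz d * Mt * Posz r))%R.

Lemma smD0 : sm a 18 D.
Proof.
have sd : sm a 1 (Posz d) by apply: sm_nat => //; rewrite expn1 (d_le ctx).
have sr : sm a 1 (Posz r).
  apply: sm_nat => //; rewrite expn1; apply: leq_trans rn _; rewrite /a; clear; lia.
rewrite /D; apply: (smM a6'); last by apply: sm_le sr.
apply: (smM a6'); last by apply: (@sm_le a a6' 15) => //; apply: smMt ctx.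
apply: (@sm_le a a6' 3) => //; apply: (smM a6'); last by apply: sm_le sd.
apply: sm_nat => //; apply: (@leq_trans (6 ^ 2)) => //; exact: leq_exp2r_weak.
Qed.

Lemma D_ge : (2 * Posz d * Mt <= D)%R.
Proof.
rewrite /D; have -> : (8 * Posz d * Mt * Posz r = 2 * Posz d * Mt * (4 * Posz r))%R by ring.
by apply: ler_peMr; [|move: r1'; clear; lia].
Qed.

Lemma ycZ_le l : l < N -> (`|ycZ l| <= 2 * Posz d * Mt)%R.
Proof.
move=> lN; have un : l %/ d < n by rewrite ltn_divLR.
rewrite /ycZ; apply: le_trans (ler_normB _ _) _.
have -> : (2 * Posz d * Mt = Posz d * Mt + Posz d * Mt)%R by ring.
apply: lerD; first by rewrite normrM ger0_norm // ler_wpM2l // yt_le.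
apply: le_trans (ler_norm_sum _ _ _) _.
have -> : (Posz d * Mt = \sum_(i < d) Mt)%R by rewrite sumr_const card_ord -mulr_natl natz.
by apply: ler_sum => i _; apply: yt_le; apply: lt_row.
Qed.

Lemma wZ_ge0 j l : l < N -> (0 <= wZ j l)%R.
Proof.
move=> lN; have h := ycZ_le lN; have h2 := D_ge; move: (le_trans h h2); rewrite ler_norml => /andP[h3 h4].
by rewrite /wZ; case: eqP => _; [rewrite -lerBlDl sub0r | case: eqP => _; [rewrite subr_ge0|]].
Qed.

(** The two signed perturbations have mass exactly [Dn], as [ycZ] is centred. The boosted one may
    fall short of [Dn], but [greedy_step] asks only for the inequality. *)
Lemma wZ_sum j u : u < n -> (\sum_(i < d) wZ j (u * d + i)%N <= Dn)%R.
Proof.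
move=> un.
have yc0 : (\sum_(i < d) ycZ (u * d + i)%N = 0)%R.
  rewrite /ycZ sumrB -mulr_sumr.
  rewrite [X in (_ - X)%R](eq_bigr (fun=> \sum_(i < d) A 12 (u * d + i)%N)%R) => [|i _]; last first.
    by rewrite (row_div ctx).
  by rewrite sumr_const card_ord -mulr_natl natz subrr.
have DE : (\sum_(i < d) D = Dn)%R by rewrite sumr_const card_ord -mulr_natl natz.
rewrite /wZ; case: eqP => _; first by rewrite big_split /= yc0 addr0 DE.
case: eqP => _; first by rewrite sumrB yc0 subr0 DE.
have e1 : (\sum_(i < d) (1 : int) = Posz d)%R by rewrite sumr_const card_ord natz.
rewrite -mulr_suml big_split /= -mulr_sumr e1.
set L := (\sum_(i < d) A 9 (u * d + i)%N)%R.
pose hv := (\sum_(i < d) Posz (heavyZ (u * d + i)))%R.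
have lamu (i : 'I_d) : (0 <= A 9 (u * d + i)%N)%R by apply: lam0; apply: lt_row.
have L0 : (0 <= L)%R by apply: sumr_ge0.
have hE (i : 'I_d) : heavyZ (u * d + i) = (15 * L < Posz d * A 9 (u * d + i)%N)%R.
  by rewrite /heavyZ (row_div ctx).
(* Markov's inequality within the row; a row sum of 0 leaves no heavy value. *)
have h15 : (15 * hv <= Posz d)%R.
  move: L0; rewrite le0r => /orP[/eqP Lz|Lp].
    have -> : hv = 0%R; last by rewrite mulr0.
    apply: big1 => i _; rewrite hE.
    have : A 9 (u * d + i)%N = 0%R.
      apply/eqP; rewrite eq_le lamu andbT; rewrite -Lz /L (bigD1 i) //= lerDl.
      by apply: sumr_ge0.
    by move=> ->; rewrite Lz !mulr0 ltxx.
  rewrite -(ler_pM2r Lp).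
  have -> : (15 * hv * L = \sum_(i < d) Posz (heavyZ (u * d + i)) * (15 * L))%R.
    by rewrite -mulr_suml -/hv; ring.
  have -> : (Posz d * L = \sum_(i < d) Posz d * A 9 (u * d + i)%N)%R by rewrite /L mulr_sumr.
  apply: ler_sum => i _; rewrite hE; case: ltP => h.
    by rewrite mul1r ltW.
  by rewrite mul0r mulr_ge0.
have q0 : (0 <= 4 * Posz d * Mt * Posz r)%R by [].
apply: (@le_trans _ _ ((Posz d + Posz d) * (4 * Posz d * Mt * Posz r))%R).
  have hh : (Posz d + 15 * hv <= Posz d + Posz d)%R by rewrite lerD2l.
  exact: (ler_wpM2r q0 hh).
by rewrite /Dn /D le_eqVlt; apply/orP; left; apply/eqP; ring.
Qed.

Lemma smyc l : l < N -> sm a 18 (ycZ l).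
Proof.
move=> lN; apply: leq_trans smD0; rewrite -lez_nat !abszE.
by apply: le_trans (ycZ_le lN) _; rewrite (ger0_norm (le_trans _ D_ge)) // D_ge.
Qed.

Lemma capw j l : l < N -> absz (wZ j l) <= cap p.
Proof.
move=> lN; apply: (@smcap _ _ _ _ _ ctx 20) => //.
rewrite /wZ; case: eqP => _.
  by apply: (@sm_le a a6' 19) => //; apply: (smD a6'); [exact: smD0 | exact: smyc].
case: eqP => _.
  by apply: (@sm_le a a6' 19) => //; apply: (smB a6'); [exact: smD0 | exact: smyc].
apply: (smM a6').
  apply: (sm_nat (e := 19)) => //; apply: (@leq_trans (6 ^ 2)).
    by case: (heavyZ l).
  apply: leq_trans (leq_exp2r_weak 2 a6') _; exact: (ale ctx).
apply: (@sm_le a a6' 18) => //; apply: leq_trans smD0; rewrite -lez_nat !abszE !ger0_norm //.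
by rewrite /D; apply: ler_wpM2r => //; apply: ler_wpM2r => //; apply: ler_wpM2r.
Qed.

Lemma weights_ok A1 : A1 = sem p V A (s_w0 ;; s_w1 ;; s_w2) ->
  [/\ forall t, t <> 13 -> A1 t = A t & forall j l, j < 3 -> l < N -> A1 13 (j * N + l) = wZ j l].
Proof.
have EM W A' : A' 19 = A 19 -> ev p W A' Mtx = Mt.
  by move=> h; rewrite /Mtx /Sx !evEc /= h A19.
have Er W A' : A' 22 = A 22 -> ev p W A' rx = Posz r by move=> h; rewrite /rx evG evC /= h.
have ED W A' : A' 19 = A 19 -> A' 22 = A 22 -> ev p W A' Dx = D.
  by move=> h h'; rewrite /Dx 2!evM (EM _ _ h) (Er _ _ h') evM evC (evd ctx).
have Erow t l A' : ev p (upd V 2 l) A' (rowx t) = (\sum_(i < d) A' t (l %/ d * d + i)%N)%R.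
  rewrite /rowx (evSd ctx); apply: eq_bigr => i _.
  by rewrite evG evA evM evQ !evV (evd ctx) flatE /upd /=.
have Eyc l A' : A' 12 = A 12 -> ev p (upd V 2 l) A' ycx = ycZ l.
  by move=> h; rewrite /ycx evB evM Erow evG evV (evd ctx) /upd /= h.
have -> : sem p V A (s_w0 ;; s_w1 ;; s_w2) = sem p V (sem p V (sem p V A s_w0) s_w1) s_w2 by [].
move=> ->.
have [||x1 x2 _] := @sem_fill p V A 2 eN 13 (EV 2) (Dx +^ ycx) N (fun l => 0 * N + l) (wZ 0) (evN ctx V A) (N_nu ctx).
- by move=> i j _ _; rewrite !mul0n !add0n.
- move=> l A' lN [h _ _]; split; [by rewrite evV /upd /= | | exact: capw].
  by rewrite evA ED ?Eyc ?h.
set B1 := sem p V A s_w0; rewrite -/B1 in x1 x2.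
have [||y1 y2 y3] := @sem_fill p V B1 2 eN 13 (eN +^ EV 2) (Dx -^ ycx) N (fun l => 1 * N + l) (wZ 1) (evN ctx V B1) (N_nu ctx).
- by move=> i j _ _ /addnI.
- move=> l A' lN [h _ _]; split; [by rewrite evA evV (evN ctx) /upd /= mul1n | | exact: capw].
  by rewrite evB ED ?Eyc ?h ?x1.
set B2 := sem p V B1 s_w1; rewrite -/B2 in y1 y2 y3.
have [||z1 z2 z3] := @sem_fill p V B2 2 eN 13 (eN +^ eN +^ EV 2)
  ((EC 1 +^ EC 15 *^ (EC 15 *^ rowx 9 <^ ed *^ EG 9 (EV 2))) *^ (EC 4 *^ ed *^ Mtx *^ rx))
  N (fun l => 2 * N + l) (wZ 2) (evN ctx V B2) (N_nu ctx).
- by move=> i j _ _ /addnI.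
- move=> l A' lN [h _ _]; split; [by rewrite !evA evV (evN ctx) /upd /= mul2n addnn | | exact: capw].
  have h' t : t <> 13 -> A' t = A t by move=> ht; rewrite h // y1 // x1.
  have Eq4 : ev p (upd V 2 l) A' (EC 4 *^ ed *^ Mtx *^ rx) = (4 * Posz d * Mt * Posz r)%R.
    by rewrite 2!evM EM ?h' // Er ?h' // evM evC (evd ctx).
  have Eh : ev p (upd V 2 l) A' (EC 15 *^ rowx 9 <^ ed *^ EG 9 (EV 2)) = Posz (heavyZ l).
    by rewrite evL !evM Erow evC evG evV (evd ctx) /upd /= h'.
  by rewrite evM Eq4 evA evM Eh !evC.
split; first by move=> t ht; rewrite z1 // y1 // x1.
have dis i j l l' : i < j -> l < N -> i * N + l <> j * N + l'.
  move=> ij lN e; have : i.+1 * N <= j * N by rewrite leq_mul2r ij orbT.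
  by move: e lN; rewrite mulSn; clear; lia.
move=> [|[|[|j]]] l // _ lN.
- by rewrite z3 ?y3 ?x2 // => i iN; apply: dis.
- by rewrite z3 ?y2 // => i iN; apply: dis.
- exact: z2.
Qed.

End Weights.

Section Greedy.
Variables (A : nat -> nat -> int) (Dn : int) (wz : nat -> nat -> int).
Hypothesis A0 : cl_ok n m cl A.
Hypothesis EDn : forall W A', A' 19 = A 19 -> A' 22 = A 22 -> ev p W A' Dnx = Dn.
Hypothesis Dn0 : (0 <= Dn)%R.
Hypothesis Dncap : absz Dn <= cap p.
Hypothesis wz0 : forall j l, l < N -> (0 <= wz j l)%R.
Hypothesis wzcap : forall j l, l < N -> absz (wz j l) <= cap p.
Hypothesis wzsum : forall j u, u < n -> (\sum_(i < d) wz j (u * d + i)%N <= Dn)%R.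
Hypothesis A13 : forall j l, j < 3 -> l < N -> A 13 (j * N + l) = wz j l.
Let phi := phiZ n d m cl Dn.

Lemma idx_cl W A' c u : A' 0 = A 0 -> c < m -> u < n -> W 1 = c -> W 4 = u ->
  ev p W A' c14 = Posz (cl c u).
Proof. by move=> h cm un h1 h4; rewrite /c14 /clx !evEc flatE h1 h4 h A0. Qed.

Lemma smallcap x : x <= a ^ 2 -> absz (Posz x) <= cap p.
Proof. by move=> h; apply: (@smcap _ _ _ _ _ ctx 2) => //; apply: sm_nat. Qed.

Lemma Ephi W A' je jv : A' 0 = A 0 -> A' 13 = A 13 -> A' 19 = A 19 -> A' 22 = A 22 ->
  (forall c u, ev p (upd (upd W 1 c) 4 u) A' je = Posz jv) -> jv < 3 ->
  ev p W A' (phix je) = phi (wz jv).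
Proof.
move=> e0 e13 e19 e22 ej jv3; rewrite /phix (evSm ctx); apply: eq_bigr => c _.
rewrite (evPn ctx); apply: eq_bigr => u _.
have Ec : ev p (upd (upd W 1 c) 4 u) A' c14 = Posz (cl c u) by apply: idx_cl.
have cd := cl_le (ltn_ord c) (ltn_ord u).
rewrite evA evM ev_eeq evC EDn // evM evB ev_eeq evC evG evA evM ej (evN ctx) evA evM evV (evd ctx) evB evC Ec.
(* For a free variable the index into array 13 is meaningless, since it involves [0 - 1], but that
   entry is multiplied by 0. *)
rewrite eqz_nat; case: eqP => [->|/eqP h]; first by rewrite mul1r subrr mul0r addr0.
rewrite mul0r add0r subr0 mul1r -A13 //; last first.
  by apply: lt_row => //; move: h cd; clear; lia.
rewrite e13 /upd /=; congr (A 13 _); move: h; move: (cl c u) => x; clear.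
by case: x => // x _; rewrite -!PoszM; lia.
Qed.

Lemma s_jb_ok V A1 : A1 = sem p V A s_jb -> exists jb, [/\ A1 23 0 = Posz jb, jb < 3 &
  forall j, j < 3 -> (phi (wz j) <= phi (wz jb))%R].
Proof.
move=> ->; rewrite -[sem p V A s_jb]/(sem p V (sem p V A (SSet 23 (EC 0) (EC 0)))
  (SFor 5 (EC 3) (SSet 23 (EC 0) (jbx +^ (EV 5 -^ jbx) *^ (phix jbx <^ phix (EV 5)))))).
set B := sem p V A _.
have n3 : 3 <= nu p by apply: (le_nu ctx (e := 1)) => //; rewrite expn1; apply: leq_trans a6'.
rewrite (sem_for _ _ (evC p V B 3) n3); set f := fun i A' => sem p (upd V 5 i) A' _.
have C x : x < 3 -> absz (Posz x) <= cap p.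
  move=> h; apply: smallcap; apply: leq_trans (ltnW h) _; apply: (@leq_trans (6 ^ 2)) => //.
  exact: leq_exp2r_weak.
suff H i : i <= 3 -> exists jb, [/\ iteri i f B 23 0 = Posz jb, jb < 3 &
    forall j, j < i -> (phi (wz j) <= phi (wz jb))%R].
  exact: H.
elim: i => [_|i IH lt].
  by exists 0; split=> //; rewrite [iteri _ _ _]/= /B sem_set0 evC clip_id // C.
have [jb [h23 jb3 hb]] := IH (ltnW lt).
have fr t : t <> 23 -> iteri i f B t = A t.
  move=> ht; elim: (i) => [|i' IH'] /=; first by rewrite /B sem_frame // inE; apply/eqP.
  by rewrite /f sem_frame // inE; apply/eqP.
rewrite [iteri _ _ _]/=; set A' := iteri i f B in h23 fr *.
have Ej W : ev p W A' jbx = Posz jb by rewrite /jbx evG evC /= h23.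
have E : ev p (upd V 5 i) A' (jbx +^ (EV 5 -^ jbx) *^ (phix jbx <^ phix (EV 5))) =
   Posz (if (phi (wz jb) < phi (wz i))%R then i else jb).
  have q1 : ev p (upd V 5 i) A' (phix jbx) = phi (wz jb).
    by apply: (@Ephi _ _ _ jb); rewrite ?fr // => c u; exact: Ej.
  have q2 : ev p (upd V 5 i) A' (phix (EV 5)) = phi (wz i).
    by apply: (@Ephi _ _ _ i); rewrite ?fr.
  rewrite evA evM evB evL q1 q2 Ej evV /upd /=.
  by case: ltP => _; rewrite ?mulr1 ?mulr0 ?addr0 // addrC subrK.
exists (if (phi (wz jb) < phi (wz i))%R then i else jb); split.
- by rewrite /f sem_set0 E clip_id // C //; case: ifP.
- by case: ifP.
move=> j; rewrite ltnS leq_eqVlt => /orP[/eqP ->|ji]; first by case: ltP.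
case: ltP => h; [exact: le_trans (hb j ji) (ltW h) | exact: hb].
Qed.

Lemma Egx W A' e i P u : A' 0 = A 0 -> A' 19 = A 19 -> A' 22 = A 22 ->
  (forall l, l < N -> A' 14 l = P l) -> W 0 = u -> u < n -> i < d ->
  (forall c v, ev p (upd (upd W 1 c) 4 v) A' e = Posz i) ->
  ev p W A' (gx e) = phi (point_row d Dn P u i).
Proof.
move=> e0 e19 e22 e14 W0 un id ee; rewrite /gx (evSm ctx); apply: eq_bigr => c _.
rewrite (evPn ctx); apply: eq_bigr => v _.
have Ec : ev p (upd (upd W 1 c) 4 v) A' c14 = Posz (cl c v) by apply: idx_cl.
have cd := cl_le (ltn_ord c) (ltn_ord v).
have V4 : ev p (upd (upd W 1 c) 4 v) A' (EV 4) = Posz v by [].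
have V0 : ev p (upd (upd W 1 c) 4 v) A' (EV 0) = Posz u by rewrite evV /upd /= W0.
have ED := EDn (upd (upd W 1 c) 4 v) e19 e22.
rewrite !(ED, ev_eeq, Ec, V4, V0, ee, evA, evB, evM, evC, evG, evd ctx) !eqz_nat.
case: (cl c v =P 0) => [_|/eqP h]; first by rewrite mul1r subrr mul0r addr0.
have cv : (cl c v).-1 < d by move: h cd; clear; lia.
rewrite mul0r add0r subr0 mul1r /point_row (row_div ctx) //.
case: eqP => [vu|_].
  rewrite vu in h *; rewrite mul1r subrr mul0r addr0 eqn_add2l.
  by case: eqP => q1; case: eqP => q2; rewrite ?mulr1 ?mulr0 //; exfalso; move: q1 q2 h; clear; lia.
rewrite mul0r add0r subr0 mul1r -e14; last exact: lt_row.
congr (A' 14 _); move: h; move: (cl c v) => x; clear.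
by case: x => // x _; rewrite -!PoszM; lia.
Qed.

Record greedy_inv jb u (B : nat -> nat -> int) : Prop := GreedyInv {
  gi_frame : forall t, t <> 14 -> t <> 15 -> t <> 23 -> B t = A t;
  gi_out : forall v, v < u -> exists2 x, x < d & B 15 v = Posz x /\
     forall i, i < d -> B 14 (v * d + i) = (if i == x then Dn else 0%R);
  gi_P0 : forall l, l < N -> (0 <= B 14 l)%R;
  gi_sum : forall v, v < n -> (\sum_(i < d) B 14 (v * d + i)%N <= Dn)%R;
  gi_phi : (phi (wz jb) <= phi (B 14))%R
}.

Lemma phi_ext P P' : (forall l, l < N -> P l = P' l) -> phi P = phi P'.
Proof.
move=> h; apply: eq_bigr => c _; apply: eq_bigr => v _; case: eqP => // /eqP hc.
by apply: h; apply: lt_row => //; have := cl_le (ltn_ord c) (ltn_ord v); move: hc; clear; lia.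
Qed.

Lemma greedy_round jb u V B : u < n -> V 0 = u -> greedy_inv jb u B ->
  greedy_inv jb u.+1 (sem p V B (h1 ;; h2 ;; h3)).
Proof.
move=> un V0 [fr out P0 Psum Pphi].
have -> : sem p V B (h1 ;; h2 ;; h3) = sem p V (sem p V (sem p V B h1) h2) h3 by [].
set B1 := sem p V B h1.
have C x : x < d -> absz (Posz x) <= cap p.
  move=> h; apply: smallcap; apply: leq_trans (ltnW h) _; apply: leq_trans (d_le ctx) _.
  by rewrite -[X in X <= _]expn1; apply: (ale ctx).
pose P := B 14.
have F1 t : t <> 15 -> B1 t = B t by move=> ht; apply: sem_frame; rewrite inE; apply/eqP.
have S15 W A' e v : W 0 = u ->
    sem p W A' (SSet 15 (EV 0) e) 15 v = if v == u then clip (cap p) (ev p W A' e) else A' 15 v.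
  by move=> hW; rewrite /= /upd2 eqxx /= hW.
have [x [xd b2 fr2 oth best]] : exists x, [/\ x < d, sem p V B1 h2 15 u = Posz x,
    forall t, t <> 15 -> sem p V B1 h2 t = B t,
    forall v, v <> u -> sem p V B1 h2 15 v = B 15 v &
    forall i, i < d -> (phi (point_row d Dn P u i) <= phi (point_row d Dn P u x))%R].
  rewrite /h2 (sem_for _ _ (evd ctx V B1) (d_nu ctx)); set f := fun i A' => sem p (upd V 5 i) A' _.
  suff H i : i <= d -> exists x, [/\ x < d, iteri i f B1 15 u = Posz x,
      forall t, t <> 15 -> iteri i f B1 t = B t,
      forall v, v <> u -> iteri i f B1 15 v = B 15 v &
      forall i', i' < i -> (phi (point_row d Dn P u i') <= phi (point_row d Dn P u x))%R].
    exact: H.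
  elim: i => [_|i IH lt].
    exists 0; split=> //; rewrite [iteri _ _ _]/= /B1.
    - by rewrite /h1 S15 // eqxx evC clip_id // C.
    - by move=> v /eqP/negbTE hv; rewrite /h1 S15 // hv.
  have [x [xd bx fx ox hx]] := IH (ltnW lt).
  rewrite [iteri _ _ _]/=; set A' := iteri i f B1 in bx fx ox *.
  have frA t : t <> 14 -> t <> 15 -> t <> 23 -> A' t = A t by move=> *; rewrite fx // fr.
  have Eo W : W 0 = u -> ev p W A' outx = Posz x by move=> hW; rewrite /outx evG evV /= hW.
  have U0 : upd V 5 i 0 = u by [].
  have e14 l : l < N -> A' 14 l = P l by rewrite fx.
  have E : ev p (upd V 5 i) A' (outx +^ (EV 5 -^ outx) *^ (gx outx <^ gx (EV 5))) =
     Posz (if (phi (point_row d Dn P u x) < phi (point_row d Dn P u i))%R then i else x).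
    have q1 : ev p (upd V 5 i) A' (gx outx) = phi (point_row d Dn P u x).
      apply: (@Egx (upd V 5 i) A' outx x P u (frA 0 _ _ _) (frA 19 _ _ _) (frA 22 _ _ _) e14 U0 un xd) => // c v.
      exact: Eo.
    have q2 : ev p (upd V 5 i) A' (gx (EV 5)) = phi (point_row d Dn P u i).
      exact: (@Egx (upd V 5 i) A' (EV 5) i P u (frA 0 _ _ _) (frA 19 _ _ _) (frA 22 _ _ _) e14 U0 un lt).
    rewrite evA evM evB evL q1 q2 Eo // evV /upd /=.
    by case: ltP => _; rewrite ?mulr1 ?mulr0 ?addr0 // addrC subrK.
  exists (if (phi (point_row d Dn P u x) < phi (point_row d Dn P u i))%R then i else x).
  split.
  - by case: ifP.
  - by rewrite /f S15 // eqxx E clip_id // C //; case: ifP.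
  - by move=> t ht; rewrite /f sem_frame ?fx // inE; apply/eqP.
  - by move=> v hv; rewrite /f S15 // (introF eqP hv) ox.
  - move=> i'; rewrite ltnS leq_eqVlt => /orP[/eqP ->|ji]; first by case: ltP.
    case: ltP => h; [exact: le_trans (hx i' ji) (ltW h) | exact: hx].
set B2 := sem p V B1 h2 in b2 fr2 oth.
have [||y1 y2 y3] := @sem_fill p V B2 5 ed 14 (EV 0 *^ ed +^ EV 5) (Dnx *^ eeq (EV 5) outx) d
  (fun i => u * d + i) (fun i => if i == x then Dn else 0%R) (evd ctx V B2) (d_nu ctx).
- by move=> i j _ _ /addnI.
- move=> i A' id [h _ _]; split.
  + by rewrite evA evM !evV (evd ctx) flatE /upd /= V0.
  + have hD : ev p (upd V 5 i) A' Dnx = Dn by apply: EDn; rewrite h // fr2 // fr.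
    have ho : ev p (upd V 5 i) A' outx = Posz x by rewrite /outx evG evV /upd /= V0 h // b2.
    rewrite evM hD ev_eeq evV ho /upd /= eqz_nat.
    by case: eqP => _; rewrite ?mulr1 ?mulr0.
  + by case: eqP.
set B3 := sem p V B2 h3; rewrite -/B3 in y1 y2 y3.
have P3 l : l < N -> B3 14 l = point_row d Dn P u x l.
  move=> lN; rewrite /point_row; case: (l %/ d =P u) => e.
    have lE : l = u * d + l %% d by rewrite -e -divn_eq.
    rewrite {1}lE y2 ?ltn_mod // {2}lE eqn_add2l //.
  rewrite y3 ?fr2 // => i id le; apply: e; by rewrite le (row_div ctx).
split.
- by move=> t h14 h15 h23; rewrite y1 // fr2 // fr.
- move=> v; rewrite ltnS leq_eqVlt => /orP[/eqP ->|vu].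
    by exists x => //; split; [rewrite y1 | exact: y2].
  have [x' x'd [h15 h14]] := out v vu; exists x' => //; split.
    by rewrite y1 // oth // => e; rewrite e ltnn in vu.
  move=> i id; rewrite y3 ?fr2 ?h14 // => i' id' /(flat_inj id id')[e _].
  by rewrite e ltnn in vu.
- by move=> l lN; rewrite P3 // /point_row; case: ifP => // _; [case: ifP | exact: P0].
- move=> v vn; rewrite (eq_bigr (fun i : 'I_d => point_row d Dn P u x (v * d + i))); last first.
    by move=> i _; rewrite P3 //; apply: lt_row.
  rewrite /point_row; case: (v =P u) => [->|ne].
    rewrite (bigD1 (Ordinal xd)) //= (row_div ctx) // !eqxx big1 ?addr0 // => i.
    by rewrite -val_eqE /= => /negbTE ne; rewrite (row_div ctx) // eqxx eqn_add2l ne.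
  rewrite (eq_bigr (fun i : 'I_d => P (v * d + i))); first exact: Psum.
  by move=> i _; rewrite (row_div ctx) // (introF eqP ne).
- rewrite (phi_ext P3); apply: le_trans Pphi _.
  apply: (greedy_step ctx cl_le) => //; exact: Psum.
Qed.

Lemma greedy_ok V A1 : A1 = sem p V A (s_jb ;; s_P ;; s_greedy) ->
  exists x : nat -> nat, [/\ forall u, u < n -> x u < d, forall u, u < n -> A1 15 u = Posz (x u) &
   forall j, j < 3 -> (phi (wz j) <= Dn ^+ n * Posz #|[set c : 'I_m | satx n cl x c]|)%R].
Proof.
move=> ->; have -> : sem p V A (s_jb ;; s_P ;; s_greedy) =
  sem p V (sem p V (sem p V A s_jb) s_P) s_greedy by [].
have [jb [h23 jb3 hb]] := s_jb_ok (erefl (sem p V A s_jb)).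
set B1 := sem p V A s_jb in h23.
have F1 t : t <> 23 -> B1 t = A t by move=> ht; apply: sem_frame; rewrite !inE orbb; apply/eqP.
have [|y1 y2 _] := @sem_fill_id p V B1 2 eN 14 (EG 13 (jbx *^ eN +^ EV 2)) N (wz jb) (evN ctx V B1) (N_nu ctx).
  move=> l A' lN h _; split; last exact: wzcap.
  by rewrite /jbx evG evA evM evG evC evV (evN ctx) /= !h // h23 -PoszM -PoszD /upd /= F1 // A13.
set B2 := sem p V B1 s_P; rewrite -/B2 in y1 y2.
have inv : greedy_inv jb n (sem p V B2 s_greedy).
  rewrite /s_greedy (sem_for _ _ (evn ctx V B2) (n_nu ctx)).
  suff H i : i <= n -> greedy_inv jb i (iteri i (fun i A' => sem p (upd V 0 i) A' (h1 ;; h2 ;; h3)) B2).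
    exact: H.
  elim: i => [_|i IH lt]; last by apply: greedy_round => //; apply: IH; apply: ltnW.
  split=> //.
  - by move=> t h14 h15 hh; rewrite [iteri _ _ _]/= y1 // F1.
  - by move=> l lN; rewrite [iteri _ _ _]/= y2 // wz0.
  - move=> v vn; rewrite [iteri _ _ _]/= (eq_bigr (fun i : 'I_d => wz jb (v * d + i))); first exact: wzsum.
    by move=> i _; rewrite y2 //; apply: lt_row.
  - by rewrite [iteri _ _ _]/= (phi_ext y2).
case: inv => _ out _ _ Pphi; set B3 := sem p V B2 s_greedy in out Pphi *.
exists (fun u => absz (B3 15 u)); split.
- by move=> u un; have [x xd [-> _]] := out u un.
- by move=> u un; have [x xd [-> _]] := out u un.
move=> j j3; apply: le_trans (hb j j3) (le_trans Pphi _).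
rewrite /phi (phiZ_point cl_le (P := B3 14) (x := fun u => absz (B3 15 u))) //.
by move=> u i un id; have [x xd [-> h]] := out u un; rewrite h.
Qed.

End Greedy.
End Assemble.

(** * Parsing the input and the default assignment *)

Lemma nth_flatten_at (ss : seq (seq nat)) c j : c < size ss -> j < size (nth [::] ss c) ->
  nth 0 (flatten ss) (sumn (shape (take c ss)) + j) = nth 0 (nth [::] ss c) j.
Proof.
elim: ss c => // s ss IH [|c] /= h hj; first by rewrite add0n nth_cat hj.
by rewrite nth_cat -addnA ltnNge leq_addr /= addKn IH.
Qed.

Lemma size_pairs n d (s : seq ('I_n * 'I_d)) :
  size (flatten [seq [:: nat_of_ord q.1; nat_of_ord q.2] | q <- s]) = 2 * size s.
Proof. by elim: s => //= q s ->; rewrite mulnS. Qed.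

Lemma nth_pairs n d (s : seq ('I_n * 'I_d)) q0 j : j < size s ->
  nth 0 (flatten [seq [:: nat_of_ord q.1; nat_of_ord q.2] | q <- s]) (2 * j) = (nth q0 s j).1 /\
  nth 0 (flatten [seq [:: nat_of_ord q.1; nat_of_ord q.2] | q <- s]) (2 * j).+1 = (nth q0 s j).2.
Proof.
by elim: s j => // q s IH [|j] h; [split | rewrite mulnS add2n; exact: (IH j h)].
Qed.

Section Parse.
Variables (k n d : nat) (P : csp n d).
Let m := #|clauses P|.
Let a := n + m + 2.

Definition nth_clause c : clause n d := nth set0 (enum (clauses P)) c.
Definition clause_pos c := 4 + \sum_(c' < c) (1 + 2 * #|nth_clause c'|).
(* The value required of variable [u] by clause [c], shifted by one; 0 if [u] is unconstrained. *)
Definition clv c u : nat :=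
  if [pick q : 'I_n * 'I_d | (q \in nth_clause c) && (nat_of_ord q.1 == u)] is Some q
  then (nat_of_ord q.2).+1 else 0.

Lemma nth_clause_in c : c < m -> nth_clause c \in clauses P.
Proof. by move=> h; rewrite -mem_enum mem_nth // -cardE. Qed.

Lemma clv_le c u : clv c u <= d.
Proof. by rewrite /clv; case: pickP => [q _|_] //; exact: ltn_ord. Qed.

Lemma clv_pair c q : c < m -> q \in nth_clause c -> clv c q.1 = (nat_of_ord q.2).+1.
Proof.
move=> cm hq; rewrite /clv; case: pickP => [q' /andP[h /eqP e]|h']; last first.
  by have := h' q; rewrite hq eqxx.
have e' : q'.1 = q.1 := val_inj e.
case: q' q h e' hq {e} => [u' i'] [u i] /= h e' hq; rewrite e' in h.
by rewrite (clauses_consistent (nth_clause_in cm) h hq).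
Qed.

Lemma clv_ex c u : clv c u != 0 -> exists2 q, q \in nth_clause c & nat_of_ord q.1 = u.
Proof. by rewrite /clv; case: pickP => // q /andP[h /eqP e] _; exists q. Qed.

Lemma clv0 c u : (forall q, q \in nth_clause c -> nat_of_ord q.1 <> u) -> clv c u = 0.
Proof. by move=> H; apply/eqP/negPn/negP => /clv_ex[q /H]. Qed.

Lemma sum_clv_le c : c < m -> \sum_(u < n) (clv c u != 0) <= #|nth_clause c|.
Proof.
move=> cm; have -> : \sum_(u < n) (clv c u != 0) = #|[set u : 'I_n | clv c u != 0]|.
  by rewrite -sum1dep_card [RHS]big_mkcond /=; apply: eq_bigr => u _; case: (clv c u != 0).
apply: leq_trans (leq_imset_card (fun q : 'I_n * 'I_d => q.1) (mem (nth_clause c))).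
apply: subset_leq_card; apply/subsetP => u; rewrite inE => /clv_ex[q hq e].
by apply/imsetP; exists q => //; apply: val_inj.
Qed.

Lemma satisfies_clv (x : assignment n d) (xf : nat -> nat) c : c < m ->
  (forall u : 'I_n, xf u = x u) -> satisfies x (nth_clause c) = satx n clv xf c.
Proof.
move=> cm e; rewrite /satx; apply/forallP/forallP => [h u|h q].
  case: (clv c u =P 0) => //= /eqP /clv_ex[q hq qu].
  have := h q; rewrite hq /= => /eqP xq; have <- : q.1 = u := val_inj qu.
  by rewrite (clv_pair cm hq) e xq.
apply/implyP => hq; have := h q.1; rewrite (clv_pair cm hq) /= eqSS e => /eqP qe.
by apply/eqP/val_inj; exact: esym qe.
Qed.

Lemma value_clv (x : assignment n d) (xf : nat -> nat) : (forall u : 'I_n, xf u = x u) ->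
  value P x = #|[set c : 'I_m | satx n clv xf c]|.
Proof.
move=> e; rewrite /value.
have -> : [set C in clauses P | satisfies x C] =
    [set enum_val c | c in [set c : 'I_m | satisfies x (nth_clause c)]].
  apply/setP=> C; apply/setIdP/imsetP => [[hC hs]|[c]].
    by exists (enum_rank_in hC C); rewrite ?inE /nth_clause -?(enum_val_nth set0) enum_rankK_in.
  by rewrite inE /nth_clause -(enum_val_nth set0) => h ->; split=> //; apply: enum_valP.
rewrite card_imset; last exact: enum_val_inj.
by apply: eq_card => c; rewrite !inE (satisfies_clv (ltn_ord c) e).
Qed.

Lemma size_encode_clause' (C : clause n d) : size (encode_clause C) = 1 + 2 * #|C|.
Proof. by rewrite /encode_clause /= size_pairs -cardE add1n. Qed.

Lemma clause_posE c : c <= m ->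
  clause_pos c = 4 + sumn (shape (take c [seq encode_clause C | C <- enum (clauses P)])).
Proof.
rewrite /clause_pos => cm; congr (4 + _).
elim: c cm => [_|c IH cm]; first by rewrite big_ord0 take0.
rewrite big_ord_recr /= IH ?(ltnW cm) //.
rewrite (take_nth [::]) ?size_map -?cardE // /shape map_rcons sumn_rcons -/(shape _).
by rewrite (nth_map set0) -?cardE // size_encode_clause'.
Qed.

Lemma read_clause c : c < m -> nth 0 (encode k P) (clause_pos c) = #|nth_clause c| /\
  forall q0 j, j < #|nth_clause c| ->
   nth 0 (encode k P) (clause_pos c + 1 + 2 * j) = (nth q0 (enum (nth_clause c)) j).1 /\
   nth 0 (encode k P) (clause_pos c + 2 + 2 * j) = (nth q0 (enum (nth_clause c)) j).2.
Proof.
move=> cm; rewrite (clause_posE (ltnW cm)); set ss := [seq _ | _ <- _].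
have E x : nth 0 (encode k P) (4 + sumn (shape (take c ss)) + x) =
    nth 0 (flatten ss) (sumn (shape (take c ss)) + x) by rewrite -addnA.
have cs : c < size ss by rewrite size_map -cardE.
have ns : nth [::] ss c = encode_clause (nth_clause c) by rewrite (nth_map set0) -?cardE.
have F x : x <= 2 * #|nth_clause c| -> nth 0 (encode k P) (4 + sumn (shape (take c ss)) + x) =
    nth 0 (encode_clause (nth_clause c)) x.
  by move=> h; rewrite E nth_flatten_at // ns // size_encode_clause' add1n ltnS.
split; first by rewrite -[X in nth 0 _ X]addn0 F.
move=> q0 j jC; have js : j < size (enum (nth_clause c)) by rewrite -cardE.
have [e1 e2] := nth_pairs q0 js.
have j2 : 2 + 2 * j <= 2 * #|nth_clause c| by move: jC; move: #|nth_clause c| => z; clear; lia.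
have j1 : 1 + 2 * j <= 2 * #|nth_clause c| by apply: leq_trans j2; rewrite leq_add2r.
by split; [rewrite -addnA (F _ j1) add1n; exact: e1 | rewrite -addnA (F _ j2) add2n; exact: e2].
Qed.

Lemma clause_pos_le c : c <= m -> clause_pos c <= a ^ 2.
Proof.
move=> cm; have : clause_pos c <= 4 + m * (1 + 2 * n).
  rewrite /clause_pos leq_add2l; apply: (@leq_trans (\sum_(c' < c) (1 + 2 * n))).
    apply: leq_sum => c' _; rewrite leq_add2l leq_mul2l /=.
    by apply: (card_clause_le (P := P)); apply: nth_clause_in; apply: leq_trans cm.
  by rewrite sum_nat_const card_ord leq_mul2r cm orbT.
by move=> h; apply: leq_trans h _; rewrite /a -mulnn; clear; nia.
Qed.

Section Run.
Variable p : conf.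
Hypothesis p_inp : inp p = encode k P.
Hypothesis p_nu : nu p = a ^ 30.
Hypothesis p_cap : cap p = d.+1 * 2 ^ (a ^ 30).

Lemma a2_nu x : x <= a ^ 2 -> x <= nu p.
Proof. by move=> h; rewrite p_nu; apply: leq_trans h _; rewrite leq_pexp2l // /a addn2. Qed.
Lemma nu_cap x : x <= nu p -> x <= cap p.
Proof.
rewrite p_nu p_cap => h; apply: leq_trans h _; apply: leq_trans (ltnW (ltn_expl _ (ltnSn 1))) _.
exact: leq_pmull.
Qed.
Lemma d_cap x : x <= d -> x <= cap p.
Proof. by move=> h; rewrite p_cap; apply: leq_trans h _; rewrite -[X in X <= _]muln1 leq_mul // expn_gt0. Qed.
Lemma a_nu x : x <= a -> x <= nu p.
Proof. by move=> h; apply: a2_nu; apply: leq_trans h _; rewrite -mulnn leq_pmulr // /a addn2. Qed.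

Lemma evI V A e : ev p V A (EI e) = Posz (nth 0 (encode k P) (absz (ev p V A e))).
Proof. by rewrite -p_inp. Qed.

(** Cells of free variables are never written, so [pi_todo] is what makes them 0 once their clause
    has been read. *)
Record parse_inv c (A : nat -> nat -> int) : Prop := ParseInv {
  pi_pos : A 24 0 = Posz (clause_pos c);
  pi_done : forall c' u, c' < c -> u < n -> A 0 (c' * n + u) = Posz (clv c' u);
  pi_todo : forall c' u, c <= c' -> u < n -> A 0 (c' * n + u) = 0%R
}.

Lemma parse_step V A c : c < m -> V 1 = c -> parse_inv c A ->
  parse_inv c.+1 (sem p V A (
    SSet 25 (EC 0) (EI posx) ;;
    SFor 5 szx (SSet 0 (EV 1 *^ en +^ EI (posx +^ EC 1 +^ EC 2 *^ EV 5))
                       (EI (posx +^ EC 2 +^ EC 2 *^ EV 5) +^ EC 1)) ;;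
    SSet 24 (EC 0) (posx +^ EC 1 +^ EC 2 *^ szx))).
Proof.
move=> cm V1 [ipos idone itodo]; have [rd0 rd] := read_clause cm.
set C := nth_clause c in rd0 rd *.
have Cn : #|C| <= n by apply: (card_clause_le (P := P)); apply: nth_clause_in.
rewrite -[sem p V A _]/(sem p V (sem p V (sem p V A (SSet 25 (EC 0) (EI posx)))
   (SFor 5 szx (SSet 0 (EV 1 *^ en +^ EI (posx +^ EC 1 +^ EC 2 *^ EV 5))
                       (EI (posx +^ EC 2 +^ EC 2 *^ EV 5) +^ EC 1))))
   (SSet 24 (EC 0) (posx +^ EC 1 +^ EC 2 *^ szx))).
set A1 := sem p V A _.
have Cnu : #|C| <= nu p by apply: a_nu; apply: leq_trans Cn _; rewrite /a -addnA leq_addr.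
have h25 : A1 25 0 = Posz #|C|.
  have Ep0 : ev p V A posx = Posz (clause_pos c) by rewrite /posx evG evC /=.
  by rewrite /A1 sem_set0 evI Ep0 absz_nat rd0 clip_id //; apply: nu_cap.
have h0 : A1 0 = A 0 by apply: sem_frame.
have h24 : A1 24 0 = Posz (clause_pos c) by rewrite /A1 (@sem_frame p V A _ 24).
have Eb : ev p V A1 szx = Posz #|C| by rewrite /szx evG evC /= h25.
pose e0 : seq ('I_n * 'I_d) := enum C.
(* [onth] gives total functions without a default pair, which need not exist when [n] or [d] is
   0. *)
pose fst_ j := if onth e0 j is Some q then nat_of_ord q.1 else 0.
pose snd_ j := if onth e0 j is Some q then nat_of_ord q.2 else 0.
have nthE j : j < #|C| -> exists2 q, q \in C & [/\ forall q0, nth q0 e0 j = q, fst_ j = q.1 & snd_ j = q.2].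
  move=> jC; have js : j < size e0 by rewrite -cardE.
  have [q1 _] : exists q1 : 'I_n * 'I_d, true by move: js; case: (e0) => // q1 s _; exists q1.
  exists (nth q1 e0 j); first by rewrite -mem_enum mem_nth.
  have oE : onth e0 j = Some (nth q1 e0 j) by rewrite (onthE e0 j) (nth_map q1).
  by split; [move=> q0; apply: set_nth_default | rewrite /fst_ oE | rewrite /snd_ oE].
have [||y1 y2 y3] := @sem_fill p V A1 5 szx 0 (EV 1 *^ en +^ EI (posx +^ EC 1 +^ EC 2 *^ EV 5))
   (EI (posx +^ EC 2 +^ EC 2 *^ EV 5) +^ EC 1) #|C| (fun j => c * n + fst_ j)
   (fun j => Posz (snd_ j).+1) Eb Cnu.
(* The cells written for one clause are distinct because consistency lets a variable occur in only
   one of its pairs. *)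
- move=> i j iC jC /addnI; have [q qC [qn qf _]] := nthE i iC; have [q' q'C [qn' qf' _]] := nthE j jC.
  rewrite qf qf' => /val_inj qq.
  have qE : q = q'.
    case: q q' qC q'C qq {qn qf qn' qf'} => [u i1] [u' i2] /= qC q'C uu; rewrite -uu in q'C *.
    by rewrite (clauses_consistent (nth_clause_in cm) qC q'C).
  apply/eqP; rewrite -(@nth_uniq _ q e0) ?enum_uniq -?cardE //.
  by rewrite qn qn' qE.
- move=> j A' jC [f1 _ _]; have [q qC [qn qf qs]] := nthE j jC; have [r1 r2] := rd q j jC.
  rewrite -/e0 qn in r1 r2.
  have Ep W : ev p W A' posx = Posz (clause_pos c) by rewrite /posx evG evC /= f1.
  have en' W : ev p W A' en = Posz n by rewrite /en evI.
  pose W := upd V 5 j.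
  have V5 : W 5 = j by [].
  have V1' : W 1 = c by rewrite /W /upd /= V1.
  have E1 : ev p W A' (EI (posx +^ EC 1 +^ EC 2 *^ EV 5)) = Posz (fst_ j).
    rewrite evI (_ : ev p W A' (posx +^ EC 1 +^ EC 2 *^ EV 5) = Posz (clause_pos c + 1 + 2 * j)).
      by rewrite absz_nat r1 qf.
    by rewrite 2!evA evM Ep !evC evV V5 -PoszM -!PoszD.
  have E2 : ev p W A' (EI (posx +^ EC 2 +^ EC 2 *^ EV 5)) = Posz (snd_ j).
    rewrite evI (_ : ev p W A' (posx +^ EC 2 +^ EC 2 *^ EV 5) = Posz (clause_pos c + 2 + 2 * j)).
      by rewrite absz_nat r2 qs.
    by rewrite 2!evA evM Ep !evC evV V5 -PoszM -!PoszD.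
  split.
  + by rewrite -/W evA evM E1 evV V1' en' flatE.
  + by rewrite -/W evA E2 evC -PoszD addn1.
  + by rewrite /=; apply: d_cap; rewrite qs.
set A2 := sem p V A1 _; rewrite -/A2 in y1 y2 y3.
have z0 : sem p V A2 (SSet 24 (EC 0) (posx +^ EC 1 +^ EC 2 *^ szx)) 0 = A2 0 by apply: sem_frame.
split.
- have Ep2 : ev p V A2 posx = Posz (clause_pos c) by rewrite /posx evG evC /= y1.
  have Ez : ev p V A2 szx = Posz #|C| by rewrite /szx evG evC /= y1.
  rewrite sem_set0 2!evA evM Ep2 Ez !evC -PoszM -!PoszD.
  have -> : clause_pos c + 1 + 2 * #|C| = clause_pos c.+1.
    by rewrite /clause_pos big_ord_recr /= -/C -!addnA.
  by rewrite clip_id //; apply: nu_cap; apply: a2_nu; apply: clause_pos_le.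
- move=> c' u; rewrite z0 ltnS leq_eqVlt => /orP[/eqP ->|lt] un; last first.
    rewrite y3 ?h0 ?idone // => j jC; have [q _ [_ -> _]] := nthE j jC.
    by move=> /(flat_inj un (ltn_ord _))[e _]; rewrite e ltnn in lt.
  case: (eqVneq (clv c u) 0) => [e|/clv_ex[q qC qu]].
    rewrite e y3 ?h0 ?itodo // => j jC; have [q qC [_ -> _]] := nthE j jC.
    move=> /(flat_inj un (ltn_ord _))[_ uq]; move: e; rewrite uq (clv_pair cm qC).
    by [].
  have jC : index q e0 < #|C| by rewrite cardE index_mem mem_enum.
  have [q' _ [qn qf qs]] := nthE _ jC; have qq : q' = q by rewrite -(qn q) nth_index // mem_enum.
  by have := y2 _ jC; rewrite qf qs qq qu => ->; rewrite -qu (clv_pair cm qC).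
- move=> c' u cc un; rewrite z0 y3 ?h0 ?itodo ?(ltnW cc) // => j jC.
  have [q _ [_ -> _]] := nthE j jC.
  by move=> /(flat_inj un (ltn_ord _))[e _]; rewrite e ltnn in cc.
Qed.

Lemma parse_ok V : parse_inv m (sem p V (fun _ _ => 0%R) s_parse).
Proof.
rewrite /s_parse; set body := (X in SFor 1 em X).
pose A := sem p V (fun _ _ => 0%R) (SSet 24 (EC 0) (EC 4)).
rewrite -[sem p V _ _]/(sem p V A (SFor 1 em body)).
have Em : ev p V A em = Posz m by rewrite /em evI.
have mn : m <= nu p by apply: a_nu; rewrite /a; clear; lia.
rewrite (sem_for _ _ Em mn); set f := fun i A' => _.
suff H i : i <= m -> parse_inv i (iteri i f A) by exact: H.
elim: i => [_|i IH lt]; last exact: (@parse_step (upd V 1 i) _ i lt (erefl _) (IH (ltnW lt))).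
split=> //.
rewrite [iteri _ _ _]/= /A sem_set0 evC clip_id ?/clause_pos ?big_ord0 //=.
by apply: nu_cap; apply: a2_nu; rewrite /a addn2 -mulnn; clear; nia.
Qed.

(** Subtracting the bit [0 < v] is a truncated predecessor: the output is the value that clause 0
    requires, and 0 for its free variables. *)
Lemma default_ok V A1 : A1 = sem p V (sem p V (fun _ _ => 0%R) s_parse) s_default ->
  [/\ cl_ok n m clv A1, forall t, t \notin [:: 0; 15; 24; 25] -> A1 t = fun=> 0%R
    & forall u, u < n -> A1 15 u = Posz (clv 0 u).-1].
Proof.
move=> ->; have [_ dn td] := parse_ok V; set B := sem p V _ s_parse in dn td *.
have En : ev p V B en = Posz n by rewrite /en evI.
have nn : n <= nu p by apply: a_nu; rewrite /a -addnA leq_addr.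
have B0 u : u < n -> B 0 u = Posz (clv 0 u).
  move=> un; case: (posnP m) => [m0|m0]; last exact: (dn 0 u).
  rewrite (_ : clv 0 u = 0); first by apply: (td 0 u) => //; rewrite m0.
  by apply: clv0 => q; rewrite /nth_clause nth_default -?cardE -/m ?m0 // inE.
have [|y1 y2 _] := @sem_fill_id p V B 2 en 15 (EG 0 (EV 2) -^ (EC 0 <^ EG 0 (EV 2))) n
  (fun u => Posz (clv 0 u).-1) En nn.
  move=> u A' un h _; split; last by rewrite /=; apply: d_cap; apply: leq_trans (leq_pred _) (clv_le _ _).
  rewrite evB evL evG evV evC /= /upd /= h // B0 // ltz_nat.
  by case: (clv 0 u) => // v; rewrite /=; lia.
split.
- by move=> c u cm un; rewrite y1 // dn.
- move=> t; rewrite !inE !negb_or => /and4P[h0 h15 h24 h25].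
  by rewrite y1 ?/B ?sem_frame //; [rewrite !inE !negb_or h24 h25 h0 | apply/eqP].
- exact: y2.
Qed.

End Run.
End Parse.

Lemma sem_seq p V A c1 c2 : sem p V A (c1 ;; c2) = sem p V (sem p V A c1) c2.
Proof. by []. Qed.

(** * A complete run of the main branch *)

Section Main.
Variables (p : conf) (k n d m : nat).
Hypothesis ctx : context p k n d m.
Variable cl : nat -> nat -> nat.
Hypothesis cl_le : forall c u, c < m -> u < n -> cl c u <= d.
Let N := n * d.
Let a := n + m + 2.
Let d0 : 0 < d. Proof. exact: ltnW (ctx_d2 ctx). Qed.
Let S : int := Posz (2 ^ (a ^ 13)).

Definition Bz c l : int :=
  (Posz d * Posz (cl c (l %/ d) == (l %% d).+1) - Posz (cl c (l %/ d) != 0))%R.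
Definition DnZ r : int := (Posz d * (8 * Posz d * (160 * S * Posz N) * Posz r))%R.

Lemma Bz_le c l : absz (Bz c l) <= d.
Proof.
have d2 := ctx_d2 ctx; rewrite /Bz.
by case: (cl c (l %/ d) == (l %% d).+1); case: (cl c (l %/ d) == 0);
  rewrite /= ?mulr1 ?mulr0; move: d2; clear; lia.
Qed.

Lemma s_B_ok V A : cl_ok n m cl A -> B_ok n d m Bz (sem p V A s_B).
Proof.
move=> h0; have [|_ y _] := @sem_fill2 p V A 1 2 em eN 1 (EV 1 *^ eN +^ EV 2)
  (ed *^ eeq (clx (EV 1) (EV 2 /^ ed)) (EV 2 -^ ed *^ (EV 2 /^ ed) +^ EC 1)
     -^ (EC 0 <^ clx (EV 1) (EV 2 /^ ed))) 0 m N Bz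
  (evm ctx V A) (m_nu ctx) (fun W A' => evN ctx W A') (N_nu ctx); last first.
  by move=> c l cm lN; have := y c l cm lN; rewrite add0n.
move=> c l A' cm lN f1 _; pose W := upd (upd V 1 c) 2 l.
have V1 : W 1 = c by [].
have V2 : W 2 = l by [].
have un : l %/ d < n by rewrite ltn_divLR.
have Ec : ev p W A' (clx (EV 1) (EV 2 /^ ed)) = Posz (cl c (l %/ d)).
  by rewrite /clx evG evA evM evQ !evV (evn ctx) (evd ctx) V1 V2 flatE f1 // h0.
have El : ev p W A' (EV 2 -^ ed *^ (EV 2 /^ ed) +^ EC 1) = Posz (l %% d).+1.
  rewrite evA evB evM evQ !evV (evd ctx) V2 evC !absz_nat.
  have := divn_eq l d; move: (l %/ d) (l %% d) => q r ->; clear; lia.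
rewrite -/W; split.
- by rewrite evA evM !evV (evN ctx) V1 V2 flatE add0n.
- by rewrite evB evM ev_eeq evL evC Ec El (evd ctx) eqz_nat ltz_nat lt0n.
- apply: (@smcap _ _ _ _ _ ctx 1) => //; apply: leq_trans (Bz_le c l) _; rewrite expn1.
  by apply: leq_trans (d_le ctx) _; apply/ltnW/ltn_expl.
Qed.

Lemma s_W0_ok V A l : l < N -> sem p V A s_W0 2 l = 1%R.
Proof.
have [|_ y _] := @sem_fill_id p V A 2 eN 2 (EC 1) N (fun=> 1%R) (evN ctx V A) (N_nu ctx); last exact: y.
by move=> i A' iN _ _; split=> //; apply: (@smcap _ _ _ _ _ ctx 1) => //; apply: sm_small.
Qed.

Lemma main_run (R : realType) V A : cl_ok n m cl A ->
  (forall t, t \notin [:: 0; 15; 24; 25] -> A t = fun=> 0%R) ->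
  exists (x : nat -> nat) (A6 : nat -> nat -> int) (r : nat) (Q : int),
  [/\ forall u, u < n -> x u < d, forall u, u < n -> sem p V A s_main 15 u = Posz (x u),
      flat_res n d m Bz A6 Q, minn k n <= r ^ 2 /\ (0 < minn k n -> r ^ 2 <= 4 * minn k n)
    & forall j, j < 3 -> (phiZ n d m cl (DnZ r) (wZ n d m A6 r j)
         <= DnZ r ^+ n * Posz #|[set c : 'I_m | satx n cl x c]|)%R].
Proof.
move=> hcl hz.
pose A1 := sem p V A s_B; pose A2 := sem p V A1 s_S; pose A3 := sem p V A2 s_W0.
pose A4 := sem p V A3 s_MW; pose A5 := sem p V A4 (s_sign ;; s_yt); pose A6 := sem p V A5 s_r.
pose A7 := sem p V A6 (s_w0 ;; s_w1 ;; s_w2).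
have -> : sem p V A s_main = sem p V A7 (s_jb ;; s_P ;; s_greedy) by [].
have b3 : B_ok n d m Bz A3.
  have f31 : A3 1 = A1 1 by rewrite /A3 (@sem_frame p V A2 s_W0 1) // /A2 (@sem_frame p V A1 s_S 1).
  by rewrite /B_ok f31; apply: s_B_ok.
have s3 : A3 19 0 = S by rewrite /A3 (@sem_frame p V A2 s_W0 19) // /A2 (s_S_ok ctx).
have z3 : A3 9 = A 9 by apply: (@sem_frame p V A (s_B ;; s_S ;; s_W0) 9).
have l3 l : A3 9 l = 0%R by rewrite z3 hz.
have inv : mw_inv R n d m Bz (N * N) A4.
  by apply: (mw_loop R ctx) => // [c l _ _|l]; [exact: Bz_le | exact: s_W0_ok].
have y10 l : A4 10 l = 0%R.
  have et : A4 10 = A 10 by exact: (@sem_frame p V A (s_B ;; s_S ;; s_W0 ;; s_MW) 10).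
  by rewrite et hz.
have y11 l : A4 11 l = 0%R.
  have et : A4 11 = A 11 by exact: (@sem_frame p V A (s_B ;; s_S ;; s_W0 ;; s_MW) 11).
  by rewrite et hz.
have := flat_ok ctx V inv y10 y11; rewrite -/A5; set Q := Qs _ _ _ _ _ _ => fl.
have [r [r22 r0 rn rK rK4]] := s_r_ok ctx V A5; rewrite -/A6 in r22.
have e t : t <> 22 -> A6 t = A5 t by move=> ht; apply: sem_frame; rewrite !inE orbb; apply/eqP.
have fl6 : flat_res n d m Bz A6 Q.
  by case: fl => f1 f2 f3 f4 f5 f6 f7; split; rewrite ?(e 19) ?(e 9) ?(e 12) // /B_ok (e 1).
have yt6 := fl_yt fl6; have lam6 := fl_lam fl6; have s6 := fl_S fl6.
have [f7 w7] := weights_ok ctx s6 r22 r0 rn yt6 (erefl (sem p V A6 (s_w0 ;; s_w1 ;; s_w2))).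
rewrite -/A7 in f7 w7.
have cl7 : cl_ok n m cl A7.
  have e0 : A7 0 = A 0.
    exact: (@sem_frame p V A (s_B ;; s_S ;; s_W0 ;; s_MW ;; (s_sign ;; s_yt) ;; s_r ;; (s_w0 ;; s_w1 ;; s_w2)) 0).
  by move=> c u cm un; rewrite e0; apply: hcl.
have EDn W A' : A' 19 = A7 19 -> A' 22 = A7 22 -> ev p W A' Dnx = DnZ r.
  move=> h19 h22; have E19 : ev p W A' Sx = S by rewrite /Sx evG evC /= h19 f7.
  have E22 : ev p W A' rx = Posz r by rewrite /rx evG evC /= h22 f7.
  have EM : ev p W A' Mtx = (160 * S * Posz N)%R by rewrite /Mtx evM (evN ctx) evM E19 evC.
  by rewrite /Dnx evM (evd ctx) /Dx 2!evM EM E22 evM evC (evd ctx).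
have D0 : (0 <= DnZ r)%R by [].
have Dcap : absz (DnZ r) <= cap p.
  have sd : sm a 18 (Posz d).
    by apply: sm_nat => //; apply: leq_trans (d_le ctx) _; rewrite -[X in X <= _]expn1; apply: (ale ctx).
  exact: (@smcap _ _ _ _ _ ctx 19 _ isT (smM (a6 ctx) sd (smD0 ctx rn))).
have wsum j u : u < n -> (\sum_(i < d) wZ n d m A6 r j (u * d + i)%N <= DnZ r)%R.
  by move=> un; apply: (wZ_sum ctx) => //; exact: lam6.
have [x [xd xo xphi]] := greedy_ok ctx cl_le cl7 EDn D0 Dcap
  (fun j l lN => wZ_ge0 ctx r0 yt6 j lN) (fun j l lN => capw ctx r0 rn yt6 j lN) wsum w7
  (erefl (sem p V A7 (s_jb ;; s_P ;; s_greedy))).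
by exists x, A6, r, Q; split.
Qed.

(** * Transfer of the integer results to the real gains *)

Section RealBound.
Variables (R : realType) (A : nat -> nat -> int) (r : nat) (Q : int).
Hypothesis fl : flat_res n d m Bz A Q.
Let yt l : R := ((A 12 l)%:~R)%R.
Let lam l : R := ((A 9 l)%:~R)%R.
Let SR : R := ((2 ^ (a ^ 13))%N%:R)%R.
Let MR : R := (160 * SR * N%:R)%R.

Lemma qfR (z : nat -> int) : ((qf m N Bz z)%:~R =
  \sum_(c < m) (\sum_(l < N) Bf R d cl c l * (z l)%:~R) ^+ 2 :> R)%R.
Proof.
rewrite /qf rmorph_sum /=; apply: eq_bigr => c _; rewrite rmorphXn rmorph_sum /=.
by congr (_ ^+ 2)%R; apply: eq_bigr => l _; rewrite rmorphM /= /Bz rmorphB rmorphM.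
Qed.

Lemma MtR : ((160 * S * Posz N)%:~R = MR)%R.
Proof. by rewrite /MR /SR !intrM rmorph_nat -!pmulrn. Qed.
Lemma DR : ((8 * Posz d * (160 * S * Posz N) * Posz r)%:~R = 8 * d%:R * MR * r%:R)%R.
Proof. by rewrite 2!intrM MtR intrM rmorph_nat -!pmulrn. Qed.
Lemma DnR : ((DnZ r)%:~R = 8 * d%:R ^+ 2 * MR * r%:R :> R)%R.
Proof. by rewrite /DnZ intrM DR -pmulrn expr2; ring. Qed.
Lemma ycR l : ((ycZ d A l)%:~R = yc d yt l)%R.
Proof. by rewrite /ycZ rmorphB rmorphM rmorph_sum. Qed.
Lemma heavyR l : heavyZ d A l = heavy d lam l.
Proof.
by rewrite /heavyZ -(ltr_int R) !rmorphM rmorph_sum rmorph_nat.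
Qed.

Lemma ytR l : l < N -> (`|yt l| <= MR)%R.
Proof. by move=> lN; rewrite -MtR -intr_norm ler_int; apply: (fl_yt fl). Qed.
Lemma lamR0 l : l < N -> (0 <= lam l)%R.
Proof. by move=> lN; rewrite ler0z; apply: (fl_lam fl). Qed.
Lemma lamRQ : (\sum_(l < N) lam l <= 2 * N%:R * Q%:~R)%R.
Proof.
have := fl_lamQ fl; rewrite -(ler_int R) rmorph_sum !rmorphM rmorph_nat; exact.
Qed.
Lemma QR : (Q%:~R <= 4 * \sum_(c < m) (\sum_(l < N) Bf R d cl c l * yt l) ^+ 2)%R.
Proof. by have := fl_Q fl; rewrite -(ler_int R) intrM qfR rmorph_nat. Qed.
(** For a vector of zeros and ones the square on the dual side disappears. *)
Lemma dualR (z : nat -> bool) :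
  ((\sum_(c < m) (\sum_(l < N) Bf R d cl c l * (z l)%:R) ^+ 2) * (N%:R ^+ 3 * SR ^+ 2)
  <= 16 * \sum_(l < N) lam l * (z l)%:R)%R.
Proof.
have h : (qf m N Bz (fun l => Posz (z l)) * (Posz N ^+ 3 * S ^+ 2)
  <= 16 * \sum_(l < N) A 9 l * Posz (z l) ^+ 2)%R := fl_dual fl _.
have e1 : ((Posz N ^+ 3 * S ^+ 2)%:~R = N%:R ^+ 3 * SR ^+ 2 :> R)%R by rewrite rmorphM !rmorphXn.
have e2 : ((16 * \sum_(l < N) A 9 l * Posz (z l) ^+ 2)%:~R = 16 * \sum_(l < N) lam l * (z l)%:R :> R)%R.
  rewrite rmorphM rmorph_nat rmorph_sum; congr (_ * _)%R; apply: eq_bigr => l _.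
  by rewrite rmorphM /=; case: (z l).
by move: h; rewrite -(ler_int R) intrM e1 qfR e2.
Qed.

(** [gain] bounds one of the three expectations from below, and [M] dominates each of them after
    division by [Dn ^ n]; it does not matter which one is the good one. *)
Lemma gain_int K x0 M : 0 < K -> K <= r ^ 2 -> r ^ 2 <= 4 * K ->
  (forall c, c < m -> \sum_(u < n) (cl c u != 0) <= K) -> (forall u, u < n -> x0 u < d) ->
  (forall j, j < 3 -> (phiZ n d m cl (DnZ r) (wZ n d m A r j) <= DnZ r ^+ n * Posz M)%R) ->
  (10 ^- 15 * (Num.min (K * d)%:R (expR (K%:R / 8)) * #|[set c : 'I_m | satx n cl x0 c]|%:R)
     * d%:R ^- K <= M%:R :> R)%R.
Proof.
move=> K0 rge rle szK xd H.
have S0 : (0 < SR)%R by rewrite ltr0n expn_gt0.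
have [j [j3 g]] := gain (ctx_d2 ctx) (ctx_n0 ctx) K0 rge rle cl_le szK S0 xd ytR lamR0 lamRQ dualR QR.
have r0 : 0 < r by rewrite lt0n; apply/eqP => rz; move: rge; rewrite rz exp0n // leqNgt K0.
have M0 : (0 < MR)%R by rewrite /MR !mulr_gt0 // ltr0n /N muln_gt0 (ctx_n0 ctx).
have dR : (0 < d%:R :> R)%R by rewrite ltr0n.
have rR : (0 < r%:R :> R)%R by rewrite ltr0n.
have Dn0 : (0 < 8 * d%:R ^+ 2 * MR * r%:R)%R.
  by apply: mulr_gt0 => //; apply: mulr_gt0 => //; apply: mulr_gt0 => //; apply: exprn_gt0.
have h : ((phiZ n d m cl (DnZ r) (wZ n d m A r j))%:~R <= (8 * d%:R ^+ 2 * MR * r%:R) ^+ n * M%:R)%R.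
  by have := H j j3; rewrite -(ler_int R) intrM rmorphXn /= DnR.
have DnK : (0 < (8 * d%:R ^+ 2 * MR * r%:R) ^+ n)%R by rewrite exprn_gt0.
rewrite -(ler_pM2l DnK) mulrCA; apply: (le_trans _ h); apply: (le_trans g).
rewrite le_eqVlt; apply/orP; left; apply/eqP.
rewrite /phiZ rmorph_sum /= /phi; apply: eq_bigr => c _; rewrite rmorph_prod /=; apply: eq_bigr => u _.
case: eqP => _; first by rewrite DnR.
rewrite /wZ; cbv beta.
case: eqP => _; first by first [rewrite intrD DR ycR // | rewrite intrD -ycR -DR].
case: eqP => _; first by first [rewrite intrB DR ycR // | rewrite intrB -ycR -DR].
rewrite /p2 -heavyR intrM; congr (_ * _)%R; first by rewrite intrD intrM rmorph_nat.
by rewrite 2!intrM MtR intrM rmorph_nat -!pmulrn.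
Qed.
End RealBound.
End Main.

(** * Monotonicity in the clause length, and trivial cases *)

Lemma expR8_le2 (R : realType) : (expR (8^-1) <= 2 :> R)%R.
Proof.
have e0 := expR_gt0 (8^-1 : R)%R; have := expR_ge1Dx (- 8^-1 : R)%R; rewrite expRN => h.
have : ((1 - 8^-1) * expR (8^-1) <= 1 :> R)%R by rewrite -[X in (_ <= X)%R](mulVf (lt0r_neq0 e0)) ler_pM2r.
by move: e0; move: (expR _) => y; lra.
Qed.

(** Either branch at most doubles when [k] grows by one: [k + 1 <= 2 k] and [exp (1 / 8) <= 2]. The
    factor [d >= 2] covers this. *)
Lemma min_step (R : realType) k d : 0 < k -> 2 <= d ->
  (Num.min (k.+1 * d)%:R (expR (k.+1%:R / 8)) <= d%:R * Num.min (k * d)%:R (expR (k%:R / 8)) :> R)%R.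
Proof.
move=> k0 d2; case: (leP ((k * d)%:R : R)%R (expR (k%:R / 8))) => _; rewrite ge_min; apply/orP; [left|right].
  rewrite -natrM ler_nat mulnA leq_mul2r; apply/orP; right; apply: (@leq_trans (2 * k)).
    by rewrite mul2n -addnn -addn1 leq_add2l.
  by rewrite leq_mul2r d2 orbT.
have -> : (k.+1%:R / 8 = 8^-1 + k%:R / 8 :> R)%R by rewrite -natr1 mulrDl mul1r addrC.
rewrite expRD ler_wpM2r ?expR_ge0 //; apply: le_trans (expR8_le2 R) _.
by rewrite ler_nat.
Qed.

(** Relates [K = minn k n], with which the analysis works, to the [k] of the guarantee: passing to
    the smaller parameter only strengthens the bound. *)
Lemma min_antitone (R : realType) K k d : 0 < K -> K <= k -> 2 <= d ->
  (Num.min (k * d)%:R (expR (k%:R / 8)) / d%:R ^+ k <=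
   Num.min (K * d)%:R (expR (K%:R / 8)) / d%:R ^+ K :> R)%R.
Proof.
move=> K0 Kk d2; rewrite -(subnKC Kk); elim: (k - K) => [|i IH]; first by rewrite addn0.
apply: le_trans IH; rewrite addnS exprS invfM mulrA.
have d0 : (0 < d%:R :> R)%R by rewrite ltr0n ltnW.
apply: ler_wpM2r; first by rewrite invr_ge0 exprn_ge0 // ltW.
rewrite ler_pdivrMr // [X in (_ <= X)%R]mulrC; apply: min_step => //; exact: leq_trans K0 (leq_addr _ _).
Qed.

Lemma card_clauses0 d (P : csp 0 d) : #|clauses P| <= 1.
Proof.
rewrite -(cards1 (set0 : clause 0 d)); apply: subset_leq_card; apply/subsetP => C _.
by rewrite inE; apply/eqP/setP => -[[u hu] i].
Qed.

Lemma value_le_clauses n d (P : csp n d) x : value P x <= #|clauses P|.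
Proof. by apply: subset_leq_card; apply/subsetP => C; rewrite inE => /andP[]. Qed.

Lemma opt_le_clauses n d (P : csp n d) : opt P <= #|clauses P|.
Proof. by apply/bigmax_leqP => x _; apply: value_le_clauses. Qed.

Lemma opt_attained n d (P : csp n d) : 0 < d -> exists x, opt P = value P x.
Proof.
move=> d0; pose x0 : assignment n d := [ffun=> Ordinal d0].
have ex : exists v, [exists x : assignment n d, value P x == v].
  by exists (value P x0); apply/existsP; exists x0.
have ub v : [exists x : assignment n d, value P x == v] -> v <= #|clauses P|.
  by case/existsP => x /eqP <-; apply: value_le_clauses.
case: (ex_maxnP ex ub) => v /existsP[x /eqP <-] hv; exists x.
apply/eqP; rewrite eqn_leq; apply/andP; split; last by rewrite /opt (bigD1 x) //= leq_maxl.
by apply/bigmax_leqP => y _; apply: hv; apply/existsP; exists y.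
Qed.

Lemma min_gain_ge0 (R : realType) k d : (0 <= Num.min (k * d)%:R (expR (k%:R / 8)) :> R)%R.
Proof. by rewrite le_min ler0n expR_ge0. Qed.

Lemma target0 (R : realType) d (o : R) : (Num.min (0 * d)%:R (expR (0%:R / 8)) * o / d%:R ^+ 0 = 0)%R.
Proof. by rewrite mul0n mul0r expR0 (min_l ler01) !mul0r. Qed.

Lemma csp_vars_gt0 n d (P : csp n d) : 1 < #|clauses P| -> 0 < n.
Proof. by case: n P => // P; rewrite ltnNge card_clauses0. Qed.

Lemma gain_constant_le (R : realType) : (10 ^- 15 * 2 <= 1 :> R)%R.
Proof.
apply: (@le_trans _ _ (2^-1 * 2)%R); last by rewrite mulVf // pnatr_eq0.
by rewrite ler_pM2r // lef_pV2 ?posrE ?exprn_gt0 // -natrX ler_nat.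
Qed.

(** * Correctness of the program in both cases *)

Section Program.
Variables (R : realType) (k n d : nat) (P : csp n d) (p : conf) (V : nat -> nat).
Hypothesis d2 : 2 <= d.
Hypothesis kP : is_kcsp k P.
Let m := #|clauses P|.
Hypothesis p_inp : inp p = encode k P.
Hypothesis p_nu : nu p = (n + m + 2) ^ 30.
Hypothesis p_cap : cap p = d.+1 * 2 ^ ((n + m + 2) ^ 30).
Let B := sem p V (sem p V (fun _ _ => 0%R) s_parse) s_default.
Let target : R := (10 ^- 15 * (Num.min (k * d)%:R (expR (k%:R / 8)) * (opt P)%:R / d%:R ^+ k))%R.
Let d0 : 0 < d. Proof. exact: ltnW. Qed.

Lemma target_k0 x : k = 0 -> (target <= (value P x)%:R)%R.
Proof. by move=> e; rewrite /target e target0 mulr0 ler0n. Qed.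

Lemma targetE : target = (10 ^- 15 * (Num.min (k * d)%:R (expR (k%:R / 8)) / d%:R ^+ k * (opt P)%:R))%R.
Proof. by rewrite /target mulrAC. Qed.

(** Comparing with clause length 1, the guaranteed fraction is at most [2 / d] before the constant,
    and the optimum is at most [m <= d]. The target is thus at most [2 * 10 ^- 15], and the default
    assignment satisfies one clause if there is any. *)
Lemma few_clauses : m <= d -> exists x : assignment n d,
  (forall u : 'I_n, B 15 u = Posz (x u)) /\ (target <= (value P x)%:R)%R.
Proof.
move=> dm; have [_ _ h15] := default_ok p_inp p_nu p_cap (erefl B).
have xlt u : (clv P 0 u).-1 < d by have := clv_le P 0 u; move: d0; clear; lia.
exists [ffun u : 'I_n => Ordinal (xlt u)]; split; first by move=> u; rewrite ffunE h15.
case: (posnP k) => [k0|k0]; first exact: target_k0.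
rewrite targetE; case: (posnP m) => [m0|m0].
  have : opt P <= 0 by rewrite -m0; exact: opt_le_clauses.
  by rewrite leqn0 => /eqP ->; rewrite !mulr0 ler0n.
have v1 : 1 <= value P [ffun u : 'I_n => Ordinal (xlt u)].
  rewrite (@value_clv n d P _ (fun u => (clv P 0 u).-1)); last by move=> u; rewrite ffunE.
  apply/card_gt0P; exists (Ordinal m0); rewrite inE /satx /=; apply/forallP => u.
  by case: (clv P 0 u) => //= v; rewrite eqxx.
apply: (@le_trans _ _ 1%R); last by rewrite ler1n.
have h := @min_antitone R 1 k d isT k0 d2; rewrite mul1n expr1 in h.
have dR : (0 < d%:R :> R)%R by rewrite ltr0n.
have h2 : (Num.min d%:R (expR (1%:R / 8)) / d%:R <= 2 / d%:R :> R)%R.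
  apply: ler_wpM2r; first by rewrite invr_ge0 ltW.
  by rewrite ge_min mul1r expR8_le2 orbT.
have h3 : (Num.min (k * d)%:R (expR (k%:R / 8)) / d%:R ^+ k * (opt P)%:R <= 2 :> R)%R.
  have e2 : (2 / d%:R * d%:R = 2 :> R)%R by rewrite divfK // gt_eqF.
  rewrite -[X in (_ <= X)%R]e2.
  apply: ler_pM; [by rewrite divr_ge0 ?min_gain_ge0 ?exprn_ge0 ?ler0n | by rewrite ler0n | exact: le_trans h h2 |].
  by rewrite ler_nat; apply: leq_trans (opt_le_clauses P) dm.
have c0 : (0 < 10 ^- 15 :> R)%R by rewrite invr_gt0; apply: exprn_gt0.
by apply: (le_trans _ (gain_constant_le R)); rewrite (ler_pM2l c0).
Qed.

Lemma many_clauses V' : d < m -> exists x : assignment n d,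
  (forall u : 'I_n, sem p V' B s_main 15 u = Posz (x u)) /\ (target <= (value P x)%:R)%R.
Proof.
move=> dm; have [hcl hz _] := default_ok p_inp p_nu p_cap (erefl B).
(* Without variables the empty clause is the only possible one, which contradicts [2 <= d < m]. *)
have n0 : 0 < n by apply: (@csp_vars_gt0 n d P); apply: leq_trans dm; apply: ltnW.
have c2 : 2 ^ nu p <= cap p by rewrite p_nu p_cap leq_pmull.
have ctx : context p k n d m.
  by apply: (@Ctx p k n d m _ _ _ _ p_nu c2 n0 d2 dm); rewrite p_inp.
have cl_le c u : c < m -> u < n -> clv P c u <= d by move=> _ _; apply: clv_le.
have [x [A6 [r [Q [xd xo fl [rge rle] xphi]]]]] := main_run ctx cl_le R V' hcl hz.
pose xa : assignment n d := [ffun u : 'I_n => Ordinal (xd u (ltn_ord u))].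
have xaE (u : 'I_n) : x u = xa u by rewrite ffunE.
exists xa; split; first by move=> u; rewrite xo // xaE.
case: (posnP k) => [k0|k0]; first exact: target_k0.
have K0 : 0 < minn k n by rewrite leq_min k0.
have [xo0 oE] := opt_attained P d0.
pose x0 u : nat := if insub u is Some v then nat_of_ord (xo0 v) else 0.
have x0E (u : 'I_n) : x0 u = xo0 u by rewrite /x0 valK.
have x0d u : u < n -> x0 u < d by move=> un; rewrite /x0; case: insubP => [v _ _|]; rewrite ?un.
rewrite targetE oE (value_clv P x0E) (value_clv P xaE).
have szK c : c < m -> \sum_(u < n) (clv P c u != 0) <= minn k n.
  move=> cm; apply: leq_trans (sum_clv_le cm) _; rewrite leq_min kP ?nth_clause_in //.
  by apply: (card_clause_le (P := P)); apply: nth_clause_in.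
have g : (10 ^- 15 * (Num.min (minn k n * d)%:R (expR ((minn k n)%:R / 8)) *
    #|[set c : 'I_m | satx n (clv P) x0 c]|%:R) * d%:R ^- minn k n
    <= #|[set c : 'I_m | satx n (clv P) x c]|%:R :> R)%R.
  have rle' := rle K0.
  first [exact: (gain_int ctx cl_le R fl K0 rge rle' szK x0d xphi)
        |exact: (gain_int ctx cl_le fl K0 rge rle' szK x0d xphi)
        |eapply gain_int; eassumption].
have c0 : (0 < 10 ^- 15 :> R)%R by rewrite invr_gt0; apply: exprn_gt0.
have mo := @min_antitone R (minn k n) k d K0 (geq_minl k n) d2.
apply: (le_trans _ g); rewrite -[X in (_ <= X)%R]mulrA (ler_pM2l c0) [X in (_ <= X)%R]mulrAC.
by apply: ler_wpM2r; [exact: ler0n | exact: mo].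
Qed.

Lemma program_ok : exists x : assignment n d,
  (forall u : 'I_n, sem p V (fun _ _ => 0%R) program 15 u = Posz (x u)) /\ (target <= (value P x)%:R)%R.
Proof.
rewrite /program 2!sem_seq -/B.
have Eb : ev p V B (ed <^ em) = Posz (d < m).
  by rewrite evL /ed /em !(evI p_inp) !evC ltz_nat.
have nu1 b : nat_of_bool b <= nu p by apply: leq_trans (leq_b1 b) _; rewrite p_nu expn_gt0 addn2.
rewrite (sem_for _ _ Eb (nu1 _)).
by case: (ltnP d m) => dm; [exact: many_clauses | exact: few_clauses].
Qed.

End Program.

Local Open Scope ring_scope.

Theorem theorem2 (R : realType) :
  exists (A : prog) (T : {poly nat}) (c p : R),
    [/\ runs_in_time A T, 0 < c, 0 < p
      & forall (k d n : nat) (P : csp n d), (2 <= d)%N -> is_kcsp k P ->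
          p <= success_prob R A (encode k P) T.[input_size k P]
                 (fun s => exists x : assignment n d,
                    outputs s x /\
                    c * (Num.min (k * d)%:R (expR (k%:R / 8))
                         * (opt P)%:R / d%:R ^+ k)
                      <= (value P x)%:R)].
Proof.
(* The loop bound is the power [29 + 1 = 30] required by the magnitude levels, and array 15 holds
   the output. *)
have [T HT] := compile_correct 29 program 15.
exists (compile 30 program 15), T, (10 ^- 15), 1; split.
- move=> k d n P _ _ r; have [s [b [ex bt _]]] := HT k n d P r.
  by exists s, r, b.
- by rewrite invr_gt0 exprn_gt0.
- exact: ltr01.
move=> k d n P d2 kP; rewrite success_prob1 // => r.
have [s [b [ex _ me]]] := HT k n d P r; have [x [xo xv]] := @program_ok R k n d P (wconf 30 (encode k P)) (fun=> 0%N) d2 kP erefl erefl erefl.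
exists s, r, b; split=> //; exists x; split=> // u.
by rewrite me xo.
Qed.
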